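(* Let $N,d\ge1$ be integers, let $B$ be an $N$-parameter Brownian sheet with values in $\mathbb{R}^d$, and let $A\subset\mathbb{R}^d$ be a Borel set. For all integers $k\ge 2$, $$P\bigl\{\exists(\mathbf{t}^1,\ldots,\mathbf{t}^k)\in\mathcal{T}_N^k : B(\mathbf{t}^1)=\cdots=B(\mathbf{t}^k)\in A\bigr\}>0$$ if and only if $$P\bigl\{\exists(\mathbf{t}^1,\ldots,\mathbf{t}^k)\in\mathcal{T}_N^k : W_1(\mathbf{t}^1)=\cdots=W_k(\mathbf{t}^k)\in A\bigr\}>0,$$ where $W_1,\ldots,W_k$ are independent $N$-parameter Brownian sheets with values in $\mathbb{R}^d$.
   Context: An $N$-parameter Brownian sheet with values in $\mathbb{R}^d$ is a centered $\mathbb{R}^d$-valued Gaussian random field $B=(B^1,\ldots,B^d)$ with continuous sample paths, with parameter set $\mathbb{R}_+^N=[0,\infty)^N$ and covariances $\operatorname{Cov}(B^i(\mathbf{s}),B^j(\mathbf{t}))=\delta_{i,j}\prod_{\ell=1}^N (s_\ell\wedge t_\ell)$, where $\delta_{i,j}=1$ if $i=j$ and $0$ otherwise. Writing $\mathbf{t}^i=(t^i_1,\ldots,t^i_N)$, $\mathcal{T}_N^k$ is the set of $k$-tuples of parameters no two of which share a common coordinate: $$\mathcal{T}_N^k=\bigl\{(\mathbf{t}^1,\ldots,\mathbf{t}^k)\in\bigl((0,\infty)^N\bigr)^k : t^i_\ell\neq t^j_\ell \text{ for all } \ell=1,\ldots,N \text{ and } 1\le i<j\le k\bigr\}.$$ The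 probability $P$ is understood to be complete, so that the two events (projections of Borel sets) are measurable. *)

(* Defs.v *)
From mathcomp Require Import all_boot all_order all_algebra.
From mathcomp Require Import all_classical all_reals all_analysis.

Set Implicit Arguments.
Unset Strict Implicit.
Unset Printing Implicit Defensive.

Import Order.TTheory GRing.Theory Num.Theory.
Import numFieldTopology.Exports numFieldNormedType.Exports.

Local Open Scope classical_set_scope.
Local Open Scope ring_scope.

Definition orthant (R : realType) (N : nat) : set 'rV[R]_N :=
  [set t | forall l, 0 <= t 0 l].

Definition borel (R : realType) (d : nat) : set (set 'rV[R]_d) :=
  <<s [set U : set 'rV[R]_d | open U] >>.

(* Gaussian laws are allowed to be degenerate (Dirac masses). The case s = 0 is
   separated because [normal_prob m 0] is by convention uniform on [0, 1]. *)
Definition gaussian_rv (dT : measure_display) (T : measurableType dT)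
    (R : realType) (P : probability T R) (X : T -> R) : Prop :=
  measurable_fun setT X /\
  exists m s : R, 0 <= s /\
    forall U : set R, measurable U ->
      P (X @^-1` U) = if s == 0 then \d_m U else normal_prob m s U.

(* Random fields are represented by functions on all of R^N, but only their
   values on the closed orthant are ever constrained or used. *)
Definition gaussian_field (dT : measure_display) (T : measurableType dT)
    (R : realType) (P : probability T R) (N d : nat)
    (B : T -> 'rV[R]_N -> 'rV[R]_d) : Prop :=
  forall (n : nat) (t : 'I_n -> 'rV[R]_N) (c : 'I_n -> 'rV[R]_d),
    (forall j, orthant (t j)) ->
    gaussian_rv P
      (fun w => \sum_(j < n) \sum_(i < d) c j 0 i * B w (t j) 0 i).

Record brownian_sheet (dT : measure_display) (T : measurableType dT)
    (R : realType) (P : probability T R) (N d : nat)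
    (B : T -> 'rV[R]_N -> 'rV[R]_d) : Prop := BrownianSheet {
  bs_continuous : forall w : T, {within @orthant R N, continuous (B w)} ;
  bs_gaussian : gaussian_field P B ;
  bs_centered : forall (t : 'rV[R]_N) (i : 'I_d), orthant t ->
    ('E_P[fun w => (B w t 0 i)%R] = 0)%E ;
  bs_covariance : forall (s t : 'rV[R]_N) (i j : 'I_d),
    orthant s -> orthant t ->
    covariance P (fun w => B w s 0 i) (fun w => B w t 0 j) =
      ((i == j)%:R * \prod_(l < N) Num.min (s 0 l) (t 0 l))%:E
}.

Definition field_sigma_algebra (T : Type) (R : realType) (N d : nat)
    (X : T -> 'rV[R]_N -> 'rV[R]_d) : set (set T) :=
  <<s [set E : set T | exists t (U : set 'rV[R]_d),
         [/\ orthant t, borel U & E = (fun w => X w t) @^-1` U]] >>.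

Definition independent_fields (dT : measure_display) (T : measurableType dT)
    (R : realType) (P : probability T R) (N d k : nat)
    (W : 'I_k -> T -> 'rV[R]_N -> 'rV[R]_d) : Prop :=
  forall (J : {set 'I_k}) (E : 'I_k -> set T),
    (forall j, j \in J -> field_sigma_algebra (W j) (E j)) ->
    P (\bigcap_(j in [set` J]) E j) = (\prod_(j in J) P (E j))%E.

Definition distinct_coords (R : realType) (N k : nat) :
    set ('I_k -> 'rV[R]_N) :=
  [set t | (forall i l, 0 < t i 0 l) /\
           (forall l (i j : 'I_k), (i < j)%N -> t i 0 l <> t j 0 l)].

Definition coincidence_event (T : Type) (R : realType) (N d k : nat)
    (W : 'I_k -> T -> 'rV[R]_N -> 'rV[R]_d) (A : set 'rV[R]_d) : set T :=
  [set w | exists t : 'I_k -> 'rV[R]_N, distinct_coords t /\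
           exists x : 'rV[R]_d, A x /\ forall i, W i w (t i) = x].

(* Main.v *)
Require Import Defs.
From mathcomp Require Import all_boot all_order all_algebra.
From mathcomp Require Import all_classical all_reals all_analysis.
From HB Require Import structures.
From mathcomp Require Import measurable_realfun.
From mathcomp Require Import ring lra.

(** The coincidence event is a countable union, over families of disjoint rational
    boxes in (0, oo)^N (one for each of the k parameters), of the events that the
    compact random set of values common to the k boxes hits A. By Choquet's capacity
    argument such an event has positive probability iff some closed subset of A is
    hit with positive probability, and hitting a closed set is a cylinder event in
    the values of the field at countably many points. It remains to see that the
    values of one sheet on k disjoint boxes and the values of k independent sheets
    on the same boxes have the same null sets. On a box [a, b] subtract from the
    sheet the multilinear interpolation of its values at the 2^N corners: if no
    coordinate of t lies strictly inside [a, b], then each min(s_l, t_l) is affine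
    in s_l on [a_l, b_l], so the residual is uncorrelated with the field at t. Hence,
    in both models, the residuals of different boxes are independent of each other
    and of all the corner values, and their law is the same, while the finitely many
    corner values are jointly Gaussian with nondegenerate covariance. Replacing one
    corner value at a time, the null sets are in both models those of the product of
    the residual law with Lebesgue measure. *)

Set Implicit Arguments.
Unset Strict Implicit.
Unset Printing Implicit Defensive.

Import Order.TTheory GRing.Theory Num.Theory.
Import numFieldTopology.Exports numFieldNormedType.Exports.

Local Open Scope classical_set_scope.
Local Open Scope ring_scope.

(** * Cramer-Wold device on path spaces *)

(** The laws of the two models on the boxes differ, since the corner values of one sheet are
    correlated across boxes; only null sets can be compared, and only for events of the product
    sigma-algebra. Hitting a Borel set is an analytic event; capacity replaces the Borel set by a
    deterministic closed set, which can be carried from one probability space to the other.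
    Separation of the boxes in every coordinate keeps [min] affine across a box, and its strictness
    keeps the corner values linearly independent. Laws are handled through the real transforms
    [E cos (L + phi)] of all linear combinations [L]: the phase carries real and imaginary part
    together, a Gaussian family, degenerate or not, is one equation, and independence follows from
    equality with a product law. Linear combinations are formal lists of weighted indices, so
    interpolation, residuals and projections reduce to bilinear algebra of the covariance. *)

Section bounded_measurable.
Context d (T : measurableType d) (R : realType).
Implicit Types f g : T -> R.

Definition bounded_mfun f := measurable_fun setT f /\ exists M, forall x, `|f x| <= M.

Lemma bounded_mfun_cst c : bounded_mfun (fun=> c).
Proof. by split; [exact: measurable_cst|exists `|c|]. Qed.

Lemma bounded_mfunM f g : bounded_mfun f -> bounded_mfun g ->
  bounded_mfun (fun x => f x * g x).
Proof.
move=> [mf [M fM]] [mg [N gN]]; split; first exact: measurable_funM.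
by exists (M * N) => x; rewrite normrM ler_pM.
Qed.

Lemma bounded_mfunD f g : bounded_mfun f -> bounded_mfun g ->
  bounded_mfun (fun x => f x + g x).
Proof.
move=> [mf [M fM]] [mg [N gN]]; split; first exact: measurable_funD.
by exists (M + N) => x; rewrite (le_trans (ler_normD _ _))// lerD.
Qed.

Lemma bounded_mfun_cos f : measurable_fun setT f -> bounded_mfun (fun x => cos (f x)).
Proof.
move=> mf; split.
  apply: measurableT_comp => //; apply: continuous_measurable_fun.
  exact: continuous_cos.
by exists 1 => x; rewrite ler_norml cos_geN1 cos_le1.
Qed.

Lemma bounded_mfun_sin f : measurable_fun setT f -> bounded_mfun (fun x => sin (f x)).
Proof.
move=> mf; split.
  apply: measurableT_comp => //; apply: continuous_measurable_fun.
  exact: continuous_sin.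
by exists 1 => x; rewrite ler_norml sin_geN1 sin_le1.
Qed.

Lemma bounded_mfun_indic (b : T -> bool) : measurable [set x | b x] ->
  bounded_mfun (fun x => (b x)%:R).
Proof.
move=> mb; split; last by exists 1 => x; case: (b x); rewrite ?normr1 ?normr0.
rewrite (_ : (fun _ => _) = \1_[set x | b x]); first exact: measurable_indic.
by apply/funext => x; rewrite indicE; congr (nat_of_bool _)%:R; apply/idP/idP;
  rewrite inE.
Qed.

Section integral.
Variable P : probability T R.

Lemma bounded_mfun_integrable f : bounded_mfun f -> P.-integrable setT (EFin \o f).
Proof.
move=> [mf [M fM]]; apply: measurable_bounded_integrable => //.
  by rewrite [X in (X < _)%E]probability_setT ltry.
exists M; split; first by rewrite num_real.
by move=> N MN x _ /=; rewrite (le_trans (fM x))// ltW.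
Qed.

Lemma bounded_cvg_Rintegral (f_ : nat -> T -> R) f M :
  (forall n, measurable_fun setT (f_ n)) -> (forall n x, `|f_ n x| <= M) ->
  (forall x, f_ n x @[n --> \oo] --> f x) ->
  \int[P]_x f_ n x @[n --> \oo] --> \int[P]_x f x.
Proof.
move=> mf_ f_M f_f.
have mf : measurable_fun setT f by apply: (measurable_fun_cvg mf_) => x _; exact: f_f.
have fM x : `|f x| <= M.
  have h : `|f_ n x| @[n --> \oo] --> `|f x| by apply: cvg_norm; exact: f_f.
  rewrite -(cvg_lim (@norm_hausdorff _ _) h); apply: limr_le; last exact: nearW.
  by apply/cvg_ex; exists `|f x|.
have bf : bounded_mfun f by split => //; exists M.
have [] := @dominated_convergence _ _ _ P setT measurableT
  (fun n x => (f_ n x)%:E) (EFin \o f) (fun=> M%:E).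
- by move=> n; exact/measurable_EFinP.
- exact/measurable_EFinP.
- by apply: aeW => x _; apply: cvg_EFin; [exact: nearW|exact: f_f].
- exact: (bounded_mfun_integrable (bounded_mfun_cst M)).
- by apply: aeW => x n _; rewrite /= lee_fin.
move=> _ _ h; apply: fine_cvg; rewrite fineK; first exact: h.
apply: integrable_fin_num => //; exact: bounded_mfun_integrable.
Qed.

End integral.
End bounded_measurable.

(** * Polynomial approximation of a step function *)

Section steep_powers.
Context (R : realType).
Implicit Types (x u v : R) (n : nat).

Lemma bernoulli_le x n : 0 <= x <= 1 -> 1 - n%:R * x <= (1 - x) ^+ n.
Proof.
move=> /andP[x0 x1]; elim: n => [|n ih]; first by rewrite mul0r subr0 expr0.
have h : (1 - x) * (1 - n%:R * x) <= (1 - x) ^+ n.+1.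
  by rewrite exprS ler_wpM2l// subr_ge0.
apply: le_trans h; rewrite -natr1.
have : 0 <= n%:R * x ^+ 2 by rewrite mulr_ge0// sqr_ge0.
nra.
Qed.

Lemma bernoulli_ge x n : 0 <= x <= 1 -> (1 - x) ^+ n <= (1 + n%:R * x)^-1.
Proof.
move=> /andP[x0 x1].
have p m : 0 < 1 + m%:R * x by rewrite ltr_pwDl// mulr_ge0.
rewrite -[leRHS]div1r ler_pdivlMr//.
elim: n => [|n ih]; first by rewrite expr0 mul0r addr0 mul1r.
apply: le_trans ih; rewrite exprS -mulrA mulrCA ler_wpM2l//.
  by rewrite exprn_ge0// subr_ge0.
have := p n; rewrite -natr1.
have : 0 <= n%:R * x ^+ 2 by rewrite mulr_ge0// sqr_ge0.
have : 0 <= x ^+ 2 by rewrite sqr_ge0.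
nra.
Qed.

(** With [v = w ^ 2], one factor [w ^ m] absorbs [m] by Bernoulli and the other still tends to 0. *)
Lemma cvg_natMexpr v : 0 <= v < 1 -> m%:R * v ^+ m @[m --> \oo] --> (0 : R).
Proof.
move=> /andP[]; rewrite le_eqVlt => /predU1P[<- _|v0 v1].
  apply: cvg_near_cst; near=> m; rewrite expr0n.
  have -> : (m == 0)%N = false by apply/negbTE; rewrite -lt0n; near: m; exists 1.
  by rewrite mulr0.
set w := Num.sqrt v.
have w0 : 0 < w by rewrite sqrtr_gt0.
have w1 : w < 1 by rewrite -sqrtr1 ltr_sqrt.
have vE : v = w * w by rewrite -expr2 sqr_sqrtr// ltW.
have x01 : 0 <= 1 - w <= 1 by rewrite subr_ge0 (ltW w1)/= gerBl ltW.
have mC (m : nat) : m%:R * w ^+ m <= (1 - w)^-1.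
  have := bernoulli_ge m x01; rewrite subKr => h.
  apply: (le_trans (ler_wpM2l _ h)) => //.
  have p : 0 < 1 + m%:R * (1 - w).
    by rewrite ltr_pwDl// mulr_ge0// subr_ge0 ltW.
  rewrite ler_pdivrMr// mulrDr mulr1 mulrCA mulVf ?subr_eq0 ?gt_eqF// mulr1.
  by rewrite lerDr invr_ge0 subr_ge0 ltW.
apply: (@squeeze_cvgr _ _ _ _ (cst 0) (fun m => (1 - w)^-1 * w ^+ m)).
- apply: nearW => m; apply/andP; split; first by rewrite mulr_ge0// exprn_ge0// ltW.
  rewrite vE exprMn mulrA; apply: ler_wpM2r => //; exact/exprn_ge0/ltW.
- exact: cvg_cst.
- rewrite -[X in _ --> X](mulr0 (1 - w)^-1); apply: cvgMr.
  by apply: cvg_expr; rewrite gtr0_norm.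
Unshelve. all: by end_near. Qed.

(* The exponent [n * 2 ^ n] makes the steps also converge at [u = 1/2]. *)
Lemma cvg_step u : 0 <= u <= 1 ->
  (1 - u ^+ n) ^+ (n * 2 ^ n) @[n --> \oo] --> ((u < 2^-1)%R%:R : R).
Proof.
move=> /andP[u0 u1].
have un n : 0 <= u ^+ n <= 1 by rewrite exprn_ge0//= exprn_ile1.
(* With [m = n * 2 ^ n], the product [m * u ^ n] equals [n * (2 * u) ^ n]: it tends to 0 below 1/2
   and is at least [n] from 1/2 on, so the two Bernoulli bounds settle both cases. *)
have nE n : (n * 2 ^ n)%:R * u ^+ n = n%:R * (2 * u) ^+ n.
  by rewrite natrM natrX exprMn mulrA.
case: ltP => /= u2.
- apply: (@squeeze_cvgr _ _ _ _ (fun n => 1 - n%:R * (2 * u) ^+ n) (cst 1)).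
  + apply: nearW => n; rewrite -nE bernoulli_le//= exprn_ile1 ?subr_ge0 ?gerBl//.
    * by have /andP[] := un n.
    * by have /andP[] := un n.
  + rewrite -[X in _ --> X]subr0; apply: cvgB; first exact: cvg_cst.
    by apply: cvg_natMexpr; rewrite mulr_ge0//= mulrC -ltr_pdivlMr// div1r.
  + exact: cvg_cst.
- apply: (@squeeze_cvgr _ _ _ _ (cst 0) (fun n => (n%:R + 1)^-1)).
  + apply: nearW => n; rewrite exprn_ge0 ?subr_ge0/=; last by have /andP[] := un n.
    apply: le_trans (bernoulli_ge _ (un n)) _.
    rewrite lef_pV2 ?posrE; [|by rewrite ltr_pwDl// mulr_ge0//; case/andP: (un n)
      |by rewrite ltr_wpDl].
    rewrite addrC lerD2l nE ler_peMr// exprn_ege1//.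
    by rewrite mulrC -ler_pdivrMr// div1r.
  + exact: cvg_cst.
  + under eq_fun do rewrite natr1; exact: cvg_harmonic.
Qed.

End steep_powers.

(** * Path spaces and finite linear combinations *)

Section paths.
Context (R : realType) (I : Type).

Definition cylinders : set (set (I -> R)) :=
  [set E | exists i (U : set R), measurable U /\ E = [set y | U (y i)]].

(** The product sigma-algebra, for an index type of any cardinality. *)
Definition pathspace := g_sigma_algebraType cylinders.

Lemma measurable_coord (i : I) : measurable_fun setT (fun y : pathspace => y i : R).
Proof.
by move=> _ U mU; rewrite setTI; apply: sub_sigma_algebra; exists i, U.
Qed.

Lemma measurable_path d (T : measurableType d) (X : T -> pathspace) :
  (forall i, measurable_fun setT (fun w => X w i : R)) -> measurable_fun setT X.
Proof.
move=> mX; refine (@measurability _ _ T pathspace setT X cylinders erefl _).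
by move=> _ [_ [i [U [mU ->]]] <-]; exact: mX.
Qed.

Definition lin (y : I -> R) (s : seq (R * I)) := \sum_(p <- s) p.1 * y p.2.

Lemma measurable_lin d (T : measurableType d) (X : T -> I -> R) s :
  (forall i, measurable_fun setT (fun w => X w i)) ->
  measurable_fun setT (fun w => lin (X w) s).
Proof.
move=> mX; rewrite /lin.
apply: measurable_sum => p; apply: measurable_funM => //.
Qed.

End paths.

(** * Uniqueness of a law from its cosine transforms *)

Section cramer_wold.
Context (R : realType) (I : Type).
Notation pathspace := (pathspace R I).
Variables mu nu : probability pathspace R.

(** Under the weight [q], which may change sign, [mu] and [nu] have equal characteristic functions.
    The phase [phi] covers cosine and sine at once, so everything stays real. *)
Definition same_char (q : pathspace -> R) := bounded_mfun q /\
  forall s phi, \int[mu]_y (q y * cos (lin y s + phi)) =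
                \int[nu]_y (q y * cos (lin y s + phi)).

(* Closed under sums, products and bounded limits and containing the sines: enough
   to reach indicators of half-lines without Fourier inversion. *)
Definition char_multiplier (r : pathspace -> R) :=
  forall q, same_char q -> same_char (fun y => q y * r y).

Let mlin s phi : measurable_fun setT (fun y : pathspace => lin y s + phi : R).
Proof.
by apply: measurable_funD => //; apply: measurable_lin; exact: measurable_coord.
Qed.

Let bcos q s phi : bounded_mfun q -> bounded_mfun (fun y : pathspace => q y * cos (lin y s + phi)).
Proof. by move=> bq; apply: bounded_mfunM => //; apply: bounded_mfun_cos. Qed.

Lemma char_multiplier_cst c : char_multiplier (fun=> c).
Proof.
move=> q [bq eq]; split; first exact: bounded_mfunM (bounded_mfun_cst _ c).
have h (m : probability pathspace R) s phi : \int[m]_y (q y * c * cos (lin y s + phi)) =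
  c * \int[m]_y (q y * cos (lin y s + phi)).
  rewrite -RintegralZl//; last exact/bounded_mfun_integrable/bcos.
  by apply: eq_Rintegral => y _; rewrite mulrCA mulrA.
by move=> s phi; rewrite !h eq.
Qed.

Lemma char_multiplierD f g : char_multiplier f -> char_multiplier g ->
  char_multiplier (fun y => f y + g y).
Proof.
move=> Mf Mg q qq; have [bf ef] := Mf _ qq; have [bg eg] := Mg _ qq.
have E : (fun y => q y * (f y + g y)) = (fun y => q y * f y + q y * g y).
  by apply/funext => y; rewrite mulrDr.
rewrite E; split; first exact: bounded_mfunD.
have h (m : probability pathspace R) s phi :
    \int[m]_y ((q y * f y + q y * g y) * cos (lin y s + phi)) =
    \int[m]_y (q y * f y * cos (lin y s + phi)) +
    \int[m]_y (q y * g y * cos (lin y s + phi)).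
  rewrite -RintegralD//; [|exact/bounded_mfun_integrable/bcos..].
  by apply: eq_Rintegral => y _; rewrite mulrDl.
by move=> s phi; rewrite !h ef eg.
Qed.

Lemma char_multiplierM f g : char_multiplier f -> char_multiplier g ->
  char_multiplier (fun y => f y * g y).
Proof.
move=> Mf Mg q /Mf/Mg; under eq_fun do rewrite -mulrA; exact.
Qed.

Lemma char_multiplierX f n : char_multiplier f -> char_multiplier (fun y => f y ^+ n).
Proof.
move=> Mf; elim: n => [|n ih].
  by under eq_fun do rewrite expr0; exact: char_multiplier_cst.
by under eq_fun do rewrite exprS; exact: char_multiplierM.
Qed.

Lemma char_multiplier_cvg (f_ : nat -> pathspace -> R) f :
  (forall n, char_multiplier (f_ n)) -> (forall n, measurable_fun setT (f_ n)) ->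
  (forall n y, `|f_ n y| <= 1) -> (forall y, f_ n y @[n --> \oo] --> f y) ->
  char_multiplier f.
Proof.
move=> Mf mf_ f1 ff q qq; have [[mq [M qM]] eq] := qq.
have mf : measurable_fun setT f by apply: (measurable_fun_cvg mf_) => x _; exact: ff.
split.
  apply: bounded_mfunM; first by split => //; exists M.
  split => //; exists 1 => y.
  have h : `|f_ n y| @[n --> \oo] --> `|f y| by apply: cvg_norm; exact: ff.
  rewrite -(cvg_lim (@norm_hausdorff _ _) h); apply: limr_le; last exact: nearW.
  by apply/cvg_ex; exists `|f y|.
move=> s phi.
have h (m : probability pathspace R) :
    \int[m]_y (q y * f_ n y * cos (lin y s + phi)) @[n --> \oo] -->
    \int[m]_y (q y * f y * cos (lin y s + phi)).
  apply: (@bounded_cvg_Rintegral _ _ _ _ _ _ M).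
  - move=> n; apply: measurable_funM; first exact: measurable_funM.
    exact: (bounded_mfun_cos (mlin s phi)).1.
  - move=> n y; rewrite !normrM -[leRHS]mulr1 ler_pM//.
      by rewrite -[leRHS]mulr1 ler_pM.
    by rewrite ler_norml cos_geN1 cos_le1.
  - by move=> y; apply: cvgM; [apply: cvgM => //|]; exact: cvg_cst.
apply: (cvg_unique (@norm_hausdorff _ R) (h mu)).
have -> : (fun n => \int[mu]_y (q y * f_ n y * cos (lin y s + phi))) =
          (fun n => \int[nu]_y (q y * f_ n y * cos (lin y s + phi))).
  by apply/funext => n; have [_ ->] := Mf n q qq.
exact: h.
Qed.

(** Product-to-sum: multiplying by the sine adds [c] or [- c] to the linear form at [i], and the
    phase [- pi / 2] turns the resulting sines into cosines. *)
Lemma char_multiplier_sin c i b : char_multiplier (fun y => sin (c * y i + b)).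
Proof.
move=> q [bq eq].
have ms : measurable_fun setT (fun y : pathspace => c * y i + b : R).
  apply: measurable_funD => //; apply: measurable_funM => //; exact: measurable_coord.
split; first by apply: bounded_mfunM => //; exact: bounded_mfun_sin.
have h (m : probability pathspace R) s phi :
    \int[m]_y (q y * sin (c * y i + b) * cos (lin y s + phi)) =
    2^-1 * (\int[m]_y (q y * cos (lin y ((c, i) :: s) + (b + phi - pi / 2))) -
            \int[m]_y (q y * cos (lin y ((- c, i) :: s) + (phi - b - pi / 2)))).
  rewrite -RintegralB//; [|exact/bounded_mfun_integrable/bcos..].
  rewrite -RintegralZl//; last first.
    apply: bounded_mfun_integrable.
    have -> : (fun y : pathspace => q y * cos (lin y ((c, i) :: s) + (b + phi - pi / 2)) -
      q y * cos (lin y ((- c, i) :: s) + (phi - b - pi / 2))) =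
      (fun y => q y * cos (lin y ((c, i) :: s) + (b + phi - pi / 2)) +
      (-1) * (q y * cos (lin y ((- c, i) :: s) + (phi - b - pi / 2)))).
      by apply/funext => y; rewrite mulN1r.
    apply: bounded_mfunD; first exact: bcos.
    by apply: bounded_mfunM; [exact: bounded_mfun_cst|exact: bcos].
  apply: eq_Rintegral => y _; rewrite /lin !big_cons /= -!/(lin y s).
  set a := c * y i + b; set l := lin y s + phi.
  have -> : c * y i + lin y s + (b + phi - pi / 2) = a + l - pi / 2 by rewrite /a /l; lra.
  have -> : - c * y i + lin y s + (phi - b - pi / 2) = l - a - pi / 2 by rewrite /a /l; lra.
  clearbody a l; rewrite !cosB cos_pihalf sin_pihalf !mulr0 !mulr1 !add0r sinD sinB; by field.
by move=> s phi; rewrite !h !eq.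
Qed.

(** The function [u = (1 - sin) / 2] takes values in [0, 1] and is below 1/2 exactly where the sine
    is positive, so the polynomials of [cvg_step] in [u] converge to the indicator. *)
Lemma char_multiplier_sin_gt0 c i b :
  char_multiplier (fun y => (0 < sin (c * y i + b))%R%:R).
Proof.
pose u y := 2^-1 * (1 - sin (c * y i + b)).
have u01 y : 0 <= u y <= 1.
  by rewrite /u; have := sin_geN1 (c * y i + b); have := sin_le1 (c * y i + b); lra.
have Mu n : char_multiplier (fun y => (1 - u y ^+ n) ^+ (n * 2 ^ n)).
  apply: char_multiplierX.
  have -> : (fun y : pathspace => 1 - u y ^+ n) = (fun y => 1 + (-1) * u y ^+ n).
    by apply/funext => y; rewrite mulN1r.
  apply: char_multiplierD; first exact: char_multiplier_cst.
  apply: char_multiplierM; first exact: char_multiplier_cst.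
  apply: char_multiplierX; apply: char_multiplierM; first exact: char_multiplier_cst.
  have -> : (fun y : pathspace => 1 - sin (c * y i + b)) = (fun y => 1 + (-1) * sin (c * y i + b)).
    by apply/funext => y; rewrite mulN1r.
  apply: char_multiplierD; first exact: char_multiplier_cst.
  apply: char_multiplierM; first exact: char_multiplier_cst.
  exact: char_multiplier_sin.
apply: (char_multiplier_cvg Mu).
- move=> n; apply: measurable_funX; apply: measurable_funB => //.
  apply: measurable_funX; apply: measurable_funM => //; apply: measurable_funB => //.
  apply: (bounded_mfun_sin _).1; apply: measurable_funD => //.
  apply: measurable_funM => //; exact: measurable_coord.
- move=> n y; have /andP[u0 u1] := u01 y.
  have un : 0 <= 1 - u y ^+ n <= 1.
    by rewrite subr_ge0 gerBl exprn_ge0// exprn_ile1.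
  case/andP: un => un0 un1.
  by rewrite ger0_norm ?exprn_ge0// exprn_ile1.
- move=> y; have := cvg_step (u01 y).
  suff -> : (u y < 2^-1) = (0 < sin (c * y i + b)) by [].
  by apply/idP/idP; rewrite /u; lra.
Qed.

(** The sine of [(y i - x) / (n + 1)] has the sign of [y i - x] as soon as
    [|y i - x| / (n + 1) < pi], so at low frequency the periodic indicator becomes that of a
    half-line. *)
Lemma char_multiplier_gt i x : char_multiplier (fun y => (x < y i)%R%:R).
Proof.
apply: (char_multiplier_cvg
  (fun n => @char_multiplier_sin_gt0 n.+1%:R^-1 i (- (n.+1%:R^-1 * x)))).
- move=> n; set f := fun y : pathspace => sin (n.+1%:R^-1 * y i + - (n.+1%:R^-1 * x)).
  have mf : measurable_fun setT f.
    apply: (bounded_mfun_sin _).1; apply: measurable_funD => //.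
    apply: measurable_funM => //; exact: measurable_coord.
  apply: (@bounded_mfun_indic _ pathspace R (fun y => 0 < f y)%R _).1.
  have := mf measurableT _ (measurable_itv `]0, +oo[).
  rewrite setTI; congr measurable; apply/seteqP; split => y /=;
   by rewrite in_itv/= andbT.
- by move=> n y; case: (_ < _); rewrite ?normr1 ?normr0.
- move=> y; apply: cvg_near_cst.
  have := @cvg_harmonic R; move/cvgrPdist_lt => /(_ (pi / (`|y i - x| + 1)))[].
    by rewrite divr_gt0 ?pi_gt0 ?ltr_wpDl.
  move=> N _ HN; near=> n; congr (nat_of_bool _)%:R.
  have {HN} := HN n; rewrite /= sub0r normrN ger0_norm// => /(_ _)HN.
  have hN : n.+1%:R^-1 < pi / (`|y i - x| + 1) :> R by apply: HN; near: n; exists N.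
  rewrite -mulrBr; set k := n.+1%:R^-1 in hN *; set t := y i - x in hN *.
  have -> : (x < y i) = (0 < t) by rewrite subr_gt0.
  have k0 : 0 < k by rewrite invr_gt0.
  have kp : k * `|t| < pi.
    apply: le_lt_trans (_ : k * (`|t| + 1) < pi); first by apply: ler_wpM2l; [exact: ltW|rewrite lerDl].
    by rewrite -ltr_pdivlMr// ltr_wpDl.
  case: (ltrgtP 0 t) => t0.
  - by rewrite sin_gt0_pi// mulr_gt0//= -(gtr0_norm t0).
  - apply/negbTE; rewrite -leNgt -[k * t]opprK sinN oppr_le0 ltW//.
    by rewrite sin_gt0_pi// -mulrN mulr_gt0 ?oppr_gt0//= -(ltr0_norm t0).
  - by rewrite -t0 mulr0 sin0 ltxx.
Unshelve. all: by end_near. Qed.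

End cramer_wold.

(** Finite intersections of half-spaces form a generating pi-system, and their indicators arise from
    the constant 1 by multipliers. The empty combination with phase 0 then reads off the measure. *)
Theorem cramer_wold (R : realType) (I : Type) (mu nu : probability (pathspace R I) R) :
  (forall s phi, \int[mu]_y cos (lin y s + phi) = \int[nu]_y cos (lin y s + phi)) ->
  forall E, measurable E -> mu E = nu E.
Proof.
move=> H.
pose box (s : seq (I * R)) := [set y : pathspace R I | all (fun p => p.2 < y p.1)%R s].
pose G := range box.
have mbox s : measurable (box s).
  elim: s => [|p s ih]; first by rewrite (_ : box _ = setT)//; exact/seteqP.
  rewrite (_ : box _ = [set y : pathspace R I | (p.2 < y p.1)%R] `&` box s); last first.
    by apply/seteqP; split => y; [move=> /andP[a b]; split|case=> a b; apply/andP; split].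
  apply: measurableI => //.
  have := @measurable_coord R I p.1 measurableT _ (measurable_itv `]p.2, +oo[).
  rewrite setTI; congr measurable; apply/seteqP; split => y /=;
   by rewrite in_itv/= andbT.
have sc : same_char mu nu (fun=> 1).
  split; first exact: bounded_mfun_cst.
  have E (m : probability (pathspace R I) R) s phi :
    \int[m]_y (1 * cos (lin y s + phi)) = \int[m]_y cos (lin y s + phi).
    by apply: eq_Rintegral => y _; rewrite mul1r.
  by move=> s phi; rewrite !E.
have sbox s : same_char mu nu (fun y => (all (fun p => p.2 < y p.1)%R s)%:R).
  elim: s => [|p s ih]; first exact: sc.
  have := @char_multiplier_gt _ _ mu nu p.1 p.2 _ ih.
  by under eq_fun do rewrite -natrM mulnb andbC.
apply: (@measure_unique _ _ _ G (fun=> setT)).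
- apply/seteqP; split; last first.
    by apply: smallest_sub; [exact: sigma_algebra_measurable|move=> _ [s _ <-]].
  apply: smallest_sub; first exact: smallest_sigma_algebra.
  move=> _ [i [U [mU ->]]].
  pose f (y : g_sigma_algebraType G) : R := (y : I -> R) i.
  have mf : measurable_fun setT f.
    apply: (measurability (@RGenOInfty.G R)); first exact: RGenOInfty.measurableE.
    move=> _ [_ [x ->] <-]; rewrite setTI; apply: sub_sigma_algebra.
    exists [:: (i, x)] => //; apply/seteqP; split => y; rewrite /box /f/= in_itv/= !andbT//.
  by have := mf measurableT _ mU; rewrite setTI.
- move=> _ _ [s _ <-] [t _ <-]; exists (s ++ t) => //.
  by apply/seteqP; split => y; rewrite /box/= all_cat => /andP.
- by move=> _; exists [::] => //; exact/seteqP.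
- by apply/seteqP; split => // y _; exists 0%N.
- move=> _ [s _ <-].
  have h (m : probability (pathspace R I) R) :
    m (box s) = (\int[m]_y ((all (fun p => p.2 < y p.1)%R s)%:R * cos (lin y [::] + 0)))%:E.
    rewrite /lin; under eq_Rintegral do rewrite big_nil addr0 cos0 mulr1.
    rewrite /Rintegral fineK; last first.
      apply: integrable_fin_num => //; apply: bounded_mfun_integrable.
      exact: (sbox s).1.
    rewrite -[X in m X = _](setIT (box s)) -integral_indic//; apply: eq_integral => y _.
    by rewrite indicE; congr (nat_of_bool _)%:R%:E; apply/idP/idP; rewrite inE.
  by apply: etrans (h mu) (etrans _ (esym (h nu))); rewrite (sbox s).2.
- by move=> _; rewrite [X in (X < _)%E]probability_setT ltry.
Qed.

(** * Integrals of derivatives over the whole line *)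

Section ftc_line.
Context (R : realType).
Notation leb := (@lebesgue_measure R).

Lemma Rintegral_derive_eq0 (f F : R -> R) :
  (forall x : R, is_derive x (1 : R) F (f x)) -> continuous f -> leb.-integrable setT (EFin \o f) ->
  F x @[x --> +oo] --> 0 -> F x @[x --> -oo] --> 0 ->
  \int[leb]_x f x = 0.
Proof.
move=> dF cf intf Fy FNy.
have cF : continuous F.
  move=> x; apply: differentiable_continuous; apply/derivable1_diffP.
  exact: (@ex_derive _ _ _ _ _ _ _ (dF x)).
have shift : n.+1 @[n --> \oo] --> \oo.
  by move=> A [M _ MA]; exists M => // n /= Mn; apply: MA => /=; exact: leqW.
(* The endpoint [n + 1] keeps the interval nondegenerate at [n = 0], as [continuous_FTC2]
   requires. *)
pose K n : set R := [set` `[- n.+1%:R, n.+1%:R]].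
have mK n : measurable (K n) by exact: measurable_itv.
have mf : measurable_fun setT f by exact: continuous_measurable_fun.
have FTC n : \int[leb]_(x in K n) f x = F n.+1%:R - F (- n.+1%:R).
  rewrite /Rintegral (@continuous_FTC2 _ f F)//.
  - by rewrite (@lt_trans _ _ 0)// oppr_lt0.
  - by apply: continuous_subspaceT => x; exact: cf.
  - split; first by move=> x _; exact: (@ex_derive _ _ _ _ _ _ _ (dF x)).
    + exact: cvg_at_right_filter (cF _).
    + exact: cvg_at_left_filter (cF _).
  - by move=> x _; rewrite derive1E; exact: (@derive_val _ _ _ _ _ _ _ (dF x)).
have c1 : \int[leb]_(x in K n) f x @[n --> \oo] --> 0.
  have -> : (fun n => \int[leb]_(x in K n) f x) = (fun n => F n.+1%:R - F (- n.+1%:R)).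
    by apply/funext => n; exact: FTC.
  rewrite -[X in _ --> X](subrr 0); apply: cvgB.
    apply: (cvg_comp _ _ _ Fy); apply: (@cvg_comp _ _ _ S (fun n => n%:R) _ \oo).
      exact: shift.
    exact: cvgr_idn.
  apply: (cvg_comp _ _ _ FNy); apply/cvgNry.
  rewrite (_ : - _ = fun n => n.+1%:R); last by apply/funext => n; rewrite /= opprK.
  apply: (@cvg_comp _ _ _ S (fun n => n%:R) _ \oo); last exact: cvgr_idn.
  exact: shift.
apply: (cvg_unique (@norm_hausdorff _ R) _ c1).
have [] := @dominated_convergence _ _ _ leb setT measurableT
  (fun n x => (f \_ (K n) x)%:E) (EFin \o f) (fun x => `|f x|%:E).
- by move=> n; apply/measurable_EFinP; apply/(measurable_restrictT _ (mK n)); exact: measurable_funTS.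
- exact/measurable_EFinP.
- apply: aeW => x _; apply: cvg_EFin; first exact: nearW.
  apply: cvg_near_cst; near=> n; rewrite /= patchE mem_set// /K/= in_itv/= -ler_norml.
  rewrite (@le_trans _ _ n%:R)// ?ler_nat//; near: n; exact: nbhs_infty_ger.
- exact: integrable_norm.
- apply: aeW => x n _; rewrite /= lee_fin patchE; case: ifP => //= _.
  by rewrite normr0.
move=> _ _ h.
have -> : (fun n => \int[leb]_(x in K n) f x) =
  (fun n => fine (\int[leb]_x (f \_ (K n) x)%:E)%E).
  by apply/funext => n; rewrite Rintegral_mkcond.
apply: fine_cvg; rewrite fineK; first exact: h.
exact: integrable_fin_num.
Unshelve. all: by end_near. Qed.

End ftc_line.

(** * Moments and cosine transform of the normal law *)

Section normal_moments.
Context (R : realType) (m s : R) (s0 : s != 0).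
Notation leb := (@lebesgue_measure R).
Notation g := (normal_pdf m s).

Lemma is_derive_normal_pdf (x : R) : is_derive x (1 : R) g (- ((x - m) / s ^+ 2) * g x).
Proof.
have -> : g = (fun x => normal_peak s * expR (- (x - m) ^+ 2 / (s ^+ 2 *+ 2))).
  by rewrite normal_pdfE.
have h : is_derive x (1 : R) (fun x : R => - (x - m) ^+ 2 / (s ^+ 2 *+ 2)) (- ((x - m) / s ^+ 2)).
  have h1 : is_derive x (1 : R) (fun x : R => x - m) 1.
    by apply: (is_derive_eq (is_deriveD (is_derive_id x 1) (is_derive_cst (- m) x 1))); rewrite addr0.
  have h2 := is_deriveM h1 h1.
  have h3 := is_deriveM (is_derive_cst (- (s ^+ 2 *+ 2)^-1) x 1) h2.
  have -> : (fun x : R => - (x - m) ^+ 2 / (s ^+ 2 *+ 2)) =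
    (cst (- (s ^+ 2 *+ 2)^-1) * ((fun x : R => x - m) * (fun x : R => x - m)))%R.
    by apply/funext => z /=; rewrite !fctE expr2 mulNr mulrC mulNr.
  apply: (is_derive_eq h3); rewrite /GRing.scale/= ?fctE /cst/=; by field.
have h4 := is_derive1_comp (is_derive_expR _) h.
have h5 := is_deriveM (is_derive_cst (normal_peak s) x 1) h4.
apply: (is_derive_eq h5); rewrite /GRing.scale/= /cst/=; by ring.
Qed.

Let y2 x := (x - m) ^+ 2 / (s ^+ 2 *+ 2).

Let y2_ge0 x : 0 <= y2 x.
Proof. by rewrite divr_ge0 ?sqr_ge0// mulrn_wge0 ?sqr_ge0. Qed.

Let y2E x : (x - m) ^+ 2 = y2 x * (s ^+ 2 *+ 2).
Proof. by rewrite /y2 divfK// mulrn_eq0 /= sqrf_eq0. Qed.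

Let gE x : g x = normal_peak s * expR (- y2 x).
Proof. by rewrite normal_pdfE// /normal_fun /y2 mulNr. Qed.

Lemma normal_pdf_decay (p : R -> R) (K : R) : (forall x, `|p x| <= K * (1 + `|x - m|)) ->
  exists2 C, 0 <= C & forall x, x != m -> `|p x * g x| <= C / `|x - m|.
Proof.
(* With [z = |x - m|] and [z ^ 2 = 2 * s ^ 2 * y2], the constant comes from
   [z + z ^ 2 <= 1/2 + 3/2 * z ^ 2], combined with [expR (- y2) <= 1 / (1 + y2)]. *)
move=> hp; exists (K * normal_peak s * (2^-1 + 3 * s ^+ 2)).
  rewrite !mulr_ge0 ?normal_peak_ge0//.
    by have := le_trans (normr_ge0 _) (hp m); rewrite subrr normr0 addr0 mulr1.
  by rewrite addr_ge0// mulr_ge0// sqr_ge0.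
have K0 : 0 <= K by have := le_trans (normr_ge0 _) (hp m); rewrite subrr normr0 addr0 mulr1.
move=> x xm; rewrite normrM [`|g x|]ger0_norm ?normal_pdf_ge0// gE.
apply: le_trans (ler_wpM2r _ (hp x)) _.
  by rewrite mulr_ge0 ?normal_peak_ge0 ?expR_ge0.
rewrite -!mulrA; apply: ler_wpM2l => //; rewrite mulrCA; apply: ler_wpM2l; first exact: normal_peak_ge0.
have n0 : 0 < `|x - m| by rewrite normr_gt0 subr_eq0.
rewrite ler_pdivlMr// expRN mulrAC ler_pdivrMr ?expR_gt0//.
apply: le_trans (_ : (1 + `|x - m|) * `|x - m| <= _); first by rewrite ler_wpM2r.
apply: le_trans (ler_wpM2l _ (expR_ge1Dx (y2 x))); last first.
  by rewrite addr_ge0// mulr_ge0// sqr_ge0.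
have e2 : `|x - m| ^+ 2 = y2 x * (s ^+ 2 *+ 2) by rewrite real_normK ?num_real// y2E.
have := y2_ge0 x; have := sqr_ge0 s; have := sqr_ge0 (`|x - m| - 1).
rewrite mulr2n in e2; move: (y2 x) (s ^+ 2) `|x - m| e2 => a b c e2.
nra.
Qed.

Lemma cvg_normal_pdf0 (p : R -> R) (K : R) : (forall x, `|p x| <= K * (1 + `|x - m|)) ->
  p x * g x @[x --> +oo] --> 0 /\ p x * g x @[x --> -oo] --> 0.
Proof.
move=> /normal_pdf_decay[C C0 hC].
have main x e : 0 < e -> `|x - m| > C / e -> `|p x * g x| < e.
  move=> e0 xe; have n0 : 0 < `|x - m| by apply: le_lt_trans xe; rewrite divr_ge0// ltW.
  apply: le_lt_trans (hC x _) _; first by rewrite -subr_eq0 -normr_gt0.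
  by rewrite ltr_pdivrMr// mulrC -ltr_pdivrMr.
split; apply/cvgr0Pnorm_lt => e e0.
- near=> x; apply: main => //.
  have : m + C / e < x by near: x; apply: nbhs_pinfty_gt; exact: num_real.
  rewrite -ltrBrDl => h; apply: lt_le_trans h _; exact: ler_norm.
- near=> x; apply: main => //.
  have : x < m - C / e by near: x; apply: nbhs_ninfty_lt; exact: num_real.
  rewrite -normrN => h; apply: lt_le_trans (_ : - (x - m) <= _); last exact: ler_norm.
  lra.
Unshelve. all: by end_near. Qed.

(** Half of the exponent absorbs the quadratic growth of [p]; the other half is, up to a constant,
    the normal density of variance [2 * s ^ 2], whence [s' = s * sqrt 2]. *)
Lemma integrable_normal_pdfM (p : R -> R) (K : R) : measurable_fun setT p ->
  (forall x, `|p x| <= K * (1 + (x - m) ^+ 2)) ->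
  leb.-integrable setT (EFin \o (fun x => p x * g x)).
Proof.
move=> mp hp.
pose s' := s * Num.sqrt 2.
have s'0 : s' != 0 by rewrite mulf_neq0// gt_eqF// sqrtr_gt0.
pose K' := K * (1 + s ^+ 2 *+ 2 *+ 2) * normal_peak s / normal_peak s'.
have K0 : 0 <= K by have := le_trans (normr_ge0 _) (hp m); rewrite subrr expr0n/= addr0 mulr1.
have I2 : leb.-integrable setT (fun x => K'%:E * (normal_pdf m s' x)%:E)%E.
  by apply: integrableZl => //; exact: integrable_normal_pdf.
apply: (le_integrable _ _ _ I2) => //.
- apply/measurable_EFinP; apply: measurable_funM => //; exact: measurable_normal_pdf.
- move=> x _; rewrite /= lee_fin normrM [`|g x|]ger0_norm ?normal_pdf_ge0//.
  apply: le_trans (ler_norm _); rewrite gE (normal_pdfE _ s'0) /normal_fun.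
  have -> : - (x - m) ^+ 2 / (s' ^+ 2 *+ 2) = - (y2 x / 2).
    by rewrite /y2 /s' exprMn sqr_sqrtr//; field.
  have -> : - y2 x = - (y2 x / 2) + - (y2 x / 2) by field.
  have pk : normal_peak s' != 0 by rewrite gt_eqF// normal_peak_gt0.
  rewrite expRD; set E := expR _.
  have -> : K' * (normal_peak s' * E) = K * (1 + s ^+ 2 *+ 2 *+ 2) * (normal_peak s * E).
    by rewrite /K'; field.
  rewrite [X in _ <= X](_ : _ = K * ((1 + s ^+ 2 *+ 2 *+ 2) * E^-1) * (normal_peak s * (E * E))); last first.
    by field; rewrite gt_eqF// expR_gt0.
  apply: ler_wpM2r.
    by rewrite mulr_ge0 ?normal_peak_ge0// mulr_ge0 ?expR_ge0.
  apply: le_trans (hp x) _; apply: ler_wpM2l => //.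
  rewrite /E expRN invrK.
  apply: le_trans (ler_wpM2l _ (expR_ge1Dx (y2 x / 2))); last first.
    by rewrite addr_ge0// !mulrn_wge0// sqr_ge0.
  rewrite y2E -subr_ge0; move: (y2 x) (y2_ge0 x) (s ^+ 2) (sqr_ge0 s) => a a0 b b0.
  rewrite (_ : _ - _ = 4 * b + a / 2); last by field.
  by rewrite addr_ge0 ?mulr_ge0 ?divr_ge0.
Qed.

(** The abstract Radon-Nikodym derivative agrees almost everywhere with [normal_pdf], because both
    have the same integral over every measurable set. *)
Lemma integral_normal_prob (f : R -> R) : measurable_fun setT f ->
  (normal_prob m s).-integrable setT (EFin \o f) ->
  \int[normal_prob m s]_x f x = \int[leb]_x (f x * g x).
Proof.
move=> mf intf; rewrite /Rintegral.
under [in RHS]eq_integral do rewrite EFinM.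
rewrite -(Radon_Nikodym_change_of_variables (@normal_prob_dominates R m s))//=.
congr fine; apply: ae_eq_integral => //.
- apply: emeasurable_funM; first exact/measurable_EFinP.
  apply: (measurable_int leb); apply: Radon_Nikodym_integrable.
  exact: normal_prob_dominates.
- by apply: emeasurable_funM; apply/measurable_EFinP => //; exact: measurable_normal_pdf.
- apply: ae_eqe_mul2l => /=.
  rewrite Radon_NikodymE//=; first exact: normal_prob_dominates.
  move=> abmu.
  case: cid => /= h [h1 h2 h3].
  apply: integral_ae_eq => //=.
  + by apply: measurableT_comp => //; exact: measurable_normal_pdf.
  + by move=> E E01 mE; rewrite -h3.
Qed.

Let integrable_bounded (f : R -> R) (K : R) : measurable_fun setT f ->
  (forall x, `|f x| <= K) -> leb.-integrable setT (EFin \o (fun x => f x * g x)).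
Proof.
move=> mf hf; have K0 := le_trans (normr_ge0 _) (hf 0).
apply: (@integrable_normal_pdfM _ K) => // x.
by rewrite (le_trans (hf x))// mulrDr mulr1 lerDl mulr_ge0// sqr_ge0.
Qed.

Let norm_le_sqr (y : R) : `|y| <= 1 + y ^+ 2.
Proof.
have : `|y| ^+ 2 = y ^+ 2 by rewrite real_normK ?num_real.
have := sqr_ge0 (`|y| - 1); have := normr_ge0 y; nra.
Qed.

Let is_derive_center (x : R) : is_derive x (1 : R) (fun x : R => x - m) 1.
Proof.
by apply: (is_derive_eq (is_deriveD (is_derive_id x 1) (is_derive_cst (- m) x 1))); rewrite addr0.
Qed.

(** Stein's identity: the derivative of [h * g] is [h' * g - (x - m) / s ^ 2 * h * g], and its
    integral vanishes because [h * g] tends to 0 at both ends. *)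
Lemma normal_stein (h h' : R -> R) (K : R) :
  (forall x : R, is_derive x (1 : R) h (h' x)) -> continuous h' ->
  (forall x, `|h x| <= K * (1 + `|x - m|)) -> (forall x, `|h' x| <= K) ->
  \int[leb]_x ((x - m) * h x * g x) = s ^+ 2 * \int[leb]_x (h' x * g x).
Proof.
move=> dh ch' hh hh'.
have K0 := le_trans (normr_ge0 _) (hh' 0).
have ch : continuous h.
  move=> x; apply: differentiable_continuous; apply/derivable1_diffP.
  exact: (@ex_derive _ _ _ _ _ _ _ (dh x)).
have [c1 c2] := cvg_normal_pdf0 hh.
have i1 : leb.-integrable setT (EFin \o (fun x => h' x * g x)).
  by apply: (@integrable_bounded _ K) => //; exact: continuous_measurable_fun.
have i2 : leb.-integrable setT (EFin \o (fun x => (x - m) * h x * g x)).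
  apply: (@integrable_normal_pdfM _ (K * 2)).
    apply: measurable_funM; last exact: continuous_measurable_fun.
    exact: measurable_funB.
  move=> x; rewrite normrM.
  have : `|x - m| ^+ 2 = (x - m) ^+ 2 by rewrite real_normK ?num_real.
  move: (`|x - m|) (normr_ge0 (x - m)) (norm_le_sqr (x - m)) (hh x) => a a0 a1 ha a2.
  apply: le_trans (ler_wpM2l a0 ha) _.
  rewrite mulrCA -mulrA; apply: ler_wpM2l => //; nra.
have i3 : leb.-integrable setT (EFin \o (fun x => s ^- 2 * ((x - m) * h x * g x))).
  exact: (integrableZl measurableT (s ^- 2) i2).
have := @Rintegral_derive_eq0 _ (fun x => h' x * g x - s ^- 2 * ((x - m) * h x * g x)) (fun x => h x * g x).
rewrite RintegralB// RintegralZl// => H.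
have {}H : \int[leb]_x (h' x * g x) - s ^- 2 * \int[leb]_x ((x - m) * h x * g x) = 0.
  apply: H => //.
  - move=> x; apply: (is_derive_eq (is_deriveM (dh x) (is_derive_normal_pdf x))).
    by rewrite /GRing.scale/=; field.
  - have cg : continuous g by exact: continuous_normal_pdf.
    move=> x; apply: cvgB; first by apply: cvgM; [exact: ch'|exact: cg].
    apply: cvgM; first exact: cvg_cst.
    apply: cvgM; last exact: cg.
    by apply: cvgM; [apply: cvgB; [exact: cvg_id|exact: cvg_cst]|exact: ch].
  - exact: (integrableB measurableT i1 i3).
move/eqP: H; rewrite subr_eq0 => /eqP ->.
by rewrite mulrA mulfV ?mul1r// expf_neq0.
Qed.

Lemma normal_mean : \int[leb]_x ((x - m) * g x) = 0.
Proof.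
have := @normal_stein (fun=> 1) (fun=> 0) 1.
have -> : \int[leb]_x (0 * g x) = 0.
  by under eq_Rintegral do rewrite mul0r; rewrite Rintegral_cst// mul0r.
have -> : \int[leb]_x ((x - m) * 1 * g x) = \int[leb]_x ((x - m) * g x).
  by apply: eq_Rintegral => x _; rewrite mulr1.
rewrite mulr0; apply.
- by move=> x; exact: cvg_cst.
- by move=> x; rewrite normr1 mul1r lerDl.
- by move=> x; rewrite normr0.
Qed.

Lemma normal_variance : \int[leb]_x ((x - m) ^+ 2 * g x) = s ^+ 2.
Proof.
have := @normal_stein (fun x => x - m) (fun=> 1) 1 is_derive_center.
have -> : \int[leb]_x (1 * g x) = 1.
  by under eq_Rintegral do rewrite mul1r; rewrite /Rintegral integral_normal_pdf.
have -> : \int[leb]_x ((x - m) * (x - m) * g x) = \int[leb]_x ((x - m) ^+ 2 * g x).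
  by apply: eq_Rintegral => x _; rewrite expr2.
rewrite mulr1; apply.
- by move=> x; exact: cvg_cst.
- by move=> x; rewrite mul1r lerDr.
- by move=> x; rewrite normr1.
Qed.

Variable phi : R.

(** Real form of the characteristic function of the centered variable, with phase [phi]. *)
Definition ncos t := \int[leb]_x (cos (t * (x - m) + phi) * g x).

Let is_derive_scale (t x : R) : is_derive x (1 : R) (fun x : R => t * (x - m) + phi) t.
Proof.
have h := is_deriveM (is_derive_cst t x (1 : R)) (is_derive_center x).
apply: (is_derive_eq (is_deriveD h (is_derive_cst phi x (1 : R)))).
by rewrite /GRing.scale/= mulr0 !addr0 mulr1.
Qed.

Let is_derive_scale' (t x : R) : is_derive t (1 : R) (fun t : R => t * (x - m) + phi) (x - m).
Proof.
have h := is_deriveM (is_derive_id t (1 : R)) (is_derive_cst (x - m) t (1 : R)).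
apply: (is_derive_eq (is_deriveD h (is_derive_cst phi t (1 : R)))).
by rewrite /GRing.scale/= mulr0 add0r addr0 mulr1.
Qed.

Let sinb (y : R) : `|sin y| <= 1. Proof. by rewrite ler_norml sin_geN1 sin_le1. Qed.

Let cosb (y : R) : `|cos y| <= 1. Proof. by rewrite ler_norml cos_geN1 cos_le1. Qed.

Let mscale t : measurable_fun setT (fun x : R => t * (x - m) + phi).
Proof.
apply: measurable_funD => //; apply: measurable_funM => //; exact: measurable_funB.
Qed.

Let msin t : measurable_fun setT (fun x : R => sin (t * (x - m) + phi)).
Proof.
by apply: measurableT_comp => //; apply: continuous_measurable_fun; exact: continuous_sin.
Qed.

Let mcos t : measurable_fun setT (fun x : R => cos (t * (x - m) + phi)).
Proof.
by apply: measurableT_comp => //; apply: continuous_measurable_fun; exact: continuous_cos.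
Qed.

(** Differentiation under the integral produces a sine, which Stein's identity turns back into
    [ncos]: a linear differential equation of first order. *)
Lemma is_derive_ncos (t : R) : is_derive t (1 : R) ncos (- (t * s ^+ 2) * ncos t).
Proof.
pose f (t x : R) := cos (t * (x - m) + phi) * g x.
have df t' x : is_derive t' (1 : R) (f ^~ x) (- ((x - m) * sin (t' * (x - m) + phi) * g x)).
  have h := is_derive1_comp (is_derive_cos _) (is_derive_scale' t' x).
  apply: (is_derive_eq (is_deriveM h (is_derive_cst (g x) t' (1 : R)))).
  rewrite /GRing.scale/= mulr0 add0r /cst; ring.
have p1 t' x : partial1of2 f t' x = - ((x - m) * sin (t' * (x - m) + phi) * g x).
  by rewrite partial1of2E (@derive_val _ _ _ _ _ _ _ (df t' x)).
have tI : `](t - 1), (t + 1)[%classic t by rewrite /= in_itv/= ltrBlDr ltrDl ltr01.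
have intf x : `](t - 1), (t + 1)[%classic x -> leb.-integrable setT (EFin \o f x).
  by move=> _; exact: (@integrable_bounded _ 1 (mcos x) (fun y => cosb _)).
have derf x y : `](t - 1), (t + 1)[%classic x -> setT y -> derivable (f ^~ y) x 1.
  by move=> _ _; exact: (@ex_derive _ _ _ _ _ _ _ (df x y)).
have G0 y : 0 <= `|y - m| * g y by rewrite mulr_ge0 ?normal_pdf_ge0.
have intG : leb.-integrable setT (EFin \o (fun y => `|y - m| * g y)).
  apply: (@integrable_normal_pdfM _ 1).
    by apply: measurableT_comp => //; exact: measurable_funB.
  by move=> x; rewrite mul1r normr_id.
have Gub x y : `](t - 1), (t + 1)[%classic x -> setT y -> `|partial1of2 f x y| <= `|y - m| * g y.
  move=> _ _; rewrite p1 normrN !normrM [`|g y|]ger0_norm ?normal_pdf_ge0//.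
  by apply: ler_wpM2r; rewrite ?normal_pdf_ge0// -[leRHS]mulr1; apply: ler_wpM2l.
have := derivable_under_integral measurableT tI intf derf G0 intG Gub.
have := differentiation_under_integral measurableT tI intf derf G0 intG Gub.
have -> : \int[leb]_y (partial1of2 f ^~ y) t = - (t * s ^+ 2) * ncos t.
  transitivity (- \int[leb]_x ((x - m) * sin (t * (x - m) + phi) * g x)).
    rewrite -mulN1r -RintegralZl//; last first.
      apply: (@integrable_normal_pdfM _ 1).
        by apply: measurable_funM => //; exact: measurable_funB.
      move=> x; rewrite mul1r normrM; apply: le_trans (norm_le_sqr (x - m)).
      by rewrite -[leRHS]mulr1; apply: ler_wpM2l.
    by apply: eq_Rintegral => x _; rewrite p1 mulN1r.
  have := @normal_stein (fun x => sin (t * (x - m) + phi)) (fun x => t * cos (t * (x - m) + phi)) (1 + `|t|).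
  move=> St; have {}St : \int[leb]_x ((x - m) * sin (t * (x - m) + phi) * g x) =
      s ^+ 2 * \int[leb]_x (t * cos (t * (x - m) + phi) * g x).
    apply: St.
    - move=> x; have := is_derive1_comp (is_derive_sin _) (is_derive_scale t x).
      by move=> h; apply: (is_derive_eq h); rewrite mulrC.
    - move=> x; apply: cvgM; first exact: cvg_cst.
      apply: (@continuous_comp _ _ _ (fun x => t * (x - m) + phi) cos); last exact: continuous_cos.
      apply: cvgD; last exact: cvg_cst.
    by apply: cvgM; [exact: cvg_cst|apply: cvgB; [exact: cvg_id|exact: cvg_cst]].
    - move=> x; apply: le_trans (sinb _) _.
      by rewrite -[leLHS]mulr1 ler_pM// lerDl.
    - by move=> x; rewrite normrM -[leRHS]mulr1 ler_pM// lerDr.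
  rewrite St.
  have -> : \int[leb]_x (t * cos (t * (x - m) + phi) * g x) = t * ncos t.
      rewrite /ncos -RintegralZl//; last exact: (@integrable_bounded _ 1 (mcos t) (fun y => cosb _)).
      by apply: eq_Rintegral => x _; rewrite mulrA.
  by rewrite mulrA mulNr [s ^+ 2 * t]mulrC.
by rewrite derive1E => h1 h2; apply: DeriveDef.
Qed.

(** [E] is the integrating factor of the equation, and the value at 0 is [cos phi]. *)
Lemma ncosE t : ncos t = cos phi * expR (- (s ^+ 2 * t ^+ 2) / 2).
Proof.
pose E (t : R) := expR (s ^+ 2 / 2 * (t * t)).
have dE (x : R) : is_derive x (1 : R) E (x * s ^+ 2 * E x).
  have h1 := is_deriveM (is_derive_id x (1 : R)) (is_derive_id x (1 : R)).
  have h2 := is_deriveM (is_derive_cst (s ^+ 2 / 2) x (1 : R)) h1.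
  have h3 := is_derive1_comp (is_derive_expR _) h2.
  apply: (is_derive_eq h3); rewrite /E /GRing.scale/= /cst/=.
  set X := expR _; rewrite -/X; by field.
have := @is_derive_0_is_cst _ (fun t => ncos t * E t) t 0.
have -> : ncos 0 * E 0 = cos phi.
  rewrite /E mulr0 mulr0 expR0 mulr1 /ncos.
  under eq_Rintegral do rewrite mul0r add0r.
  rewrite RintegralZl//; last exact: integrable_normal_pdf.
  by rewrite /Rintegral integral_normal_pdf mulr1.
move=> H; have {}H : ncos t * E t = cos phi.
  apply: H => x; apply: (is_derive_eq (is_deriveM (is_derive_ncos x) (dE x))).
  by rewrite /GRing.scale/=; ring.
have -> : - (s ^+ 2 * t ^+ 2) / 2 = - (s ^+ 2 / 2 * (t * t)) by field.
by rewrite expRN -/(E t) -[LHS](mulfK (lt0r_neq0 (expR_gt0 (s ^+ 2 / 2 * (t * t))))) H.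
Qed.

End normal_moments.

Section integral_tools.
Context d (T : measurableType d) (R : realType) (P : {measure set T -> \bar R}).

Lemma Rintegral_sum (A : Type) (s : seq A) (f : A -> T -> R) :
  (forall a, P.-integrable setT (EFin \o f a)) ->
  P.-integrable setT (EFin \o (fun x => \sum_(a <- s) f a x)) /\
  \int[P]_x (\sum_(a <- s) f a x) = \sum_(a <- s) \int[P]_x f a x.
Proof.
move=> hf; elim: s => [|a s [ih1 ih2]].
  split; last by under eq_Rintegral do rewrite big_nil; rewrite big_nil Rintegral_cst// mul0r.
  apply: eq_integrable (integrable0 P setT) => //.
  by move=> x _; rewrite /= big_nil.
split.
  apply: eq_integrable (integrableD measurableT (hf a) ih1) => //.
  by move=> x _; rewrite /= big_cons.
under eq_Rintegral do rewrite big_cons.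
by rewrite RintegralD// big_cons ih2.
Qed.

Lemma integrable_le (f g : T -> R) : measurable_fun setT f ->
  P.-integrable setT (EFin \o g) -> (forall x, `|f x| <= g x) ->
  P.-integrable setT (EFin \o f).
Proof.
move=> mf ig fg; apply: (le_integrable _ _ _ ig) => //; first exact/measurable_EFinP.
by move=> x _ /=; rewrite lee_fin (le_trans (fg x))// ler_norm.
Qed.

End integral_tools.

(** * Cosine transform of a Gaussian random variable *)

Section law.
Context d (T : measurableType d) (R : realType) (P : probability T R).

(* [j] is the identity below; it bridges the two canonical measurable structures of [R]. *)
Lemma integral_law dY (Y : measurableType dY) (D : {measure set Y -> \bar R}) (j : Y -> R)
    (X : T -> R) (f : R -> R) :
  measurable_fun setT j -> measurable_fun setT X ->
  (forall U : set R, measurable U -> P (X @^-1` U) = D (j @^-1` U)) ->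
  measurable_fun setT f -> P.-integrable setT (EFin \o (f \o X)) ->
  D.-integrable setT (EFin \o (f \o j)) /\ \int[P]_w f (X w) = \int[D]_x f (j x).
Proof.
move=> mj mX hX mf intf.
have mf' : measurable_fun setT (EFin \o f) by exact/measurable_EFinP.
have eq_push (g : R -> \bar R) : (\int[pushforward P X]_x g x = \int[pushforward D j]_x g x)%E.
  by apply: eq_measure_integral => U mU _; exact: hX.
have iD : D.-integrable setT (EFin \o (f \o j)).
  apply/integrableP; split; first by apply/measurable_EFinP; exact: measurableT_comp.
  have /integrableP[_] := intf; apply: le_lt_trans; rewrite le_eqVlt; apply/orP; left; apply/eqP.
  have mabs : measurable_fun setT (fun x => `|(f x)%:E|%E) by exact: measurableT_comp.
  have abs0 : {in setT, forall y, (0 <= `|(f y)%:E|)%E} by move=> y _; exact: abse_ge0.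
  have h1 := @ge0_integral_pushforward _ _ _ _ R X mX P setT _ measurableT mabs abs0.
  have h2 := @ge0_integral_pushforward _ _ _ _ R j mj D setT _ measurableT mabs abs0.
  exact: etrans (esym h2) (etrans (esym (eq_push _)) h1).
split => //; rewrite /Rintegral; congr fine.
have h1 := integral_pushforward mX mf' intf measurableT.
have h2 := integral_pushforward mj mf' iD measurableT.
exact: etrans (esym h1) (etrans (eq_push _) h2).
Qed.

(** The moments identify the hidden parameters: [m = 0] and [s ^ 2 = v]. The Dirac case is treated
    apart, since [normal_prob] at [s = 0] means another law. *)
Lemma gaussian_rv_cos (X : T -> R) (v : R) : gaussian_rv P X ->
  P.-integrable setT (EFin \o X) -> \int[P]_w X w = 0 ->
  P.-integrable setT (EFin \o (fun w => X w ^+ 2)) -> \int[P]_w (X w ^+ 2) = v ->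
  forall phi, \int[P]_w cos (X w + phi) = cos phi * expR (- v / 2).
Proof.
move=> [mX [m [s [s0 hX]]]] iX eX iX2 eX2 phi.
have mcos : measurable_fun setT (fun x : R => cos (x + phi)).
  by apply: (bounded_mfun_cos _).1; exact: measurable_funD.
have icos : P.-integrable setT (EFin \o ((fun x : R => cos (x + phi)) \o X)).
  apply: bounded_mfun_integrable; apply: bounded_mfun_cos; exact: measurable_funD.
have m2 : measurable_fun setT (fun x : R => x ^+ 2) by exact: measurable_funX.
case: (eqVneq s 0) => [sE|sn0].
- have {}hX (U : set R) : measurable U -> P (X @^-1` U) = (\d_m : set R -> \bar R) (id @^-1` U).
    by move=> mU; rewrite hX// sE eqxx.
  have L := integral_law (@measurable_id _ _ setT) mX hX.
  have dE (f : R -> R) : measurable_fun setT f -> \int[\d_m]_x f x = f m.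
    move=> mf; rewrite /Rintegral integral_dirac//; last exact/measurable_EFinP.
    by rewrite diracT mul1e.
  have m0 : m = 0.
    by have [_] := L id (@measurable_id _ _ setT) iX; rewrite eX dE.
  have v0 : v = 0.
    by have [_] := L _ m2 iX2; rewrite eX2 dE// m0 expr0n.
  by have [_ ->] := L _ mcos icos; rewrite dE// m0 v0 add0r oppr0 mul0r expR0 mulr1.
have {}hX (U : set R) : measurable U -> P (X @^-1` U) = normal_prob m s U.
  by move=> mU; rewrite hX// (negbTE sn0).
have mid : measurable_fun setT (id : measurableTypeR R -> R) by exact: measurable_id.
have L (f : R -> R) := @integral_law _ _ (normal_prob m s) _ X f mid mX hX.
have mc : measurable_fun setT (fun x : R => x - m) by exact: measurable_funB.
have i1 := bounded_mfun_integrable P (@bounded_mfun_cst _ T R m).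
have m0 : m = 0.
  have [i2] := L (fun x => x - m) mc (integrableB measurableT iX i1).
  rewrite integral_normal_prob// normal_mean// RintegralB// eX sub0r Rintegral_cst//.
  rewrite [X in fine X]probability_setT mulr1 => /eqP; rewrite oppr_eq0; exact/eqP.
rewrite {}m0 in hX L mc i1 *.
have vE : v = s ^+ 2.
  have [i2] := L _ m2 iX2; rewrite eX2 integral_normal_prob// -(normal_variance 0 sn0) => ->.
  by apply: eq_Rintegral => x _; rewrite subr0.
have [i2 ->] := L _ mcos icos; rewrite integral_normal_prob// vE.
have := ncosE 0 sn0 phi 1; rewrite /ncos expr1n mulr1 => <-.
by apply: eq_Rintegral => x _; rewrite subr0 mul1r.
Qed.

End law.

(** * Factorisation, from indicators to bounded functions *)

Section decouple.
Import HBNNSimple.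
Context d (T : measurableType d) (R : realType) (P : probability T R).

(** Linearity gives simple functions and dominated convergence bounded ones. The shift by [M] makes
    [f] nonnegative, so that simple approximations from below exist; the event [setT] handles the
    constant. *)
Lemma decouple (H X : T -> R) (c : R) : bounded_mfun H -> measurable_fun setT X ->
  (forall U : set R, measurable U ->
     \int[P]_w (H w * \1_(X @^-1` U) w) = c * fine (P (X @^-1` U))) ->
  forall f : R -> R, bounded_mfun f ->
  \int[P]_w (H w * f (X w)) = c * \int[P]_w f (X w).
Proof.
move=> bH mX hH f bf.
have bX (g : R -> R) : bounded_mfun g -> bounded_mfun (g \o X).
  by move=> [mg [M gM]]; split; [exact: measurableT_comp|exists M => w; exact: gM].
have iH (g : R -> R) : bounded_mfun g -> P.-integrable setT (EFin \o (fun w => H w * g (X w))).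
  by move=> bg; apply: bounded_mfun_integrable; apply: bounded_mfunM => //; exact: bX.
have iX (g : R -> R) : bounded_mfun g -> P.-integrable setT (EFin \o (fun w => g (X w))).
  by move=> bg; apply: bounded_mfun_integrable; exact: bX.
have b1 (U : set R) : measurable U -> bounded_mfun (\1_U : R -> R).
  move=> mU; split; first exact: measurable_indic.
  by exists 1 => x; rewrite indicE; case: (_ \in _); rewrite ?normr1 ?normr0.
pose Q (g : R -> R) := \int[P]_w (H w * g (X w)) = c * \int[P]_w g (X w).
have Q1 (U : set R) : measurable U -> Q \1_U.
  move=> mU; have := hH _ mU; rewrite /Q.
  have E w : \1_U (X w) = \1_(X @^-1` U) w :> R by rewrite !indicE.
  under eq_Rintegral do rewrite -E.
  move=> ->; congr (c * _); rewrite /Rintegral; under eq_integral do rewrite E.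
  by rewrite integral_indic ?setIT// -[_ @^-1` _]setTI; exact: mX.
have Qh (h : {nnsfun R >-> R}) : Q h.
  pose e (y x : R) : R := y * \1_(h @^-1` [set y]) x.
  have [s hE] : exists s : seq R, forall x, h x = \sum_(y <- s) e y x.
    by eexists => x; rewrite fimfunE fsbig_finite/=; [reflexivity|exact: fimfunP].
  have me y : measurable (h @^-1` [set y]) by exact: measurable_sfunP.
  have be y : bounded_mfun (e y) by apply: bounded_mfunM; [exact: bounded_mfun_cst|exact: b1].
  have Qe i : Q (e i).
    rewrite /Q /e; under eq_Rintegral do rewrite mulrCA.
    have i1 := iH _ (b1 _ (me i)); have i2 := iX _ (b1 _ (me i)).
    rewrite (RintegralZl i measurableT i1) (RintegralZl i measurableT i2).
    by rewrite Q1// mulrCA.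
  rewrite /Q; under eq_Rintegral do rewrite hE mulr_sumr.
  rewrite (Rintegral_sum _ (f := fun i w => H w * e i (X w)) _).2; last by move=> i; exact: iH.
  under [in RHS]eq_Rintegral do rewrite hE.
  rewrite (Rintegral_sum _ (f := fun i w => e i (X w)) _).2; last by move=> i; exact: iX.
  by rewrite mulr_sumr; apply: eq_bigr => i _; exact: Qe.
have [mf [M fM]] := bf.
pose f' x := f x + M.
have mf' : measurable_fun setT f' by exact: measurable_funD.
have f'0 x : 0 <= f' x by rewrite /f' -lerBlDr sub0r; have := fM x; rewrite ler_norml => /andP[].
have f'2 x : f' x <= M + M by rewrite lerD2r; have := fM x; rewrite ler_norml => /andP[].
have mf'E : measurable_fun setT (EFin \o f') by exact/measurable_EFinP.
pose g := nnsfun_approx measurableT mf'E.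
have g2 n x : `|g n x| <= M + M.
  rewrite ger0_norm//; apply: le_trans (f'2 x); rewrite -lee_fin.
  rewrite /g nnsfun_approxE; apply: le_approx => // y _; rewrite lee_fin; exact: f'0.
have gf x : g n x @[n --> \oo] --> f' x.
  have := @cvg_nnsfun_approx _ _ _ _ measurableT _ mf'E (fun y _ => _) x I.
  by move=> /(_ (fun y => (f'0 y : (0 <= (f' y)%:E)%E)))/fine_cvg; exact.
have [mH [MH HM]] := bH.
have Qf' : Q f'.
  have c1 : \int[P]_w (H w * g n (X w)) @[n --> \oo] --> \int[P]_w (H w * f' (X w)).
    apply: (@bounded_cvg_Rintegral _ _ _ _ _ _ (MH * (M + M))).
    - by move=> n; apply: measurable_funM => //; exact: measurableT_comp.
    - by move=> n w; rewrite normrM ler_pM.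
    - by move=> w; apply: cvgM; [exact: cvg_cst|exact: gf].
  have c2 : c * \int[P]_w (g n (X w)) @[n --> \oo] --> c * \int[P]_w f' (X w).
    apply: cvgM; first exact: cvg_cst.
    apply: (@bounded_cvg_Rintegral _ _ _ _ _ _ (M + M)) => //.
    - by move=> n; exact: measurableT_comp.
  apply: (cvg_unique (@norm_hausdorff _ R) c1).
  rewrite (_ : (fun n => \int[P]_w (H w * g n (X w))) = (fun n => c * \int[P]_w (g n (X w)))) //.
  by apply/funext => n; exact: Qh.
have QM : Q (fun=> M).
  have := Q1 _ (@measurableT _ R); rewrite /Q.
  under eq_Rintegral do rewrite indicT mulr1.
  under [in RHS]eq_Rintegral do rewrite indicT.
  move=> E; rewrite RintegralZr//; last exact: bounded_mfun_integrable.
  rewrite E [RHS](_ : _ = c * \int[P]_w (1 * M)); last by under [in RHS]eq_Rintegral do rewrite mul1r.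
  by rewrite RintegralZr ?mulrA//; apply: bounded_mfun_integrable; exact: bounded_mfun_cst.
have bM := @bounded_mfun_cst _ R R M.
have bf' : bounded_mfun f' by split => //; exists (M + M) => x; rewrite ger0_norm.
have E1 : \int[P]_w (H w * f (X w)) = \int[P]_w (H w * f' (X w)) - \int[P]_w (H w * M).
  rewrite -RintegralB//; [|exact: iH|exact: (iH _ bM)].
  by apply: eq_Rintegral => w _; rewrite /f' mulrDr addrK.
have E2 : \int[P]_w (f (X w)) = \int[P]_w (f' (X w)) - \int[P]_w M.
  rewrite -RintegralB//; [|exact: iX|exact: (iX _ bM)].
  by apply: eq_Rintegral => w _; rewrite /f' addrK.
by rewrite E1 E2 Qf' QM mulrBr.
Qed.

End decouple.

(** * Gaussian families *)

Section gauss_family.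
Context d (T : measurableType d) (R : realType) (P : probability T R) (I : Type).
Implicit Types (X : T -> I -> R) (K : I -> I -> R).

Definition quad K (s t : seq (R * I)) :=
  \sum_(p <- s) \sum_(q <- t) p.1 * q.1 * K p.2 q.2.

(** A centered Gaussian family with covariance [K], expressed by transforms so that degenerate
    combinations obey the same formula. *)
Definition gauss_family X K := (forall i, measurable_fun setT (fun w => X w i)) /\
  forall s phi, \int[P]_w cos (lin (X w) s + phi) = cos phi * expR (- quad K s s / 2).

End gauss_family.

(** * The Brownian sheet as a Gaussian family *)

Section sheet_family.
Context (R : realType) (N d : nat).
Notation index := ('rV[R]_N * 'I_d)%type.

(* Indices range over all of [R^N], clamped to the orthant. *)
Definition clamp (t : 'rV[R]_N) : 'rV[R]_N := \row_l Num.max 0 (t 0 l).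

Lemma orthant_clamp t : orthant (clamp t).
Proof. by move=> l; rewrite mxE le_max lexx. Qed.

Lemma clampE t : orthant t -> clamp t = t.
Proof. by move=> ot; apply/rowP => l; rewrite mxE; apply/max_idPr. Qed.

Definition sheet_val (T : Type) (B : T -> 'rV[R]_N -> 'rV[R]_d) (w : T) (a : index) : R :=
  B w (clamp a.1) 0 a.2.

Definition sheet_cov (a b : index) : R :=
  (a.2 == b.2)%:R * \prod_(l < N) Num.min (clamp a.1 0 l) (clamp b.1 0 l).

Context dT (T : measurableType dT) (P : probability T R).
Variable B : T -> 'rV[R]_N -> 'rV[R]_d.
Hypothesis hB : brownian_sheet P B.

Lemma gaussian_lin s : gaussian_rv P (fun w => lin (sheet_val B w) s).
Proof.
(* Each list entry becomes one time point whose coefficient vector is supported on a single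
   component. *)
have := bs_gaussian hB (t := fun j => clamp (tnth (in_tuple s) j).2.1)
  (fun j => (tnth (in_tuple s) j).1 *: delta_mx 0 (tnth (in_tuple s) j).2.2)
  (fun j => orthant_clamp _).
congr gaussian_rv; apply/funext => w; rewrite /lin [RHS]big_tnth.
apply: eq_bigr => j _; rewrite (bigD1 (tnth (in_tuple s) j).2.2)//= big1.
  by rewrite addr0 !mxE !eqxx mulr1.
by move=> i ij; rewrite !mxE (negbTE ij) andbF mulr0 mul0r.
Qed.

Lemma measurable_sheet_val a : measurable_fun setT (fun w => sheet_val B w a).
Proof.
have [+ _] := gaussian_lin [:: (1, a)].
by rewrite /lin; under eq_fun do rewrite big_seq1 mul1r.
Qed.

Lemma sheet_val_mean a : (\int[P]_w (sheet_val B w a)%:E = 0)%E.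
Proof.
have := bs_centered hB a.2 (orthant_clamp a.1).
by rewrite unlock.
Qed.

Lemma sheet_val_cov a b :
  (\int[P]_w (sheet_val B w a * sheet_val B w b)%:E = (sheet_cov a b)%:E)%E.
Proof.
have := bs_covariance hB a.2 b.2 (orthant_clamp a.1) (orthant_clamp b.1).
rewrite unlock !(bs_centered hB); try exact: orthant_clamp.
rewrite unlock /= => <-; apply: eq_integral => w _ /=.
by rewrite !fctE /= !subr0.
Qed.

Lemma integrable_sheet_val_sqr a :
  P.-integrable setT (EFin \o (fun w => sheet_val B w a ^+ 2)).
Proof.
apply/integrableP; split.
  by apply/measurable_EFinP; apply: measurable_funX; exact: measurable_sheet_val.
have -> : (\int[P]_w `|(EFin \o (fun w => sheet_val B w a ^+ 2)%R) w| = (sheet_cov a a)%:E)%E.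
  rewrite -sheet_val_cov; apply: eq_integral => w _.
  by rewrite /= ger0_norm ?sqr_ge0// expr2.
exact: ltry.
Qed.

Lemma integrable_sheet_val a : P.-integrable setT (EFin \o (fun w => sheet_val B w a)).
Proof.
apply: (@integrable_le _ _ _ _ _ (fun w => 1 + sheet_val B w a ^+ 2)).
- exact: measurable_sheet_val.
- have i1 := bounded_mfun_integrable P (@bounded_mfun_cst _ T R 1).
  exact: (integrableD measurableT i1 (integrable_sheet_val_sqr a)).
- move=> w; set y := sheet_val B w a.
  have : `|y| ^+ 2 = y ^+ 2 by rewrite real_normK ?num_real.
  have := sqr_ge0 (`|y| - 1); have := normr_ge0 y; nra.
Qed.

Lemma integrable_sheet_valM a b :
  P.-integrable setT (EFin \o (fun w => sheet_val B w a * sheet_val B w b)).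
Proof.
apply: (@integrable_le _ _ _ _ _ (fun w => sheet_val B w a ^+ 2 + sheet_val B w b ^+ 2)).
- by apply: measurable_funM; exact: measurable_sheet_val.
- exact: (integrableD measurableT (integrable_sheet_val_sqr a) (integrable_sheet_val_sqr b)).
- move=> w; set x := sheet_val B w a; set y := sheet_val B w b.
  rewrite ler_norml; have := sqr_ge0 (x - y); have := sqr_ge0 (x + y).
  have := sqr_ge0 x; have := sqr_ge0 y.
  move=> a1 a2 a3 a4; apply/andP; split; nra.
Qed.

Lemma sheet_gauss_family : gauss_family P (sheet_val B) sheet_cov.
Proof.
split; first exact: measurable_sheet_val.
move=> s.
have lin_sqr w : lin (sheet_val B w) s ^+ 2 =
    \sum_(p <- s) \sum_(q <- s) p.1 * q.1 * (sheet_val B w p.2 * sheet_val B w q.2).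
  rewrite expr2 mulr_suml; apply: eq_bigr => p _; rewrite mulr_sumr.
  by apply: eq_bigr => q _; rewrite mulrACA.
have ipq (p : R * index) :
    P.-integrable setT (EFin \o (fun w => \sum_(q <- s) p.1 * q.1 * (sheet_val B w p.2 * sheet_val B w q.2))) /\
    \int[P]_w (\sum_(q <- s) p.1 * q.1 * (sheet_val B w p.2 * sheet_val B w q.2)) =
    \sum_(q <- s) p.1 * q.1 * sheet_cov p.2 q.2.
  have [q|i1 ->] := Rintegral_sum s (P := P)
    (f := fun q w => p.1 * q.1 * (sheet_val B w p.2 * sheet_val B w q.2)).
    exact: (integrableZl measurableT (p.1 * q.1) (integrable_sheet_valM p.2 q.2)).
  split => //; apply: eq_bigr => q _; rewrite RintegralZl//; last exact: integrable_sheet_valM.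
  by rewrite /Rintegral sheet_val_cov.
apply: gaussian_rv_cos; first exact: gaussian_lin.
- apply: (Rintegral_sum s (f := fun p w => p.1 * sheet_val B w p.2) _).1 => p.
  exact: (integrableZl measurableT p.1 (integrable_sheet_val p.2)).
- rewrite /lin (Rintegral_sum s (f := fun p w => p.1 * sheet_val B w p.2) _).2.
    rewrite big1// => p _; rewrite RintegralZl//; last exact: integrable_sheet_val.
    by rewrite /Rintegral sheet_val_mean mulr0.
  by move=> p; exact: (integrableZl measurableT p.1 (integrable_sheet_val p.2)).
- apply: eq_integrable ((Rintegral_sum s (f := fun p w => \sum_(q <- s) p.1 * q.1 * (sheet_val B w p.2 * sheet_val B w q.2)) _).1) => //.
    by move=> w _; rewrite /= lin_sqr.
  by move=> p; exact: (ipq p).1.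
- under eq_Rintegral do rewrite lin_sqr.
  rewrite (Rintegral_sum s (f := fun p w => \sum_(q <- s) p.1 * q.1 * (sheet_val B w p.2 * sheet_val B w q.2)) _).2.
    by apply: eq_bigr => p _; exact: (ipq p).2.
  by move=> p; exact: (ipq p).1.
Qed.

End sheet_family.

Lemma bounded_mfun_prod d (T : measurableType d) (R : realType) (A : Type) (s : seq A)
    (Q : pred A) (f : A -> T -> R) : (forall a, bounded_mfun (f a)) ->
  bounded_mfun (fun w => \prod_(a <- s | Q a) f a w).
Proof.
move=> bf; elim: s => [|a s ih].
  by under eq_fun do rewrite big_nil; exact: bounded_mfun_cst.
under eq_fun do rewrite big_cons.
by case: (Q a) => //; exact: bounded_mfunM.
Qed.

(** * Sums of independent Gaussian variables *)

Section independent_cos.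
Context d (T : measurableType d) (R : realType) (P : probability T R) (k : nat).
Variables (L : 'I_k -> T -> R) (v : 'I_k -> R).
Hypothesis mL : forall i, measurable_fun setT (L i).
Hypothesis Lcos : forall i phi, \int[P]_w cos (L i w + phi) = cos phi * expR (- v i / 2).
Hypothesis indepL : forall E : 'I_k -> set T,
  (forall i, exists2 U : set R, measurable U & E i = L i @^-1` U) ->
  fine (P (\bigcap_i E i)) = \prod_i fine (P (E i)).

Let cosS (r : seq 'I_k) phi : bounded_mfun (fun w => cos (\sum_(i <- r) L i w + phi)).
Proof.
by apply: bounded_mfun_cos; apply: measurable_funD => //; exact: measurable_sum.
Qed.

(* Indicators are replaced by cosines one index at a time. *)
Lemma independent_cos_partial (r : seq 'I_k) : uniq r ->
  forall (E : 'I_k -> set T) phi,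
  (forall i, exists2 U : set R, measurable U & E i = L i @^-1` U) ->
  \int[P]_w (\prod_(i | i \notin r) \1_(E i) w * cos (\sum_(i <- r) L i w + phi)) =
  (\prod_(i | i \notin r) fine (P (E i))) * (cos phi * \prod_(i <- r) expR (- v i / 2)).
Proof.
elim: r => [_ E phi hE|i r ih /= /andP[ir ur] E phi hE].
  rewrite big_nil mulr1 -(indepL hE).
  have mE i : measurable (E i).
    by have [U mU ->] := hE i; rewrite -[_ @^-1` _]setTI; exact: mL.
  have fT : finite_set [set: 'I_k] by exact: finite_finset.
  have -> : fine (P (\bigcap_i E i)) = \int[P]_w \1_(\bigcap_i E i) w.
    by rewrite /Rintegral integral_indic ?setIT//; exact: fin_bigcap_measurable.
  have bi : bounded_mfun (\1_(\bigcap_i E i) : T -> R).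
    split; first by apply: measurable_indic; exact: fin_bigcap_measurable.
    by exists 1 => x; rewrite indicE; case: (_ \in _); rewrite ?normr1 ?normr0.
  rewrite -RintegralZr//; last exact: bounded_mfun_integrable.
  apply: eq_Rintegral => w _; rewrite big_nil add0r; congr (_ * _).
  rewrite [RHS]indicE; case: (asboolP ((\bigcap_i E i) w)) => h.
    rewrite mem_set//= big1// => j _; rewrite indicE mem_set//; exact: h.
  rewrite memNset//=.
  have [j hj] : exists j, ~ E j w by apply: contra_notP h => /forallNP h j _; exact: contrapT (h j).
  by rewrite (bigD1 j)//= indicE memNset// mul0r.
have bE (Q : pred 'I_k) : bounded_mfun (fun w => \prod_(j | Q j) (\1_(E j) w : R)).
  apply: bounded_mfun_prod => j; split.
    apply: measurable_indic; have [U mU ->] := hE j.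
    by rewrite -[_ @^-1` _]setTI; exact: mL.
  by exists 1 => x; rewrite indicE; case: (_ \in _); rewrite ?normr1 ?normr0.
pose H phi w := \prod_(j | j \notin i :: r) \1_(E j) w * cos (\sum_(j <- r) L j w + phi).
have bH psi : bounded_mfun (H psi) by exact: bounded_mfunM.
pose c phi := (\prod_(j | j \notin i :: r) fine (P (E j))) *
  (cos phi * \prod_(j <- r) expR (- v j / 2)).
have split_i (F : 'I_k -> R) : \prod_(j | j \notin r) F j = F i * \prod_(j | j \notin i :: r) F j.
  by rewrite (bigD1 i)//=; congr (_ * _); apply: eq_bigl => j; rewrite inE negb_or andbC.
(* [decouple] asks only for events of [L i], and these are the induction hypothesis with [E i]
   replaced by the preimage of [U]. *)
have dec psi (f : R -> R) : bounded_mfun f -> \int[P]_w (H psi w * f (L i w)) = c psi * \int[P]_w f (L i w).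
  apply: decouple => // U mU.
  pose E' j := if j == i then L i @^-1` U else E j.
  have hE' j : exists2 U : set R, measurable U & E' j = L j @^-1` U.
    by rewrite /E'; case: eqP => [->|_]; [exists U|exact: hE].
  have := ih ur E' psi hE'.
  have E'i : E' i = L i @^-1` U by rewrite /E' eqxx.
  have E'j j : j \notin i :: r -> E' j = E j.
    by rewrite inE negb_or /E' => /andP[/negbTE -> _].
  rewrite split_i E'i.
  rewrite [\prod_(j | j \notin i :: r) _](eq_bigr (fun j => fine (P (E j)))); last by move=> j /E'j ->.
  rewrite -mulrA [fine _ * _]mulrC => <-.
  apply: eq_Rintegral => w _; rewrite split_i E'i /H.
  rewrite [in RHS](eq_bigr (fun j => \1_(E j) w)); last by move=> j /E'j ->.
  by rewrite mulrC mulrA.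
have bcos : bounded_mfun (cos : R -> R) by exact: bounded_mfun_cos.
have bsin : bounded_mfun (sin : R -> R) by exact: bounded_mfun_sin.
have bcL : bounded_mfun (fun w => cos (L i w)) by exact: bounded_mfun_cos.
have bsL : bounded_mfun (fun w => sin (L i w)) by exact: bounded_mfun_sin.
(* From [cos (a + b) = cos a * cos b + sin a * cos (b + pi / 2)]: the remaining sum stays inside a
   cosine, with another phase. The sine of [L i] has mean zero, by [Lcos] at phase [- pi / 2]. *)
have -> : \int[P]_w (\prod_(j | j \notin i :: r) \1_(E j) w * cos (\sum_(j <- i :: r) L j w + phi)) =
   \int[P]_w (H phi w * cos (L i w)) + \int[P]_w (H (phi + pi / 2) w * sin (L i w)).
  rewrite -RintegralD//; [|exact/bounded_mfun_integrable/bounded_mfunM..].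
  apply: eq_Rintegral => w _; rewrite big_cons /H.
  set q := \prod_(j | _) _; set S := \sum_(j <- r) _.
  have -> : L i w + S + phi = L i w + (S + phi) by rewrite addrA.
  have -> : S + (phi + pi / 2) = (S + phi) + pi / 2 by rewrite addrA.
  move: (L i w) (S + phi) => a b; rewrite !cosD cos_pihalf sin_pihalf; ring.
rewrite (dec _ _ bcos) (dec _ _ bsin).
have -> : \int[P]_w cos (L i w) = expR (- v i / 2).
  have := Lcos i 0; rewrite cos0 mul1r => <-.
  by apply: eq_Rintegral => w _; rewrite addr0.
have -> : \int[P]_w sin (L i w) = 0.
  have := Lcos i (- (pi / 2)); rewrite cosN cos_pihalf mul0r => <-.
  by apply: eq_Rintegral => w _; rewrite cosD cosN sinN cos_pihalf sin_pihalf; ring.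
by rewrite /c big_cons; ring.
Qed.

Lemma independent_cos phi :
  \int[P]_w cos (\sum_i L i w + phi) = cos phi * expR (- (\sum_i v i) / 2).
Proof.
have := @independent_cos_partial (enum 'I_k) (enum_uniq _) (fun=> setT) phi (fun i => _).
have hE (i : 'I_k) : exists2 U : set R, measurable U & [set: T] = L i @^-1` U.
  by exists setT.
move=> /(_ hE).
rewrite big_pred0; last by move=> i; rewrite mem_enum.
have -> : expR (- (\sum_i v i) / 2) = \prod_(i <- enum 'I_k) expR (- v i / 2).
  by rewrite -expR_sum big_enum/= -mulr_suml sumrN.
rewrite mul1r => <-.
apply: eq_Rintegral => w _; rewrite big_pred0 ?mul1r; last by move=> i; rewrite mem_enum.
by rewrite big_enum.
Qed.

End independent_cos.

Section sheets_family.
Context (R : realType) (N d k : nat) dT (T : measurableType dT) (P : probability T R).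
Variable W : 'I_k -> T -> 'rV[R]_N -> 'rV[R]_d.
Hypothesis hW : forall i, brownian_sheet P (W i).
Hypothesis iW : independent_fields P W.
Notation index := ('rV[R]_N * 'I_d)%type.

Definition sheets_val (w : T) (a : 'I_k * index) : R := sheet_val (W a.1) w a.2.

Definition sheets_cov (a b : 'I_k * index) : R := (a.1 == b.1)%:R * sheet_cov a.2 b.2.

Lemma field_sigma_lin (X : T -> 'rV[R]_N -> 'rV[R]_d) s (U : set R) : measurable U ->
  field_sigma_algebra X ((fun w => lin (sheet_val X w) s) @^-1` U).
Proof.
move=> mU; set G := [set E : set T | exists t (U : set 'rV[R]_d),
         [/\ orthant t, borel U & E = (fun w => X w t) @^-1` U]].
have mG : measurable_fun setT (fun w : g_sigma_algebraType G => lin (sheet_val X w) s).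
  apply: measurable_lin => a.
  apply: (measurability (@RGenOInfty.G R)); first exact: RGenOInfty.measurableE.
  move=> _ [_ [x ->] <-]; rewrite setTI; apply: sub_sigma_algebra.
  exists (clamp a.1), [set y : 'rV[R]_d | x < y 0 a.2]; split => //.
  - exact: orthant_clamp.
  - apply: sub_sigma_algebra => /=.
    change (open ((fun y : 'rV[R]_d => y 0 a.2) @^-1` [set z | x < z])).
    apply: open_comp; last exact: open_gt.
    by move=> y _; exact: coord_continuous.
  - by apply/seteqP; split => w /=; rewrite in_itv/= andbT.
by have := mG measurableT _ mU; rewrite setTI.
Qed.

Lemma sheets_gauss_family : gauss_family P sheets_val sheets_cov.
Proof.
split; first by move=> [i a]; exact: measurable_sheet_val.
move=> s phi.
(* The entries of [s] on sheet [i]. Each sub-combination is a functional of one sheet, which is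
   where independence applies. *)
pose si i := [seq (p.1, p.2.2) | p <- s & p.2.1 == i].
have sumE (f : R * ('I_k * index) -> R) (g : 'I_k -> R * index -> R) :
    (forall p, f p = g p.2.1 (p.1, p.2.2)) ->
    \sum_(p <- s) f p = \sum_i \sum_(p <- si i) g i p.
  move=> fg; rewrite (partition_big (fun p => p.2.1) xpredT)//=.
  apply: eq_bigr => i _; rewrite /si big_map big_filter.
  by apply: eq_bigr => p /eqP <-; exact: fg.
have linE w : lin (sheets_val w) s = \sum_i lin (sheet_val (W i) w) (si i).
  exact: (sumE _ (fun i p => p.1 * sheet_val (W i) w p.2)).
have quadE : quad sheets_cov s s = \sum_i quad (@sheet_cov R N d) (si i) (si i).
  apply: (sumE _ (fun i p => \sum_(q <- si i) p.1 * q.1 * sheet_cov p.2 q.2)) => p.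
  rewrite (sumE _ (fun i q => p.1 * q.1 * ((p.2.1 == i)%:R * sheet_cov p.2.2 q.2)))//.
  rewrite (bigD1 p.2.1)//= [X in _ + X]big1 ?addr0.
    by apply: eq_bigr => q _; rewrite eqxx mul1r.
  by move=> i ip; rewrite big1// => q _; rewrite eq_sym (negbTE ip) mul0r mulr0.
under eq_Rintegral do rewrite linE.
rewrite quadE; apply: independent_cos.
- by move=> i; apply: measurable_lin; exact: measurable_sheet_val.
- by move=> i phi'; exact: (sheet_gauss_family (hW i)).2.
- move=> E hE.
  have := iW (J := [set: 'I_k]%SET) (E := E).
  have -> : [set` [set: 'I_k]%SET] = setT by apply/seteqP; split => // i _; rewrite /= inE.
  move=> ->; last by move=> j _; have [U mU ->] := hE j; exact: field_sigma_lin.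
  have mE i : measurable (E i).
    have [U mU ->] := hE i; rewrite -[_ @^-1` _]setTI.
    by apply: (measurable_lin (si i) (measurable_sheet_val (hW i))).
  rewrite [X in fine X](eq_bigl xpredT); last by move=> i; rewrite inE.
  have : (\prod_i P (E i) = (\prod_i fine (P (E i)))%:E)%E.
    elim/big_rec2: _ => //= i y x _ ->.
    by rewrite EFinM fineK// fin_num_measure.
  by move=> ->.
Qed.

End sheets_family.

(** * Algebra of formal linear combinations *)

Section lin_quad.
Context (R : realType) (I : Type).
Implicit Types (K : I -> I -> R).

Lemma lin_cons (y : I -> R) p (s : seq (R * I)) : lin y (p :: s) = p.1 * y p.2 + lin y s.
Proof. by rewrite /lin big_cons. Qed.

Lemma lin_cat (y : I -> R) (s t : seq (R * I)) : lin y (s ++ t) = lin y s + lin y t.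
Proof. by rewrite /lin big_cat. Qed.

Definition scale (c : R) (s : seq (R * I)) := [seq (c * p.1, p.2) | p <- s].

Lemma lin_scale (y : I -> R) c s : lin y (scale c s) = c * lin y s.
Proof. by rewrite /lin big_map mulr_sumr; apply: eq_bigr => p _; rewrite mulrA. Qed.

Lemma quadE K s t : quad K s t = lin (fun i => lin (K i) t) s.
Proof.
by apply: eq_bigr => p _; rewrite /lin mulr_sumr; apply: eq_bigr => q _; rewrite mulrA.
Qed.

Lemma quadC K s t : (forall i j, K i j = K j i) -> quad K s t = quad K t s.
Proof.
move=> KC; rewrite /quad exchange_big; apply: eq_bigr => q _; apply: eq_bigr => p _.
by rewrite KC [p.1 * _]mulrC.
Qed.

Lemma quad_catl K s1 s2 t : quad K (s1 ++ s2) t = quad K s1 t + quad K s2 t.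
Proof. by rewrite !quadE lin_cat. Qed.

Lemma quad_scalel K c s t : quad K (scale c s) t = c * quad K s t.
Proof. by rewrite !quadE lin_scale. Qed.

Lemma quad_catr K s t1 t2 : quad K s (t1 ++ t2) = quad K s t1 + quad K s t2.
Proof. by rewrite /quad -big_split; apply: eq_bigr => p _; rewrite big_cat. Qed.

Lemma quad_scaler K c s t : quad K s (scale c t) = c * quad K s t.
Proof.
rewrite /quad mulr_sumr; apply: eq_bigr => p _; rewrite big_map mulr_sumr.
by apply: eq_bigr => q _ /=; ring.
Qed.

Lemma quad_nill K t : quad K [::] t = 0. Proof. by rewrite /quad big_nil. Qed.

Lemma quad_nilr K s : quad K s [::] = 0.
Proof. by rewrite /quad big1// => p _; rewrite big_nil. Qed.

End lin_quad.

Section bind.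
Context (R : realType) (I : Type).

(** Substitution of combinations for generators; it expresses linear changes of coordinates on the
    level of lists. *)
Definition bind (J : Type) (S : J -> seq (R * I)) (s : seq (R * J)) : seq (R * I) :=
  flatten [seq scale p.1 (S p.2) | p <- s].

Lemma bind_cons J (S : J -> seq (R * I)) p s : bind S (p :: s) = scale p.1 (S p.2) ++ bind S s.
Proof. by []. Qed.

Lemma lin_bind (y : I -> R) J (S : J -> seq (R * I)) s :
  lin y (bind S s) = lin (fun j => lin y (S j)) s.
Proof.
elim: s => [|p s ih]; first by rewrite /bind/= /lin !big_nil.
by rewrite bind_cons lin_cat lin_scale lin_cons ih.
Qed.

Lemma quad_bind (K : I -> I -> R) J (S : J -> seq (R * I)) s t :
  quad K (bind S s) (bind S t) = quad (fun a b => quad K (S a) (S b)) s t.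
Proof.
rewrite [RHS]quadE quadE lin_bind; congr lin; apply/funext => a.
rewrite -quadE; elim: t => [|q t ih]; first by rewrite quad_nilr /lin big_nil.
by rewrite bind_cons quad_catr quad_scaler ih lin_cons.
Qed.

End bind.

Section gauss_law.
Context (R : realType).

Lemma gauss_family_lin d (T : measurableType d) (P : probability T R) (I J : Type)
    (X : T -> I -> R) K (S : J -> seq (R * I)) :
  gauss_family P X K ->
  gauss_family P (fun w j => lin (X w) (S j)) (fun a b => quad K (S a) (S b)).
Proof.
move=> [mX cX]; split; first by move=> j; exact: measurable_lin.
move=> s phi; rewrite -quad_bind -cX.
by apply: eq_Rintegral => w _; rewrite lin_bind.
Qed.

Lemma gauss_family_eq d (T : measurableType d) (P : probability T R) (I : Type)
    (X : T -> I -> R) K K' : (forall i j, K i j = K' i j) ->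
  gauss_family P X K -> gauss_family P X K'.
Proof.
move=> KK'; suff -> : K = K' by [].
by apply/funext => i; apply/funext => j.
Qed.

(** Positive semidefiniteness is read off the transform: an average of cosines is at most 1, hence
    so is [expR (- quad K s s / 2)]. *)
Lemma quad_ge0 d (T : measurableType d) (P : probability T R) (I : Type)
    (X : T -> I -> R) K s : gauss_family P X K -> 0 <= quad K s s.
Proof.
move=> [mX cX]; have := cX s 0; rewrite cos0 mul1r => h.
have : expR (- quad K s s / 2) <= 1.
  rewrite -h.
  have m1 : bounded_mfun (fun w => cos (lin (X w) s + 0)).
    by apply: bounded_mfun_cos; apply: measurable_funD => //; exact: measurable_lin.
  have : \int[P]_w cos (lin (X w) s + 0) <= \int[P]_w 1.
    apply: le_Rintegral => //; try exact: bounded_mfun_integrable.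
      by apply: bounded_mfun_integrable; exact: bounded_mfun_cst.
  by rewrite Rintegral_cst// [X in fine X]probability_setT mulr1.
by rewrite -[X in _ <= X]expR0 ler_expR mulNr oppr_le0 pmulr_lge0// invr_gt0.
Qed.

Lemma gauss_family_law d (T : measurableType d) (P : probability T R)
    d' (T' : measurableType d') (P' : probability T' R) (I : Type)
    (X : T -> I -> R) (X' : T' -> I -> R) K :
  gauss_family P X K -> gauss_family P' X' K ->
  forall E : set (pathspace R I), measurable E -> P (X @^-1` E) = P' (X' @^-1` E).
Proof.
move=> [mX cX] [mX' cX'] E mE.
have mp : measurable_fun setT (X : T -> pathspace R I) by exact: measurable_path.
have mp' : measurable_fun setT (X' : T' -> pathspace R I) by exact: measurable_path.
pose Xm : {mfun T >-> pathspace R I} := HB.pack (X : T -> pathspace R I) (isMeasurableFun.Build _ _ _ _ _ mp).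
pose Xm' : {mfun T' >-> pathspace R I} := HB.pack (X' : T' -> pathspace R I) (isMeasurableFun.Build _ _ _ _ _ mp').
have := @cramer_wold R I (distribution P Xm) (distribution P' Xm') _ E mE.
apply=> s phi.
have mc : measurable_fun setT (fun y : pathspace R I => cos (lin y s + phi)).
  apply: (bounded_mfun_cos _).1; apply: measurable_funD => //.
  apply: measurable_lin; exact: measurable_coord.
have mcE : measurable_fun setT (EFin \o (fun y : pathspace R I => cos (lin y s + phi))).
  exact/measurable_EFinP.
have i1 : P.-integrable setT (EFin \o (fun w => cos (lin (X w) s + phi))).
  apply: bounded_mfun_integrable; apply: bounded_mfun_cos; apply: measurable_funD => //.
  exact: measurable_lin.
have i2 : P'.-integrable setT (EFin \o (fun w => cos (lin (X' w) s + phi))).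
  apply: bounded_mfun_integrable; apply: bounded_mfun_cos; apply: measurable_funD => //.
  exact: measurable_lin.
have e1 := integral_pushforward mp mcE i1 measurableT.
have e2 := integral_pushforward mp' mcE i2 measurableT.
have : \int[P]_w cos (lin (X w) s + phi) = \int[P']_w cos (lin (X' w) s + phi) by rewrite cX cX'.
by rewrite /Rintegral => e3; exact: etrans (congr1 fine e1) (etrans e3 (esym (congr1 fine e2))).
Qed.

End gauss_law.

(** * Null sets of the normal law and of Lebesgue measure *)

Section lebesgue_null.
Context (R : realType).
Notation leb := (@lebesgue_measure R).

Lemma lebesgue_measure_shift (h : R) (D : set (measurableTypeR R)) : measurable D ->
  leb ((fun x => h + x) @^-1` D) = leb D.
Proof.
move=> mD.
have mh : measurable_fun setT ((fun x => h + x) : measurableTypeR R -> measurableTypeR R).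
  exact: measurable_funD.
have := @lebesgue_measure_unique R (pushforward leb ((fun x => h + x) : measurableTypeR R -> measurableTypeR R)) _ D mD.
move=> /(_ mh) -> //.
move=> X [[a b] /= ab <-]; rewrite /pushforward.
have -> : (fun x => h + x) @^-1` `]a, b]%classic = `]a - h, b - h]%classic.
  by apply/seteqP; split => x /=; rewrite !in_itv/= ltrBlDl lerBrDl.
rewrite !lebesgue_measure_itv/= !lte_fin ltrD2r -!EFinB; case: ifP => // _.
by congr EFin; ring.
Qed.

(** The density is positive everywhere, so the two measures are mutually absolutely continuous. *)
Lemma normal_prob_null (s : R) (A : set (measurableTypeR R)) : s != 0 -> measurable A ->
  normal_prob 0 s A = 0%E <-> leb A = 0%E.
Proof.
move=> s0 mA; split; last first.
  by move=> h; apply/eqP; have := @normal_prob_dominates R 0 s; move/null_content_dominatesP => /(_ A mA h) ->.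
rewrite /normal_prob => h.
have mpdf : measurable_fun A (EFin \o normal_pdf 0 s).
  by apply/measurable_EFinP; apply: measurable_funTS; exact: measurable_normal_pdf.
have : (\int[leb]_(x in A) `|(normal_pdf 0 s x)%:E| = 0)%E.
  rewrite -[RHS]h; apply: eq_integral => x _.
  by rewrite gee0_abs// lee_fin normal_pdf_ge0.
move/(ae_eq_integral_abs leb mA mpdf) => [N [mN N0 AN]].
apply/eqP; rewrite eq_le measure_ge0 andbT -N0.
apply: le_measure; rewrite ?inE// => x Ax; apply: AN => /= /(_ Ax)/eqP.
rewrite eqe normal_pdfE// mulf_eq0 gt_eqF ?normal_peak_gt0//=.
by rewrite gt_eqF// expR_gt0.
Qed.

End lebesgue_null.

(** * Adding one coordinate with an independent Gaussian part *)

Section conditional_step.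
Context (R : realType) d (T : measurableType d) (P : probability T R) (J : Type).
Variables (Y : T -> J -> R) (Z : T -> R) (K : J -> J -> R) (v : R).
Notation leb := (@lebesgue_measure R).

Definition adjoin (w : T) (a : option J) : R := if a is Some j then Y w j else Z w.

Definition adjoin_cov (a b : option J) : R :=
  match a, b with Some i, Some j => K i j | None, None => v | _, _ => 0 end.

Hypothesis v0 : 0 < v.
Hypothesis GYZ : gauss_family P adjoin adjoin_cov.

Let s := Num.sqrt v.

Let s0 : s != 0. Proof. by rewrite gt_eqF// sqrtr_gt0. Qed.

Let mY j : measurable_fun setT (fun w => Y w j).
Proof. exact: (GYZ.1 (Some j)). Qed.

Notation PR := (T * measurableTypeR R)%type.

Definition adjoin_prod (q : PR) (a : option J) : R := if a is Some j then Y q.1 j else q.2.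

Let somes (l : seq (R * option J)) : seq (R * J) :=
  pmap (fun p => omap (fun j => (p.1, j)) p.2) l.

Let nones (l : seq (R * option J)) : R := \sum_(p <- l) if p.2 is Some _ then 0 else p.1.

Let lin_adjoin (y : option J -> R) l :
  lin y l = lin (fun j => y (Some j)) (somes l) + nones l * y None.
Proof.
elim: l => [|[c [j|]] l ih]; first by rewrite /lin /nones !big_nil mul0r addr0.
  by rewrite lin_cons ih /nones big_cons /= lin_cons add0r addrA.
by rewrite lin_cons ih /nones big_cons /=; ring.
Qed.

Let quad_adjoin l : quad adjoin_cov l l = quad K (somes l) (somes l) + nones l ^+ 2 * v.
Proof.
rewrite quadE lin_adjoin /= [quad K _ _]quadE; congr (_ + _).
  by congr lin; apply/funext => j; rewrite lin_adjoin /= mulr0 addr0.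
rewrite expr2 -mulrA; congr (_ * _); rewrite lin_adjoin /=.
rewrite /lin big1 ?add0r; first by [].
by move=> p _; rewrite mulr0.
Qed.

(** Zero cross-covariance becomes independence: by Fubini, the product with a normal coordinate has
    the same covariance as [adjoin], hence the same law by [gauss_family_law]. *)
Lemma adjoin_prod_gauss : gauss_family (P \x normal_prob 0 s)%E adjoin_prod adjoin_cov.
Proof.
have mAP a : measurable_fun setT (adjoin_prod^~ a).
  case: a => [j|] /=; first exact: (measurableT_comp (mY j) measurable_fst).
  exact: measurable_snd.
split => // l phi.
have bl : bounded_mfun (fun q : PR => cos (lin (adjoin_prod q) l + phi)).
  by apply: bounded_mfun_cos; apply: measurable_funD => //; exact: measurable_lin.
have il := bounded_mfun_integrable (P \x normal_prob 0 s)%E bl.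
rewrite /Rintegral -(integral12_prod_meas1 il).
pose c := nones l.
(* For fixed [w] the terms in [Y] act as the phase of a one-dimensional transform, and [c] is the
   total weight of the new coordinate. *)
have inner w : (\int[normal_prob 0 s]_y (EFin \o (fun q : PR => cos (lin (adjoin_prod q) l + phi))) (w, y) =
   (expR (- (c ^+ 2 * v) / 2) * cos (lin (Y w) (somes l) + phi))%:E)%E.
  set psi := lin (Y w) (somes l) + phi.
  have mc : measurable_fun setT (fun y : R => cos (c * y + psi)).
    apply: (bounded_mfun_cos _).1; apply: measurable_funD => //; exact: measurable_funM.
  have ic : (normal_prob 0 s).-integrable setT (EFin \o (fun y : R => cos (c * y + psi))).
    by apply: bounded_mfun_integrable; split => //; exists 1 => x; rewrite ler_norml cos_geN1 cos_le1.
  have := integral_normal_prob mc ic.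
  have -> : \int[lebesgue_measure]_x (cos (c * x + psi) * normal_pdf 0 s x) = ncos 0 s psi c.
    by apply: eq_Rintegral => x _; rewrite subr0.
  rewrite ncosE// sqr_sqrtr ?ltW// [v * _]mulrC [cos psi * _]mulrC => h.
  rewrite -h /Rintegral fineK; last exact: integrable_fin_num.
  apply: eq_integral => y _ /=; congr (cos _)%:E; rewrite lin_adjoin /= -/c /psi.
  by rewrite addrAC addrC addrA.
rewrite (eq_integral (fun w => (expR (- (c ^+ 2 * v) / 2) * cos (lin (Y w) (somes l) + phi))%:E)); last first.
  by move=> w _; exact: inner.
have GY := (GYZ.2 [seq (p.1, Some p.2) | p <- somes l] phi).
have lE w : lin (adjoin w) [seq (p.1, Some p.2) | p <- somes l] = lin (Y w) (somes l).
  by rewrite /lin big_map.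
have qE : quad adjoin_cov [seq (p.1, Some p.2) | p <- somes l] [seq (p.1, Some p.2) | p <- somes l] =
  quad K (somes l) (somes l).
  by rewrite /quad big_map; apply: eq_bigr => p _; rewrite big_map.
have := @RintegralZl _ T R P setT (fun w => cos (lin (Y w) (somes l) + phi)) (expR (- (c ^+ 2 * v) / 2)) measurableT.
rewrite /Rintegral => ->; last first.
  apply: bounded_mfun_integrable; apply: bounded_mfun_cos; apply: measurable_funD => //.
  exact: measurable_lin.
move: GY; rewrite /Rintegral qE; under eq_integral do rewrite lE.
move=> ->; rewrite quad_adjoin -/c mulrCA -expRD; congr (_ * expR _).
by rewrite -mulrDl -opprD [RHS]mulNr mulNr addrC.
Qed.

(* Given [Y], the new coordinate has a positive Gaussian density. *)
Lemma conditional_null (Phi : pathspace R J * measurableTypeR R -> pathspace R J)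
    (h : seq (R * J)) (E : set (pathspace R J)) :
  measurable_fun setT Phi -> measurable E ->
  P [set w | E (Phi (Y w, lin (Y w) h + Z w))] = 0%E <->
  P [set w | leb (xsection (Phi @^-1` E) (Y w)) != 0%E] = 0%E.
Proof.
move=> mPhi mE.
have mA : measurable (Phi @^-1` E) by rewrite -[_ @^-1` _]setTI; exact: mPhi.
pose F (y : pathspace R (option J)) : pathspace R J :=
  Phi (fun j => y (Some j), lin (fun j => y (Some j)) h + y None).
have mF : measurable_fun setT F.
  apply: (measurableT_comp mPhi); apply: measurable_fun_pair.
    by apply: measurable_path => j; exact: measurable_coord.
  apply: measurable_funD; last exact: measurable_coord.
  by apply: measurable_lin => j; exact: measurable_coord.
have mFE : measurable (F @^-1` E) by rewrite -[_ @^-1` _]setTI; exact: mF.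
have := gauss_family_law GYZ adjoin_prod_gauss mFE.
have -> : adjoin @^-1` (F @^-1` E) = [set w | E (Phi (Y w, lin (Y w) h + Z w))] by [].
move=> ->.
set B := adjoin_prod @^-1` (F @^-1` E).
have mB : measurable B.
  have mp : measurable_fun setT (adjoin_prod : PR -> pathspace R (option J)).
    by apply: measurable_path; exact: adjoin_prod_gauss.1.
  by rewrite -[B]setTI; exact: mp.
have mYp : measurable_fun setT (Y : T -> pathspace R J) by exact: measurable_path.
have mleb := measurable_fun_xsection leb mA.
have mnor := measurable_fun_xsection (normal_prob 0 s) mB.
(* For fixed [w] the two sections differ by the translation by [lin (Y w) h]. Normal and Lebesgue
   null sets coincide, and Lebesgue measure is translation invariant. *)
have key w : (normal_prob 0 s \o xsection B) w = 0%E <-> leb (xsection (Phi @^-1` E) (Y w)) = 0%E.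
  rewrite /= normal_prob_null//; last exact: measurable_xsection.
  rewrite -(lebesgue_measure_shift (lin (Y w) h) (measurable_xsection _ mA)).
  suff -> : xsection B w = (fun x => lin (Y w) h + x) @^-1` (xsection (Phi @^-1` E) (Y w)) by [].
  apply/seteqP; split => z; rewrite /xsection /= !inE//.
have mbad : measurable [set w | leb (xsection (Phi @^-1` E) (Y w)) != 0%E].
  rewrite (_ : [set w | _] = setT `&` ((leb \o xsection (Phi @^-1` E)) \o (Y : T -> pathspace R J)) @^-1` (~` [set 0%E])).
    apply: (measurableT_comp mleb mYp) => //; apply: measurableC; exact: emeasurable_set1.
  by rewrite setTI; apply/seteqP; split => w /= /eqP.
change (\int[P]_w (normal_prob 0 s \o xsection B) w = 0 <->
  P [set w | leb (xsection (Phi @^-1` E) (Y w)) != 0] = 0)%E.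
split.
- have -> : (\int[P]_w (normal_prob 0 s \o xsection B) w = \int[P]_w `|(normal_prob 0 s \o xsection B) w|)%E.
    by apply: eq_integral => w _; rewrite gee0_abs// measure_ge0.
  move/(ae_eq_integral_abs P measurableT mnor) => [N [mN N0 AN]].
  apply/eqP; rewrite eq_le measure_ge0 andbT.
  suff : (P [set w | leb (xsection (Phi @^-1` E) (Y w)) != 0%E] <= P N)%E by rewrite N0.
  apply: le_measure; rewrite ?inE// => w /= /eqP hw.
  by apply: AN => /= /(_ I)/key.
- move=> h0; have -> : (\int[P]_w (normal_prob 0 s \o xsection B) w = \int[P]_w `|(normal_prob 0 s \o xsection B) w|)%E.
    by apply: eq_integral => w _; rewrite gee0_abs// measure_ge0.
  apply/(ae_eq_integral_abs P measurableT mnor).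
  exists [set w | leb (xsection (Phi @^-1` E) (Y w)) != 0%E]; split => //.
  by move=> w /= hw; apply/eqP => /key e; apply: hw.
Qed.

End conditional_step.

(** * Null sets and nondegenerate Gaussian coordinates *)

Section innovation.
Context (R : realType) (I : Type) (K : I -> I -> R).
Hypothesis KC : forall i j, K i j = K j i.
Hypothesis K0 : forall s, 0 <= quad K s s.

(** Degenerate Cauchy-Schwarz: otherwise [u - c * w] with [c = quad K u w / (quad K w w + 1)] would
    have negative variance. The [+ 1] keeps the denominator nonzero. *)
Lemma quad_null u w : quad K u u = 0 -> quad K u w = 0.
Proof.
move=> u0; apply/eqP/contraT => a0.
have := K0 (u ++ scale (- quad K u w / (quad K w w + 1)) w).
rewrite quad_catl !quad_catr !quad_scalel !quad_scaler u0 add0r [quad K w u]quadC//.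
have := K0 w; move: (quad K w w) (quad K u w) a0 => b a a0 b0.
have b1 : b + 1 != 0 by rewrite gt_eqF// ltr_wpDl.
rewrite (_ : _ + _ = - (a ^+ 2 * (b + 2) / (b + 1) ^+ 2)); last by field.
have a2 : 0 < a ^+ 2 by rewrite lt_def sqrf_eq0 a0 sqr_ge0.
rewrite oppr_ge0 leNgt (_ : 0 < _)//; apply: divr_gt0.
  by apply: mulr_gt0 => //; rewrite ltr_wpDl.
by rewrite exprn_gt0// ltr_wpDl.
Qed.

Lemma quad_bindl J (S : J -> seq (R * I)) s t :
  quad K (bind S s) t = \sum_(p <- s) p.1 * quad K (S p.2) t.
Proof. by rewrite quadE lin_bind; apply: eq_bigr => p _; rewrite quadE. Qed.

Variables (n : nat) (g D : 'I_n -> seq (R * I)) (kappa : R).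
Hypothesis kappa0 : kappa != 0.
Hypothesis gD : forall i j, quad K (g i) (D j) = (i == j)%:R * kappa.

(* [bind g h] is the Gram-Schmidt projection of [g m] on the earlier vectors. *)
Lemma innovation (m : 'I_n) : exists h : seq (R * 'I_n), [/\
  all (fun p : R * 'I_n => p.2 < m)%N h,
  forall j : 'I_n, (j < m)%N -> quad K (bind g ((1, m) :: scale (-1) h)) (g j) = 0 &
  0 < quad K (bind g ((1, m) :: scale (-1) h)) (bind g ((1, m) :: scale (-1) h))].
Proof.
have lemn : (m <= n)%N by exact: ltnW.
pose wd := widen_ord lemn.
pose G := \matrix_(i < m, j < m) quad K (g (wd i)) (g (wd j)).
pose comb (c : 'rV[R]_m) := [seq (c 0 i, wd i) | i <- enum 'I_m].
have combE (c : 'rV[R]_m) t : quad K (bind g (comb c)) t = \sum_i c 0 i * quad K (g (wd i)) t.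
  by rewrite quad_bindl big_map big_enum.
(* A kernel vector [c] of the Gram matrix gives a combination of zero variance, and pairing it with
   the dual family reads off every coefficient. *)
have Gu : G \in unitmx.
  rewrite -row_free_unit; apply: inj_row_free => c cG.
  have u0 : quad K (bind g (comb c)) (bind g (comb c)) = 0.
    rewrite combE big1// => i _; rewrite quadC// combE.
    have := congr1 (fun M : 'rV[R]_m => M 0 i) cG; rewrite !mxE => e.
    rewrite [X in _ * X](_ : _ = 0) ?mulr0// -[RHS]e.
    by apply: eq_bigr => j _; rewrite mxE.
  apply/rowP => j; rewrite mxE; have := quad_null (D (wd j)) u0.
  rewrite combE (bigD1 j)//= big1 ?addr0; last first.
    move=> i ij; rewrite gD (_ : (wd i == wd j) = false) ?mul0r ?mulr0//.
    by apply/negbTE; apply: contra ij => /eqP/(congr1 val)/= ij; apply/eqP/val_inj.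
  by rewrite gD eqxx mul1r => /eqP; rewrite mulf_eq0 (negbTE kappa0) orbF => /eqP.
pose b := \row_j quad K (g m) (g (wd j)).
pose c := b *m invmx G.
exists (comb c); set z := bind g _.
have zE t : quad K z t = quad K (g m) t - \sum_i c 0 i * quad K (g (wd i)) t.
  rewrite /z quad_bindl big_cons /= mul1r -combE quad_bindl big_map -sumrN; congr (_ + _).
  by apply: eq_bigr => p _; rewrite mulN1r mulNr.
split.
- by apply/allP => p /mapP[i _ ->] /=; exact: ltn_ord.
- move=> j jm; rewrite zE.
  have -> : j = wd (Ordinal jm) by exact: val_inj.
  have := congr1 (fun M : 'rV[R]_m => M 0 (Ordinal jm)) (mulmxKV Gu b).
  rewrite !mxE => e; rewrite -[X in X - _]e -sumrB big1// => i _.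
  by rewrite [G _ _]mxE subrr.
(* [D m] annihilates the earlier vectors, so the innovation pairs with it to [kappa], which is
   nonzero; its variance therefore is not zero. *)
- rewrite lt_def K0 andbT; apply/negP => /eqP z0.
  have := quad_null (D m) z0; rewrite zE gD eqxx mul1r big1 ?subr0; first exact/eqP.
  move=> i _; rewrite gD (_ : (wd i == m) = false) ?mul0r ?mulr0//.
  by apply/negbTE/negP => /eqP/(congr1 val) /= im; have := ltn_ord i; rewrite im ltnn.
Qed.

End innovation.

(** * Replacing nondegenerate coordinates one at a time *)

Section chain.
Context (R : realType) (I : Type) (n : nat).
Notation index := (I + 'I_n)%type.

(** The [inr] coordinates from [m] on are set to 0, so that all stages live on one path space and
    [update] can be iterated. *)
Definition stage_comb (m : nat) (a : index) : seq (R * index) :=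
  match a with
  | inl i => [:: (1, inl i)]
  | inr j => if (j < m)%N then [:: (1, inr j)] else [::]
  end.

Definition stage (y : index -> R) (m : nat) (a : index) : R :=
  lin y (stage_comb m a).

Lemma stageE y m a : stage y m a =
  match a with inl i => y (inl i) | inr j => if (j < m)%N then y (inr j) else 0 end.
Proof.
case: a => [i|j]; rewrite /stage /= /lin ?big_seq1 ?mul1r//.
by case: ifP; rewrite ?big_nil// big_seq1 mul1r.
Qed.

Definition update (m : 'I_n) (q : pathspace R index * measurableTypeR R) : pathspace R index :=
  fun a => match a with inl i => q.1 (inl i) | inr j => if j == m then q.2 else q.1 (inr j) end.

Lemma measurable_update m : measurable_fun setT (update m).
Proof.
apply: measurable_path => -[i|j] /=.
  exact: (measurableT_comp (measurable_coord (inl i)) measurable_fst).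
case: eqP => _; first exact: measurable_snd.
exact: (measurableT_comp (measurable_coord (inr j)) measurable_fst).
Qed.

(* The [inl] coordinates are independent of the [inr] ones, whose covariance is nondegenerate. *)
Definition split_cov (K : index -> index -> R) := [/\
  forall a b, K a b = K b a,
  forall i j, K (inl i) (inr j) = 0 &
  forall m : 'I_n, exists h : seq (R * 'I_n), let z := [seq (p.1, inr p.2 : index) | p <- (1, m) :: scale (-1) h] in
   [/\ all (fun p : R * 'I_n => p.2 < m)%N h,
       forall j : 'I_n, (j < m)%N -> quad K z [:: (1, inr j)] = 0 &
       0 < quad K z z]].

Section one.
Context d (T : measurableType d) (P : probability T R) (X : T -> index -> R).
Variable K : index -> index -> R.
Hypotheses (GX : gauss_family P X K) (sK : split_cov K).
Notation leb := (@lebesgue_measure R).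

(** The coordinate revealed at [m] is its projection on the revealed [inr] coordinates plus an
    innovation uncorrelated with the stage, so [conditional_null] applies. The resulting condition
    on stage [m] is expressed by Lebesgue measure alone, whatever [K] is. *)
Lemma stage_null (m : 'I_n) (E : set (pathspace R index)) : measurable E ->
  P [set w | E (stage (X w) m.+1)] = 0%E <->
  P [set w | leb (xsection (update m @^-1` E) (stage (X w) m)) != 0%E] = 0%E.
Proof.
move=> mE; have [KC Klr /(_ m)[h [hm zj zz]]] := sK.
set z := map _ _ in zj zz.
pose Z w := lin (X w) z.
have G : gauss_family P (adjoin (fun w => stage (X w) m) Z)
    (adjoin_cov (fun a b => quad K (stage_comb m a) (stage_comb m b)) (quad K z z)).
  have := gauss_family_lin (fun a : option index => if a is Some b then stage_comb m b else z) GX.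
  have -> : (fun w (j : option index) => lin (X w) (if j is Some b then stage_comb m b else z)) =
    adjoin (fun w => stage (X w) m) Z.
    by apply/funext => w; apply/funext => -[a|].
  apply: gauss_family_eq.
  have z0 a : quad K z (stage_comb m a) = 0.
    case: a => [i|j] /=; last by case: ifP => [/zj//|_]; rewrite quad_nilr.
    by rewrite /quad big_map big1// => p _; rewrite big_seq1 KC Klr mulr0.
  by move=> [a|] [b|] //=; rewrite quadC// z0.
have := conditional_null zz G [seq (p.1, inr p.2) | p <- h] (@measurable_update m) mE.
set A := [set w | _]; set B := [set w | _] => H.
rewrite (_ : A = [set w | E (stage (X w) m.+1)]) in H; first exact: H.
apply/funext => w /=; congr E; apply/funext => a.
rewrite [RHS]stageE; case: a => [i|j] /=; first by rewrite stageE.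
case: eqP => [->|jm]; last first.
  rewrite stageE ltnS [(j <= m)%N]leq_eqVlt (_ : (j == m :> nat) = false)//.
  by apply/negbTE/negP => /eqP/val_inj.
rewrite ltnSn /Z /z /= lin_cons /= mul1r addrCA.
rewrite (_ : lin _ _ + lin _ _ = 0) ?addr0//.
apply/eqP; rewrite addr_eq0 /lin !big_map -sumrN; apply/eqP.
rewrite big_seq [RHS]big_seq; apply: eq_bigr => p ph /=.
by rewrite stageE (allP hm _ ph) mulN1r mulNr opprK.
Qed.

End one.

Theorem gauss_null_equiv d (T : measurableType d) (P : probability T R) (X : T -> index -> R) K
    d' (T' : measurableType d') (P' : probability T' R) (X' : T' -> index -> R) K' :
  gauss_family P X K -> gauss_family P' X' K' -> split_cov K -> split_cov K' ->
  (forall i j, K (inl i) (inl j) = K' (inl i) (inl j)) ->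
  forall E : set (pathspace R index), measurable E ->
  P (X @^-1` E) = 0%E <-> P' (X' @^-1` E) = 0%E.
Proof.
move=> GX GX' sK sK' KK' E mE.
have H m : (m <= n)%N -> forall E : set (pathspace R index), measurable E ->
  P [set w | E (stage (X w) m)] = 0%E <-> P' [set w | E (stage (X' w) m)] = 0%E.
  elim: m => [_ {}E {}mE|m ih mn {}E {}mE].
    (* At stage 0 only the [inl] coordinates survive, where the covariances agree, so here even the
       laws agree. *)
    have G := gauss_family_lin (stage_comb 0) GX.
    have G' := gauss_family_lin (stage_comb 0) GX'.
    have {}G' : gauss_family P' (fun w j => lin (X' w) (stage_comb 0 j))
        (fun a b => quad K (stage_comb 0 a) (stage_comb 0 b)).
      apply: gauss_family_eq G' => -[i|i] [j|j] /=; rewrite ?quad_nill ?quad_nilr//.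
      by rewrite /quad !big_seq1 KK'.
    have e : P [set w | E (stage (X w) 0)] = P' [set w | E (stage (X' w) 0)].
      exact: (gauss_family_law G G' mE).
    by rewrite e.
  have := stage_null GX sK (Ordinal mn) mE => -> /=.
  have := stage_null GX' sK' (Ordinal mn) mE => -> /=.
  pose leb := @lebesgue_measure R.
  have mA : measurable (update (Ordinal mn) @^-1` E).
    by rewrite -[_ @^-1` _]setTI; exact: measurable_update.
  have mleb := measurable_fun_xsection leb mA.
  (* The condition on stage [m] is one measurable event of the path space, identical in both models,
     and the induction hypothesis applies to it. *)
  apply: (ih (ltnW mn) [set y | leb (xsection (update (Ordinal mn) @^-1` E) y) != 0%E]).
  rewrite (_ : [set y | _] = setT `&` (leb \o xsection (update (Ordinal mn) @^-1` E)) @^-1` (~` [set 0%E])).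
    by apply: mleb => //; apply: measurableC; exact: emeasurable_set1.
  by rewrite setTI; apply/seteqP; split => w /= /eqP.
have sn (y : index -> R) : stage y n = y.
  by apply/funext => -[i|j]; rewrite stageE// ltn_ord.
have := H n (leqnn n) E mE.
by under eq_fun do rewrite sn; under [X in _ <-> P' X = _]eq_fun do rewrite sn.
Qed.

End chain.

(** * Corner decomposition of the sheet *)

Section one_dimensional.
Context (R : realType).
Implicit Types (a b t u v e : R).

(** [min] with [u] has its only kink at [u], so it is affine on [a, b] when [u] is not strictly
    inside. *)
Lemma min_interpolation a b t u : a < b -> a <= t <= b -> u <= a \/ b <= u ->
  (b - t) / (b - a) * Num.min a u + (t - a) / (b - a) * Num.min b u = Num.min t u.
Proof.
move=> ab /andP[at_ tb] hu; have ba0 : b - a != 0 by rewrite subr_eq0 gt_eqF.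
case: hu => hu.
- by rewrite !min_r ?(le_trans hu)// ?(ltW ab)//; field.
- rewrite (min_l (le_trans (ltW ab) hu)) (min_l hu) (min_l (le_trans tb hu)); by field.
Qed.

(** The pattern 1, -2, 1 of a second difference. *)
Definition diff2_coef (x : 'I_3) : R := if x == 1%N :> nat then - 2 else 1.

(** Centered at the kink [u], the second difference of [min u] is [- e]; if [v] is at least [e] away
    from [u], the function is affine on the three nodes. *)
Lemma min_diff2 e u v : 0 < e -> (u != v -> e <= `|u - v|) ->
  \sum_(x < 3) diff2_coef x * Num.min u (v + (x%:R - 1) * e) = (u == v)%:R * (- e).
Proof.
move=> e0 huv; rewrite !big_ord_recl big_ord0 /diff2_coef /= addr0.
rewrite /bump /= sub0r mulN1r subrr mul0r addr0 (_ : (1 + 1)%:R - 1 = 1 :> R); last by ring.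
rewrite !mul1r.
case: eqVneq huv => [-> _|uv /(_ isT) h].
  rewrite (_ : true%:R = 1)// mul1r min_r ?gerBl ?ltW// minxx min_l ?lerDl ?ltW//; ring.
rewrite (_ : false%:R = 0)// mul0r.
move: h; rewrite lter_normr => /orP[h|h].
  rewrite !min_r; [ring|lra|lra|lra].
rewrite !min_l; [ring|lra|lra|lra].
Qed.

Lemma finite_pos_lower_bound (F : finType) (f : F -> R) : (forall x, 0 < f x) ->
  exists2 e, 0 < e & forall x, e <= f x.
Proof.
move=> f0; suff H (s : seq F) : exists2 e, 0 < e & forall x, x \in s -> e <= f x.
  by have [e e0 he] := H (enum F); exists e => // x; apply: he; rewrite mem_enum.
elim: s => [|x s [e e0 he]]; first by exists 1.
exists (Num.min e (f x)); first by rewrite lt_min e0 f0.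
move=> y; rewrite inE => /predU1P[->|/he ey]; first by rewrite ge_min lexx orbT.
by rewrite ge_min ey.
Qed.

End one_dimensional.

(** * Corners and residuals of separated boxes *)

Section corners.
Context (R : realType) (N d k : nat) (Q : Type).
Variables (a b : 'I_k -> 'rV[R]_N) (p : 'I_k -> Q -> 'rV[R]_N) (theta : 'I_k -> 'I_k -> R).
Hypothesis N0 : (0 < N)%N.
Hypothesis a0 : forall i l, 0 < a i 0 l.
Hypothesis ab : forall i l, a i 0 l < b i 0 l.
Hypothesis disj : forall i j l, i != j -> b i 0 l < a j 0 l \/ b j 0 l < a i 0 l.
Hypothesis box_p : forall i q l, a i 0 l <= p i q 0 l <= b i 0 l.
Hypothesis theta1 : forall i, theta i i = 1.
Hypothesis thetaC : forall i j, theta i j = theta j i.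

Notation side := {ffun 'I_N -> bool}.
Notation base := ('I_k * ('rV[R]_N * 'I_d))%type.
Notation corner := ('I_k * side * 'I_d)%type.
Notation residual := ('I_k * Q * 'I_d)%type.

(* [theta = 1] is the covariance of a single sheet, [theta i j = (i == j)%:R] that of
   independent sheets. *)
Definition theta_cov (x y : base) : R := theta x.1 y.1 * sheet_cov x.2 y.2.

Definition corner_pt i (e : side) : 'rV[R]_N := \row_l if e l then b i 0 l else a i 0 l.

(** Product of one-dimensional barycentric weights: the coefficient of corner [e] in the multilinear
    interpolation at [t]. *)
Definition weight i (t : 'rV[R]_N) (e : side) : R :=
  \prod_l (if e l then (t 0 l - a i 0 l) / (b i 0 l - a i 0 l)
           else (b i 0 l - t 0 l) / (b i 0 l - a i 0 l)).

Definition corner_comb (c : corner) : seq (R * base) :=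
  [:: (1, (c.1.1, (corner_pt c.1.1 c.1.2, c.2)))].

Definition residual_comb (r : residual) : seq (R * base) :=
  (1, (r.1.1, (p r.1.1 r.1.2, r.2))) ::
  [seq (- weight r.1.1 (p r.1.1 r.1.2) e, (r.1.1, (corner_pt r.1.1 e, r.2))) | e <- enum {: side}].

Lemma sheet_covE (s t : 'rV[R]_N) (m m' : 'I_d) : orthant s -> orthant t ->
  sheet_cov (s, m) (t, m') = (m == m')%:R * \prod_l Num.min (s 0 l) (t 0 l).
Proof. by move=> os ot; rewrite /sheet_cov !clampE. Qed.

Lemma orthant_corner i e : orthant (corner_pt i e).
Proof.
by move=> l; rewrite mxE; case: (e l); rewrite ltW// (lt_trans (a0 i l) (ab i l)).
Qed.

Lemma orthant_p i q : orthant (p i q).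
Proof. by move=> l; have /andP[h _] := box_p i q l; rewrite (le_trans _ h)// ltW. Qed.

Lemma theta_covC x y : theta_cov x y = theta_cov y x.
Proof.
rewrite /theta_cov thetaC /sheet_cov eq_sym; congr (_ * (_ * _)).
by apply: eq_bigr => l _; rewrite minC.
Qed.

(** The sum over corners factors into a product over coordinates, each factor being
    [min_interpolation]. The factor [theta] is common to the point and the corners of its box, so
    both models are covered at once. *)
Lemma residual_null (r : residual) j (t : 'rV[R]_N) m : orthant t ->
  (forall l, t 0 l <= a r.1.1 0 l \/ b r.1.1 0 l <= t 0 l) ->
  quad theta_cov (residual_comb r) [:: (1, (j, (t, m)))] = 0.
Proof.
case: r => [[i q] m'] ot ht /=.
rewrite /quad big_cons big_map big_enum /= big_seq1 /= !mul1r.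
rewrite {1}/theta_cov /= sheet_covE//; last exact: orthant_p.
set th := theta i j; set dl := (_ == _)%:R.
rewrite (eq_bigr (fun e => - (th * dl) * (weight i (p i q) e * \prod_l Num.min (corner_pt i e 0 l) (t 0 l)))); last first.
  move=> e _; rewrite big_seq1 /= mulr1 /theta_cov /= sheet_covE//; last exact: orthant_corner.
  by rewrite -/th -/dl; ring.
rewrite -mulr_sumr.
rewrite (_ : \sum_e _ = \prod_l Num.min (p i q 0 l) (t 0 l)); first by ring.
pose F l (x : bool) := (if x then (p i q 0 l - a i 0 l) / (b i 0 l - a i 0 l)
           else (b i 0 l - p i q 0 l) / (b i 0 l - a i 0 l)) *
   Num.min (if x then b i 0 l else a i 0 l) (t 0 l).
transitivity (\sum_(e : side) \prod_l F l (e l)).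
  apply: eq_bigr => e _; rewrite /weight -big_split; apply: eq_bigr => l _.
  by rewrite /F mxE.
rewrite -(bigA_distr_bigA F); apply: eq_bigr => l _.
by rewrite big_bool [LHS]addrC /F min_interpolation.
Qed.

Lemma outside_box i j (t : 'rV[R]_N) : i != j ->
  (forall l, a j 0 l <= t 0 l <= b j 0 l) ->
  forall l, t 0 l <= a i 0 l \/ b i 0 l <= t 0 l.
Proof.
move=> ij ht l; have /andP[h1 h2] := ht l.
case: (disj l ij) => h; [right|left].
  by rewrite (le_trans (ltW h)).
by rewrite (le_trans h2)// ltW.
Qed.

Lemma corner_in_box i e l : a i 0 l <= corner_pt i e 0 l <= b i 0 l.
Proof. by rewrite mxE; case: (e l); rewrite lexx (ltW (ab i l)). Qed.

Lemma corner_outside i j e l : corner_pt j e 0 l <= a i 0 l \/ b i 0 l <= corner_pt j e 0 l.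
Proof.
case: (eqVneq i j) => [->|ij].
  by rewrite mxE; case: (e l); [right|left].
by apply: (@outside_box i j) => // l'; exact: corner_in_box.
Qed.

Lemma residual_corner r c : quad theta_cov (residual_comb r) (corner_comb c) = 0.
Proof.
apply: residual_null; first exact: orthant_corner.
by move=> l; exact: corner_outside.
Qed.

Lemma residual_residual_off r r' : r.1.1 != r'.1.1 ->
  quad theta_cov (residual_comb r) (residual_comb r') = 0.
Proof.
move=> rr'; rewrite -[residual_comb r']/([:: _] ++ _) quad_catr residual_null ?add0r.
- elim: (enum _) => [|e s ih]; first by rewrite quad_nilr.
  rewrite map_cons -cat1s quad_catr ih addr0.
  rewrite (_ : [:: _] = scale (- weight r'.1.1 (p r'.1.1 r'.1.2) e)
    [:: (1, (r'.1.1, (corner_pt r'.1.1 e, r'.2)))]); last by rewrite /scale /= mulr1.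
  rewrite quad_scaler residual_null ?mulr0//; first exact: orthant_corner.
  by apply: outside_box rr' _ => l; exact: corner_in_box.
- exact: orthant_p.
- by apply: outside_box rr' _ => l; exact: box_p.
Qed.

Lemma corner_coords (c c' : corner) : c.1 != c'.1 ->
  exists l, corner_pt c.1.1 c.1.2 0 l != corner_pt c'.1.1 c'.1.2 0 l.
Proof.
case: c c' => [[i e] m] [[i' e'] m'] /=.
case: (eqVneq i i') => [<-|ii'] h.
  have [l el] : exists l, e l != e' l.
    apply: contra_neqP h => /forallNP h; congr (_, _); apply/ffunP => l.
    by apply/eqP/negPn/negP; exact: h.
  exists l; rewrite !mxE; move: el; case: (e l); case: (e' l) => // _.
    by rewrite gt_eqF// ab.
  by rewrite lt_eqF// ab.
(* Different boxes are separated in every coordinate, so the first one serves. *)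
exists (Ordinal N0); have /andP[h1 h2] := corner_in_box i e (Ordinal N0).
have /andP[h3 h4] := corner_in_box i' e' (Ordinal N0).
by case: (disj (Ordinal N0) ii') => h5;
  [rewrite lt_eqF// (le_lt_trans h2)// (lt_le_trans h5)|rewrite gt_eqF// (le_lt_trans h4)// (lt_le_trans h5)].
Qed.

(* The dual functionals are N-fold second differences of the field at the corners. *)
Lemma corner_dual : exists (D : corner -> seq (R * base)) (kappa : R), kappa != 0 /\
  forall c c', quad theta_cov (corner_comb c) (D c') = (c == c')%:R * kappa.
Proof.
have [e1 e10 he1] := @finite_pos_lower_bound R _ (fun x : (corner * 'I_N)%type => corner_pt x.1.1.1 x.1.1.2 0 x.2)
  (fun x => lt_le_trans (a0 _ _) (proj1 (andP (corner_in_box _ _ _)))).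
pose f2 (x : (corner * corner * 'I_N)%type) : R :=
  let u := corner_pt x.1.1.1.1 x.1.1.1.2 0 x.2 in
  let v := corner_pt x.1.2.1.1 x.1.2.1.2 0 x.2 in if u == v then 1 else `|u - v|.
have f20 x : 0 < f2 x by rewrite /f2/=; case: eqVneq => // h; rewrite normr_gt0 subr_eq0.
have [e2 e20 he2] := finite_pos_lower_bound f20.
(* [e1] keeps the shifted corners in the orthant; [e2] keeps distinct corner coordinates at least
   [e] apart, as [min_diff2] requires. *)
pose e := Num.min e1 e2.
have e0 : 0 < e by rewrite lt_min e10 e20.
pose v_ (c : corner) (f : {ffun 'I_N -> 'I_3}) : 'rV[R]_N :=
  \row_l (corner_pt c.1.1 c.1.2 0 l + ((f l)%:R - 1) * e).
pose D (c : corner) : seq (R * base) :=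
  [seq (\prod_(l < N) @diff2_coef R (f l), (c.1.1, (v_ c f, c.2))) | f : {ffun 'I_N -> 'I_3} <- enum {: {ffun 'I_N -> 'I_3}}].
(* On the diagonal each of the [N] second differences contributes [- e]. *)
exists D, ((- e) ^+ N); split; first by rewrite expf_neq0// oppr_eq0 gt_eqF.
have ov c f : orthant (v_ c f).
  move=> l; rewrite mxE; have h1 : e <= e1 by rewrite ge_min lexx.
  have h2 := he1 (c, l); rewrite /= in h2.
  have : -1 * e <= ((f l)%:R - 1) * e.
    by apply: ler_wpM2r; [exact: ltW|rewrite lerBrDr addNr].
  rewrite mulN1r.
  by move=> h3; rewrite -[0](subrr e); apply: lerD => //; exact: le_trans h2.
move=> c c'; rewrite /quad big_seq1 /D big_map big_enum /=.
set u := corner_pt c.1.1 c.1.2; set v := corner_pt c'.1.1 c'.1.2.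
pose th := theta c.1.1 c'.1.1; pose dl : R := (c.2 == c'.2)%:R.
rewrite (eq_bigr (fun f : {ffun 'I_N -> 'I_3} => (th * dl) *
   \prod_l (@diff2_coef R (f l) * Num.min (u 0 l) (v 0 l + ((f l)%:R - 1) * e)))); last first.
  move=> f _; rewrite mul1r /theta_cov /= sheet_covE//; last exact: orthant_corner.
  rewrite big_split /= -/th -/dl [RHS]mulrCA; congr (_ * _); rewrite mulrA; congr (_ * _).
  by apply: eq_bigr => l _; rewrite [v_ _ _ _ _]mxE.
rewrite -mulr_sumr -(bigA_distr_bigA (fun l (x : 'I_3) => @diff2_coef R x * Num.min (u 0 l) (v 0 l + (x%:R - 1) * e))).
rewrite (eq_bigr (fun l => (u 0 l == v 0 l)%:R * (- e))); last first.
  move=> l _; apply: min_diff2 => // uv.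
  have := he2 (c, c', l); rewrite /f2 /= -/u -/v (negbTE uv).
  by apply: le_trans; rewrite ge_min lexx orbT.
rewrite big_split /= prodr_const card_ord.
case: (eqVneq c c') => [cc'|cc'].
  rewrite mul1r big1 ?mul1r; last by move=> l _; rewrite /u /v cc' eqxx.
  by rewrite /th /dl cc' theta1 eqxx !mul1r.
(* Off the diagonal either only the components of the field differ, or the corners differ in some
   coordinate, whose second difference is zero. *)
rewrite mul0r; case: (eqVneq c.1 c'.1) => [c1|c1].
  rewrite /dl (_ : (c.2 == c'.2) = false) ?mulr0 ?mul0r//.
  by apply: contra_neqF cc' => /eqP c2; rewrite [c]surjective_pairing c1 c2 -surjective_pairing.
have [l hl] := corner_coords c1.
by rewrite (bigD1 l)//= (negbTE hl) !mul0r mulr0.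
Qed.

Definition split_comb (x : residual + 'I_#|{: corner}|) : seq (R * base) :=
  match x with inl r => residual_comb r | inr j => corner_comb (enum_val j) end.

Definition split_K x y := quad theta_cov (split_comb x) (split_comb y).

Lemma split_cov_corners (K0 : forall s, 0 <= quad theta_cov s s) : split_cov split_K.
Proof.
split.
- by move=> x y; apply: quadC; exact: theta_covC.
- by move=> r j; exact: residual_corner.
move=> m; have [D [kappa [kappa0 hD]]] := corner_dual.
have gD (i j : 'I_#|{: corner}|) : quad theta_cov (corner_comb (enum_val i)) (D (enum_val j)) = (i == j)%:R * kappa.
  by rewrite hD (inj_eq enum_val_inj).
have [h [h1 h2 h3]] := innovation theta_covC K0 kappa0 gD m.
exists h; set z := bind _ _ in h2 h3; set z' := map _ _.
have zz' : bind split_comb z' = z.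
  by rewrite /z /z' /bind -map_comp.
split => //.
- move=> j jm; rewrite -[quad _ _ _]quad_bind zz'.
  rewrite (_ : bind _ _ = scale 1 (corner_comb (enum_val j))); last by rewrite /bind /= ?cats0.
  by rewrite quad_scaler mul1r; exact: h2.
- by rewrite -[quad _ _ _]quad_bind zz'.
Qed.

Lemma weight_recompose (y : base -> R) i q m :
  y (i, (p i q, m)) = lin y (residual_comb (i, q, m)) +
  \sum_(e : side) weight i (p i q) e * lin y (corner_comb (i, e, m)).
Proof.
rewrite lin_cons /= mul1r -addrA [X in _ + X](_ : _ = 0) ?addr0//.
rewrite /lin big_map big_enum /= -big_split big1//= => e _.
by rewrite big_seq1 mul1r mulNr addNr.
Qed.

(** Undoes the splitting: the field on the boxes is rebuilt from residuals and corners, so its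
    events become events of the split coordinates. *)
Definition recompose (y : pathspace R (residual + 'I_#|{: corner}|)) : pathspace R residual :=
  fun r => y (inl r) + \sum_(e : side) weight r.1.1 (p r.1.1 r.1.2) e *
    y (inr (enum_rank (r.1.1, e, r.2))).

Lemma measurable_recompose :
  measurable_fun setT recompose.
Proof.
apply: measurable_path => r; apply: measurable_funD; first exact: measurable_coord.
apply: measurable_sum => e; apply: measurable_funM => //; exact: measurable_coord.
Qed.

Lemma recomposeE (y : base -> R) :
  recompose (fun x => lin y (split_comb x)) = fun r => y (r.1.1, (p r.1.1 r.1.2, r.2)).
Proof.
apply/funext => -[[i q] m]; rewrite (weight_recompose y i q m) /recompose /=; congr (_ + _).
by apply: eq_bigr => e _; rewrite enum_rankK.
Qed.

End corners.

(** * Null sets of one sheet and of independent sheets on boxes *)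

Section box_equivalence.
Context (R : realType) (N d k : nat) (Q : Type).
Variables (a b : 'I_k -> 'rV[R]_N) (p : 'I_k -> Q -> 'rV[R]_N).
Hypothesis N0 : (0 < N)%N.
Hypothesis a0 : forall i l, 0 < a i 0 l.
Hypothesis ab : forall i l, a i 0 l < b i 0 l.
Hypothesis disj : forall i j l, i != j -> b i 0 l < a j 0 l \/ b j 0 l < a i 0 l.
Hypothesis box_p : forall i q l, a i 0 l <= p i q 0 l <= b i 0 l.

Lemma sheet_base_family dT (T : measurableType dT) (P : probability T R)
    (B : T -> 'rV[R]_N -> 'rV[R]_d) : brownian_sheet P B ->
  gauss_family P (fun w (x : 'I_k * ('rV[R]_N * 'I_d)) => sheet_val B w x.2)
    (theta_cov (fun _ _ => 1)).
Proof.
move=> hB.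
have := gauss_family_lin (fun x : 'I_k * ('rV[R]_N * 'I_d) => [:: (1, x.2)]) (sheet_gauss_family hB).
have -> : (fun w (j : 'I_k * ('rV[R]_N * 'I_d)) => lin (sheet_val B w) [:: (1, j.2)]) =
  (fun w x => sheet_val B w x.2).
  by apply/funext => w; apply/funext => x; rewrite /lin big_seq1 mul1r.
by apply: gauss_family_eq => x y; rewrite /quad !big_seq1 /theta_cov /= mulr1.
Qed.

Theorem box_null_equiv dT (T : measurableType dT) (P : probability T R)
    (B : T -> 'rV[R]_N -> 'rV[R]_d) dT' (T' : measurableType dT') (P' : probability T' R)
    (W : 'I_k -> T' -> 'rV[R]_N -> 'rV[R]_d) :
  brownian_sheet P B -> (forall i, brownian_sheet P' (W i)) -> independent_fields P' W ->
  forall E : set (pathspace R ('I_k * Q * 'I_d)), measurable E ->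
  P [set w | E (fun r => B w (p r.1.1 r.1.2) 0 r.2)] = 0%E <->
  P' [set w | E (fun r => W r.1.1 w (p r.1.1 r.1.2) 0 r.2)] = 0%E.
Proof.
move=> hB hW iW E mE.
have GB := sheet_base_family hB.
have GW : gauss_family P' (sheets_val W) (theta_cov (fun i j => (i == j)%:R)).
  exact: sheets_gauss_family.
have th1 : forall i : 'I_k, (i == i)%:R = 1 :> R by move=> i; rewrite eqxx.
have thC : forall i j : 'I_k, (i == j)%:R = (j == i)%:R :> R by move=> i j; rewrite eq_sym.
have sB := @split_cov_corners R N d k Q a b p (fun _ _ => 1) N0 a0 ab disj box_p
  (fun _ => erefl) (fun _ _ => erefl) (fun s => quad_ge0 s GB).
have sW := @split_cov_corners R N d k Q a b p (fun i j => (i == j)%:R) N0 a0 ab disj box_p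
  th1 thC (fun s => quad_ge0 s GW).
have GB' := gauss_family_lin (@split_comb R N d k Q a b p) GB.
have GW' := gauss_family_lin (@split_comb R N d k Q a b p) GW.
have mF : measurable ((@recompose R N d k Q a b p) @^-1` E).
  by rewrite -[_ @^-1` _]setTI; exact: measurable_recompose.
have := gauss_null_equiv GB' GW' sB sW _ mF.
set A := [set w | _]; set A' := [set w | _] => H.
have -> : A = (fun w j => lin (fun x => sheet_val B w x.2) (split_comb a b p j)) @^-1` (recompose a b p @^-1` E).
  apply/funext => w; rewrite /A /= recomposeE; congr E; apply/funext => r.
  by rewrite /sheet_val clampE//; exact: (orthant_p a0 box_p).
have -> : A' = (fun w j => lin (sheets_val W w) (split_comb a b p j)) @^-1` (recompose a b p @^-1` E).
  apply/funext => w; rewrite /A' /= recomposeE; congr E; apply/funext => r.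
  by rewrite /sheets_val /sheet_val /= clampE//; exact: (orthant_p a0 box_p).
(* Residuals of different boxes are uncorrelated in both models; within one box only the diagonal
   value 1 of [theta] enters, so the residual covariances agree. *)
apply: H => r r'; rewrite /split_K /=.
case: (eqVneq r.1.1 r'.1.1) => [rr|rr]; last by rewrite !(@residual_residual_off _ _ _ _ _ a b p).
rewrite /quad; apply: eq_big_seq => x xr; apply: eq_big_seq => y yr; congr (_ * _).
have h (u : 'I_k * Q * 'I_d) z : z \in residual_comb a b p u -> z.2.1 = u.1.1.
  by rewrite inE => /predU1P[->//|/mapP[e _ ->]].
by rewrite /theta_cov (h _ _ xr) (h _ _ yr) rr eqxx.
Qed.

End box_equivalence.

Lemma exists_natS_inv_lt (R : realType) (e : R) : 0 < e -> exists n, n.+1%:R^-1 < e.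
Proof.
move=> e0; have /cvgrPdist_lt/(_ _ e0)[n _ /(_ n (leqnn n))] := @cvg_harmonic R.
by rewrite /harmonic/= sub0r normrN ger0_norm ?invr_ge0// => h; exists n.
Qed.

(** * Analytic sets and capacity *)

Section analytic_sets.
Context (R : realType) (S : pseudoMetricType R).

(* Sequential closedness in the product of [S] with the Baire space. *)
Definition closed_rel (C : S -> (nat -> nat) -> Prop) :=
  forall x s, (forall n, exists y t, [/\ ball x n.+1%:R^-1 y,
    forall i, (i < n)%N -> t i = s i & C y t]) -> C x s.

(** Projections of closed subsets of [S] times the Baire space, that is, Suslin sets. *)
Definition analytic (A : set S) := exists C, closed_rel C /\ forall x, A x <-> exists s, C x s.

Lemma closure_ballP (A : set S) x : closure A x <-> forall n, exists2 y, ball x n.+1%:R^-1 y & A y.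
Proof.
split=> [clA n|h].
  have [|y [Ay xy]] := clA (ball x n.+1%:R^-1); last by exists y.
  by apply: nbhsx_ballx; rewrite invr_gt0.
move=> B /nbhs_ballP[e /= e0 eB].
have [n hn] := exists_natS_inv_lt e0.
have [y xy Ay] := h n; exists y; split => //; apply: eB.
exact: le_ball (ltW hn) _ xy.
Qed.

Lemma analytic_closed (F : set S) : closed F -> analytic F.
Proof.
move=> cF; exists (fun x _ => F x); split; last by move=> x; split => [h|[]//]; exists (fun=> 0%N).
move=> x s h; apply: cF; apply/closure_ballP => n.
by have [y [t [xy _ Fy]]] := h n; exists y.
Qed.

(** Coordinate 0 of the sequence codes the index in the union, and the shifted sequence is the
    witness. *)
Lemma analytic_bigcup (A : nat -> set S) : (forall n, analytic (A n)) -> analytic (\bigcup_n A n).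
Proof.
move=> /choice[C hC].
exists (fun x s => C (s 0%N) x (fun i => s i.+1)); split.
  move=> x s h; apply: (hC (s 0%N)).1 => n.
  have [y [t [xy ts Cyt]]] := h n.+1.
  exists y, (fun i => t i.+1); split.
  - by apply: le_ball xy; rewrite lef_pV2 ?posrE// ler_nat.
  - by move=> i hi; apply: ts.
  - by rewrite -(ts 0%N).
move=> x; split=> [[n _ /(hC n).2[s Cs]]|[s Cs]].
  by exists (fun i => if i is j.+1 then s j else n).
by exists (s 0%N) => //; apply/(hC (s 0%N)).2; exists (fun i => s i.+1).
Qed.

(** One sequence stores a witness for every [m], along the codes of the pairs [(m, j)]. *)
Lemma analytic_bigcap (A : nat -> set S) : (forall n, analytic (A n)) -> analytic (\bigcap_n A n).
Proof.
move=> /choice[C hC].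
pose c (m j : nat) := pickle (m, j).
exists (fun x s => forall m, C m x (fun j => s (c m j))); split.
  move=> x s h m; apply: (hC m).1 => n.
  (* Agreement below [M] includes the positions [c m j] for all [j < n]. *)
  pose M := (n + \sum_(j < n) (c m j).+1)%N.
  have [y [t [xy ts Cyt]]] := h M.
  exists y, (fun j => t (c m j)); split => //.
  - by apply: le_ball xy; rewrite lef_pV2 ?posrE// ler_nat ltnS leq_addr.
  - move=> i hi; apply: ts; rewrite /M (bigD1 (Ordinal hi))//=.
    by rewrite addnCA leq_addr.
move=> x; split=> [Ax|[s Cs] m _]; last by apply/(hC m).2; exists (fun j => s (c m j)).
have /choice[s hs] : forall m, exists s, C m x s by move=> m; apply/(hC m).2; exact: Ax.
exists (fun i => if unpickle i is Some (m, j) then s m j else 0%N) => m.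
by rewrite (_ : (fun j => _) = s m)//; apply/funext => j; rewrite /c pickleK.
Qed.

(** The closure of the set of points whose ball of radius [1 / (n + 1)] lies in [U] is still inside
    [U], which makes [U] a countable union of closed sets. *)
Lemma analytic_open (U : set S) : open U -> analytic U.
Proof.
move=> oU; pose F n := [set x : S | forall y, ball x n.+1%:R^-1 y -> U y].
have -> : U = \bigcup_n closure (F n).
  apply/seteqP; split=> [x Ux|x [n _ /closure_ballP/(_ n)[y xy]]]; last first.
    by apply; exact: ball_sym.
  have /nbhs_ballP[e /= e0 eU] := open_nbhs_nbhs (conj oU Ux).
  have [n hn] := exists_natS_inv_lt e0; exists n => //; apply: subset_closure => y xy.
  by apply: eU; exact: le_ball (ltW hn) _ xy.
by apply: analytic_bigcup => n; apply: analytic_closed; exact: closed_closure.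
Qed.

(** The sets that are analytic together with their complement form a sigma-algebra containing the
    open sets. *)
Lemma analytic_borel (A : set S) : <<s [set U : set S | open U] >> A -> analytic A.
Proof.
move=> bA; suff [] : [set A | analytic A /\ analytic (~` A)] A by [].
apply: smallest_sub bA.
  split.
  - split; first by apply: analytic_open; exact: open0.
    by rewrite setC0; apply: analytic_open; exact: openT.
  - by move=> B [h1 h2]; split; rewrite setTD ?setCK.
  - move=> B hB; split; first by apply: analytic_bigcup => n; have [] := hB n.
    by rewrite setC_bigcup; apply: analytic_bigcap => n; have [] := hB n.
move=> U oU; split; first exact: analytic_open.
by apply: analytic_closed; exact: open_closedC.
Qed.

End analytic_sets.

(** * Hitting events of a random compact set *)

Section capacity.
Context (R : realType) (S : pseudoMetricType R) d (T : measurableType d) (P : probability T R).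
Variable Phi : T -> set S.

Definition hit (A : set S) : set T := [set w | exists2 x, Phi w x & A x].

Hypothesis cPhi : forall w, compact (Phi w).
Hypothesis mhit : forall F, closed F -> measurable (hit F).

Lemma hit_subset A B : A `<=` B -> hit A `<=` hit B.
Proof. by move=> AB w [x Px Ax]; exists x => //; exact: AB. Qed.

Lemma hit_bigcup (A : nat -> set S) : hit (\bigcup_n A n) = \bigcup_n hit (A n).
Proof.
apply/seteqP; split=> [w [x Px [n _ Ax]]|w [n _ [x Px Ax]]]; first by exists n => //; exists x.
by exists x => //; exists n.
Qed.

(** Hitting points chosen for each [n] cluster in the compact [Phi w], and a cluster point lies in
    every [F m]. *)
Lemma hit_bigcap (F : nat -> set S) : (forall n, closed (F n)) ->
  (forall n m, (n <= m)%N -> F m `<=` F n) ->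
  \bigcap_n hit (F n) `<=` hit (\bigcap_n F n).
Proof.
move=> cF ndF w hw.
have /choice[x hx] : forall n, exists x, Phi w x /\ F n x.
  by move=> n; have [x ? ?] := hw n I; exists x.
have [|p [Pp clp]] := cPhi (w := w) (F := x @ \oo).
  by exists 0%N => // n _; exact: (hx n).1.
exists p => // m _; apply: cF => B nB.
have := clp (F m) B _ nB; apply.
by exists m => // n /= mn; exact: ndF mn _ (hx n).2.
Qed.

(** Outer probability at most [a], for sets whose measurability is still open. *)
Definition outer_le (a : \bar R) (E : set T) := exists F, [/\ measurable F, E `<=` F & (P F <= a)%E].

(** Continuity from below of outer probability: intersecting the covers from [n] on makes them
    increasing and still covers [E n]. *)
Lemma outer_le_bigcup a (E : nat -> set T) : (forall n m, (n <= m)%N -> E n `<=` E m) ->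
  (forall n, outer_le a (E n)) -> outer_le a (\bigcup_n E n).
Proof.
move=> ndE /choice[F hF].
pose G n := \bigcap_(m >= n) F m.
have mG n : measurable (G n).
  by apply: bigcap_measurable; [exists n => /=|move=> m _; have [] := hF m].
have mUG : measurable (\bigcup_n G n) by exact: bigcupT_measurable.
exists (\bigcup_n G n); split => //.
  move=> w [n _ En]; exists n => // m /= nm; have [_ + _] := hF m; apply.
  exact: ndE nm _ En.
have h : P (G n) @[n --> \oo] --> P (\bigcup_n G n).
  apply: nondecreasing_cvg_mu => // n m nm; apply/subsetPset => w Gw l /= ml.
  by apply: Gw => /=; exact: leq_trans ml.
rewrite -(cvg_lim (@ereal_hausdorff _) h); apply: lime_le.
  by apply/cvg_ex; exists (P (\bigcup_n G n)).
apply: nearW => n; have [mF _ le] := hF n; apply: le_trans le.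
by apply: le_measure; rewrite ?inE// => w; apply => /=.
Qed.

(* Choquet's capacitability: bound the Baire coordinates one at a time, keeping the
   outer probability of the hitting event above [a]. *)
Lemma capacity (A : set S) a : analytic A -> ~ outer_le a (hit A) ->
  exists F, [/\ closed F, F `<=` A & (a <= P (hit F))%E].
Proof.
move=> [C [cC AC]] nA.
(* Points of [A] with a witness bounded by [s] on its first [size s] coordinates. *)
pose D (s : seq nat) := [set x : S | exists t, C x t /\ forall i, (i < size s)%N -> (t i <= nth 0%N s i)%N].
have /choice[f hf] : forall s, exists m, ~ outer_le a (hit (D s)) -> ~ outer_le a (hit (D (rcons s m))).
  move=> s; apply: contrapT => /forallNP h; apply: (h 0%N) => hs; exfalso; apply: hs.
  have -> : D s = \bigcup_m D (rcons s m).
    apply/seteqP; split=> [x [t [Cx ts]]|x [m _ [t [Cx ts]]]].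
      exists (t (size s)) => //; exists t; split => // i.
      rewrite size_rcons ltnS leq_eqVlt => /predU1P[->|si]; first by rewrite nth_rcons ltnn eqxx.
      by rewrite nth_rcons si; exact: ts.
    exists t; split => // i si; have := ts i.
    by rewrite size_rcons nth_rcons si; apply; exact: ltnW.
  rewrite hit_bigcup; apply: outer_le_bigcup.
    move=> n m nm; apply: hit_subset => x [t [Cx ts]]; exists t; split => // i.
    rewrite size_rcons ltnS => si; have := ts i; rewrite size_rcons ltnS => /(_ si).
    rewrite !nth_rcons; case: ifP => // _; case: ifP => // _ h'; exact: leq_trans nm.
  by move=> m; apply: contrapT => hm; apply: (h m).
pose s n := iter n (fun s => rcons s (f s)) [::].
have ss n : size (s n) = n by elim: n => // n ih; rewrite /s/= size_rcons -/(s n) ih.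
have ns n : ~ outer_le a (hit (D (s n))).
  elim: n => [|n ih]; last exact: hf.
  suff -> : D (s 0%N) = A by [].
  by apply/seteqP; split => x; [case=> t [Cx _]; apply/AC; exists t|move/AC => [t Cx]; exists t].
pose b i := nth 0%N (s i.+1) i.
have sb n i : (i < n)%N -> nth 0%N (s n) i = b i.
  elim: n => // n ih; rewrite ltnS leq_eqVlt => /predU1P[->//|ni].
  by rewrite {1}/s/= -/(s n) nth_rcons ss ni; exact: ih.
have ndD n m : (n <= m)%N -> D (s m) `<=` D (s n).
  move=> nm x [t [Cx ts]]; exists t; split => // i; rewrite ss => ni.
  have im := leq_trans ni nm.
  by rewrite sb// -(sb m)//; apply: ts; rewrite ss.
pose F n := closure (D (s n)).
have cF n : closed (F n) by exact: closed_closure.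
have ndF n m : (n <= m)%N -> F m `<=` F n by move=> nm; apply: closureS; exact: ndD.
exists (\bigcap_n F n); split.
- by apply: closed_bigI => n _; exact: cF.
- move=> x hx; apply/AC.
  have /choice[y hy] : forall n, exists y : S * (nat -> nat), [/\ ball x n.+1%:R^-1 y.1, C y.1 y.2 &
      forall i, (i < n)%N -> (y.2 i <= b i)%N].
    move=> n; have /closure_ballP/(_ n)[y xy [t [Cy ts]]] := hx n I.
    by exists (y, t); split => //= i ni; rewrite -(sb n)//; apply: ts; rewrite ss.
  (* Each coordinate of the witnesses is eventually bounded by [b], hence constant along an
     ultrafilter: the compactness of a product of finite sets. *)
  have [G [uG oG]] := @ultraFilterLemma nat \oo _.
  have Gge m : G [set n | (m <= n)%N] by apply: oG; exists m.
  have /choice[t ht] : forall i, exists v, G [set n | (y n).2 i = v].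
    move=> i; apply: contrapT => /forallNP h.
    have H B : G [set n | forall v, (v <= B)%N -> (y n).2 i <> v].
      elim: B => [|B ih].
        have [h0|h0] := in_ultra_setVsetC [set n | (y n).2 i = 0%N] uG; first by have := h 0%N.
        by apply: filterS h0 => n /= hn v; rewrite leqn0 => /eqP ->.
      have [h0|h0] := in_ultra_setVsetC [set n | (y n).2 i = B.+1] uG; first by have := h B.+1.
      apply: filterS2 ih h0 => n /= h1 h2 v; rewrite leq_eqVlt => /predU1P[->//|].
      by rewrite ltnS; exact: h1.
    have [n [/= h1 h2]] := filter_ex (filterI (H (b i)) (Gge i.+1)).
    have [_ _ h3] := hy n; exact: (h1 _ (h3 i h2)).
  exists t; apply: cC => m.
  have Gm : G [set n | forall i, (i < m)%N -> (y n).2 i = t i].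
    elim: m => [|m ih]; first by apply: filterS (Gge 0%N).
    apply: filterS2 ih (ht m) => n /= h1 h2 i; rewrite ltnS leq_eqVlt => /predU1P[->//|].
    exact: h1.
  have [n [/= h1 h2]] := filter_ex (filterI Gm (Gge m)).
  have [h3 h4 _] := hy n; exists (y n).1, (y n).2; split => //.
  by apply: le_ball h3; rewrite lef_pV2 ?posrE// ler_nat.
(* Compactness gives continuity from above along the closed sets. Each term exceeds [a], since
   [hit (F n)] is a measurable cover of [hit (D (s n))]. *)
- have h : P (hit (F n)) @[n --> \oo] --> P (hit (\bigcap_n F n)).
    have -> : hit (\bigcap_n F n) = \bigcap_n hit (F n).
      apply/seteqP; split; last exact: hit_bigcap.
      by move=> w [x Px hx] n _; exists x => //; exact: hx.
    apply: nonincreasing_cvg_mu.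
    + by rewrite -ge0_fin_numE// fin_num_measure//; exact: mhit.
    + by move=> n; exact: mhit.
    + by apply: bigcapT_measurable => n; exact: mhit.
    + by move=> n m nm; apply/subsetPset/hit_subset/ndF.
  rewrite -(cvg_lim (@ereal_hausdorff _) h); apply: lime_ge.
    by apply/cvg_ex; exists (P (hit (\bigcap_n F n))).
  apply: nearW => n; rewrite leNgt; apply/negP => Pa; apply: (ns n).
  exists (hit (F n)); split; [exact: mhit| |exact: ltW].
  by apply: hit_subset; exact: subset_closure.
Qed.

Lemma hit_inner (A : set S) : analytic A -> measurable (hit A) -> (0 < P (hit A))%E ->
  exists F, [/\ closed F, F `<=` A & (0 < P (hit F))%E].
Proof.
move=> aA mA PA; have [r r0 rP] : exists2 r : R, 0 < r & (r%:E < P (hit A))%E.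
  have fP : P (hit A) \is a fin_num by exact: fin_num_measure.
  exists (fine (P (hit A)) / 2).
    by rewrite divr_gt0// -lte_fin fineK.
  rewrite -[ltRHS]fineK// lte_fin ltr_pdivrMr// mulr_natr mulr2n ltrDl.
  by rewrite -lte_fin fineK.
have [|F [cF FA Fr]] := @capacity A r%:E aA.
  move=> [F [mF AF Fr]]; have : (P (hit A) <= P F)%E by apply: le_measure; rewrite ?inE.
  by move=> h; have := lt_le_trans rP (le_trans h Fr); rewrite ltxx.
by exists F; split => //; apply: lt_le_trans Fr; rewrite lte_fin.
Qed.

(** The outer probability [al] is approached from inside by hits of closed subsets, through
    [capacity], and from outside by measurable covers. What lies between is null, and completeness
    makes it measurable. *)
Lemma measurable_hit (A : set S) : measure_is_complete P -> analytic A -> measurable (hit A).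
Proof.
move=> cP aA.
pose Sm := [set r : R | 0 <= r /\ outer_le r%:E (hit A)].
have Sm1 : Sm 1.
  by split => //; exists setT; split => //; rewrite [X in (X <= _)%E]probability_setT.
have hSm : has_inf Sm by split; [exists 1|exists 0 => r []].
pose al := inf Sm.
have al_low (n : nat) : exists F, [/\ closed F, F `<=` A & ((al - n.+1%:R^-1)%:E <= P (hit F))%E].
  apply: capacity => // -[F [mF AF PF]].
  have h0 : 0 <= al - n.+1%:R^-1 by rewrite -lee_fin (le_trans _ PF).
  have : al <= al - n.+1%:R^-1 by apply: ge_inf; [exact: hSm.2|split => //; exists F].
  by rewrite leNgt ltrBlDr ltrDl invr_gt0 ltr0n.
have al_up (n : nat) : exists F, [/\ measurable F, hit A `<=` F & (P F <= (al + n.+1%:R^-1)%:E)%E].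
  have n0 : 0 < n.+1%:R^-1 :> R by rewrite invr_gt0.
  have [r [r0 [F [mF AF PF]]] rl] := inf_adherent n0 hSm.
  by exists F; split => //; apply: le_trans PF _; rewrite lee_fin ltW.
have /choice[F hF] := al_low; have /choice[G hG] := al_up.
pose V := \bigcup_n hit (F n); pose H := \bigcap_n G n.
have mV : measurable V by apply: bigcupT_measurable => n; apply: mhit; have [] := hF n.
have mH : measurable H by apply: bigcapT_measurable => n; have [] := hG n.
have VA : V `<=` hit A by move=> w [n _]; apply: hit_subset; have [] := hF n.
have AH : hit A `<=` H by move=> w Aw n _; have [_ + _] := hG n; apply.
have eps (x y : \bar R) : (forall n : nat, (x <= y + (n.+1%:R^-1)%:E)%E) -> (x <= y)%E.
  move=> h; apply/lee_addgt0Pr => e e0.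
  have [n hn] := exists_natS_inv_lt e0; apply: le_trans (h n) _.
  by apply: leeD2l; rewrite lee_fin ltW.
have PH : (P H <= al%:E)%E.
  apply: eps => n; have [mG _ PG] := hG n.
  apply: le_trans PG; apply: le_measure; rewrite ?inE// => w; exact.
have PV : (al%:E <= P V)%E.
  apply: eps => n; have [cFn _ PF] := hF n.
  rewrite -leeBlDr// -EFinB; apply: le_trans PF _; apply: le_measure; rewrite ?inE//; first exact: mhit.
  by move=> w hw; exists n.
have HV : P (H `\` V) = 0%E.
  rewrite measureD//; last by rewrite -ge0_fin_numE// fin_num_measure.
  rewrite setIidr; last exact: subset_trans AH.
  apply/eqP; rewrite eq_le; apply/andP; split.
    by rewrite sube_le0 (le_trans PH).
  by rewrite sube_ge0 ?fin_num_measure//; apply: le_measure; rewrite ?inE//; exact: subset_trans AH.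
have -> : hit A = V `|` (hit A `\` V) by rewrite setDUK.
apply: measurableU => //; apply: cP; exists (H `\` V); split => //; first exact: measurableD.
by move=> w [Aw nV]; split => //; exact: AH.
Qed.

End capacity.

(** * Coincidences in rational boxes *)

Section boxes.
Context (R : realType) (N : nat).
Implicit Types (a b t : 'rV[R]_N).

Definition box a b : set 'rV[R]_N := [set t | forall l, a 0 l <= t 0 l <= b 0 l].

Definition ratrow n (q : 'rV[rat]_n) : 'rV[R]_n := \row_l ratr (q 0 l).

(** Clamped rational points form a countable dense family in a nonempty box, whatever its endpoints;
    clamping never increases the distance to a point of the box. *)
Definition box_pt a b (q : 'rV[rat]_N) : 'rV[R]_N :=
  \row_l Num.max (a 0 l) (Num.min (b 0 l) (ratr (q 0 l))).

Lemma compact_box a b : compact (box a b).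
Proof.
have := @rV_compact R N (fun l => `[a 0 l, b 0 l]%classic) (fun l => @segment_compact _ _ _).
by congr compact; apply/seteqP; split => t ht l; have := ht l; rewrite /= in_itv.
Qed.

Lemma box_ptP a b q : (forall l, a 0 l <= b 0 l) -> box a b (box_pt a b q).
Proof.
by move=> ab l; rewrite mxE le_max lexx /= ge_max ab ge_min lexx.
Qed.

Lemma rat_near (x e : R) : 0 < e -> exists q : rat, `|ratr q - x| < e.
Proof.
move=> e0; have [|q] := @rat_in_itvoo R (x - e) (x + e); first lra.
by rewrite in_itv/= => h; exists q; rewrite ltr_distl.
Qed.

Lemma ratrow_near n (x : 'rV[R]_n) (e : R) : 0 < e ->
  exists q : 'rV[rat]_n, forall l, `|ratr (q 0 l) - x 0 l| < e.
Proof.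
move=> e0; have /choice[f hf] : forall l, exists q : rat, `|ratr q - x 0 l| < e.
  by move=> l; exact: rat_near.
by exists (\row_l f l) => l; rewrite mxE.
Qed.

Lemma box_pt_near a b t (e : R) : box a b t -> 0 < e ->
  exists q, forall l, `|box_pt a b q 0 l - t 0 l| < e.
Proof.
move=> bt /(ratrow_near t)[q hq]; exists q => l; apply: le_lt_trans (hq l).
have /andP[h1 h2] := bt l; rewrite mxE.
move: (a 0 l) (b 0 l) (t 0 l) (ratr (q 0 l)) h1 h2 => x y z u xz zy.
case: (leP y u) => [yu|uy].
  rewrite (max_r (le_trans xz zy)) !ger0_norm ?subr_ge0 ?lerD2r//.
  exact: le_trans yu.
case: (leP x u) => // ux.
rewrite distrC [leRHS]distrC !ger0_norm ?subr_ge0//; first lra.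
by rewrite (le_trans (ltW ux)).
Qed.

End boxes.

Lemma rV_ballP (R : realType) n (x y : 'rV[R]_n) e : 0 < e ->
  ball x e y <-> forall l, `|x 0 l - y 0 l| < e.
Proof.
move=> e0; split=> [[_ h] l|h]; first exact: (h 0 l).
by split=> // i l; rewrite ord1; exact: h.
Qed.

Lemma ultra_fmap (T U : Type) (g : T -> U) (G : set_system T) :
  UltraFilter G -> UltraFilter (g @ G).
Proof.
move=> uG; split=> [|H pH GH]; first exact: fmap_proper_filter.
apply/seteqP; split => [A HA|]; last exact: GH.
have [//|GA] := in_ultra_setVsetC (g @^-1` A) uG.
by have [w []] := filter_ex (filterI HA (GH (~` A) GA)).
Qed.

(** * Sampling the common values of several fields *)

Section hitting_box.
Context (R : realType) (N d k : nat) (a b : 'I_k -> 'rV[R]_N).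
Hypothesis k0 : (0 < k)%N.
Hypothesis a0 : forall i l, 0 <= a i 0 l.
Hypothesis ab : forall i l, a i 0 l <= b i 0 l.
Notation index := ('I_k * 'rV[rat]_N * 'I_d)%type.

Definition common_values (f : 'I_k -> 'rV[R]_N -> 'rV[R]_d) : set 'rV[R]_d :=
  [set x | forall i, exists2 t, box (a i) (b i) t & f i t = x].

(* A countable description of [common_values f] meeting [F], through the values of
   the [f i] at the countable dense set of points [box_pt]. *)
Definition meets (F : set 'rV[R]_d) : set (pathspace R index) :=
  [set y | forall n, exists (q : {ffun 'I_k -> 'rV[rat]_N}) (c : 'rV[rat]_d),
    (forall i m, `|y (i, q i, m) - ratr (c 0 m)| < n.+1%:R^-1) /\
    exists2 x, F x & forall m, `|x 0 m - ratr (c 0 m)| < n.+1%:R^-1].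

Let box_orthant i : box (a i) (b i) `<=` @orthant R N.
Proof. by move=> t ht l; have /andP[h _] := ht l; exact: le_trans h. Qed.

Variable f : 'I_k -> 'rV[R]_N -> 'rV[R]_d.
Hypothesis cf : forall i, {within @orthant R N, continuous (f i)}.

Lemma compact_common_values : compact (common_values f).
Proof.
have cim i : compact (f i @` box (a i) (b i)).
  apply: continuous_compact; last exact: compact_box.
  exact: continuous_subspaceW (@box_orthant i) (@cf i).
have haus : hausdorff_space 'rV[R]_d by exact: norm_hausdorff.
have E : common_values f = \bigcap_i (f i @` box (a i) (b i)).
  apply/seteqP; split=> x hx i; first by move=> _; have [t ? ?] := hx i; exists t.
  by have [t ? ?] := hx i I; exists t.
apply: (@subclosed_compact _ _ (f (Ordinal k0) @` box (a (Ordinal k0)) (b (Ordinal k0)))) => //.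
- by rewrite E; apply: closed_bigI => i _; exact: compact_closed.
- by rewrite E => x; apply.
Qed.

(** Left to right is density of the sample points. Right to left, approximate coincidences at
    precision [1 / (n + 1)] pass to the limit along one ultrafilter, which makes the times in all
    boxes converge simultaneously. *)
Lemma meetsP (F : set 'rV[R]_d) : closed F ->
  (exists2 x, common_values f x & F x) <->
  meets F (fun r => f r.1.1 (box_pt (a r.1.1) (b r.1.1) r.1.2) 0 r.2).
Proof.
move=> cF; split=> [[x hx Fx] n|h].
- have e0 : 0 < n.+1%:R^-1 / 2 :> R by rewrite divr_gt0 ?invr_gt0.
  have [c hc] := ratrow_near x e0.
  have /choice[q hq] : forall i, exists q : 'rV[rat]_N,
      forall m, `|f i (box_pt (a i) (b i) q) 0 m - x 0 m| < n.+1%:R^-1 / 2.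
    move=> i; have [t bt ft] := hx i.
    have /subspace_continuousP/(_ t (box_orthant bt)) := @cf i.
    rewrite /from_subspace ft => /(_ _ (nbhsx_ballx x _ e0)).
    rewrite /= /within /= => /nbhs_ballP[dl /= dl0 hdl].
    have [q hq] := box_pt_near bt dl0; exists q => m.
    have /(rV_ballP _ _ e0)/(_ m) : ball x (n.+1%:R^-1 / 2) (f i (box_pt (a i) (b i) q)).
      apply: hdl; first by apply/(rV_ballP _ _ dl0) => l; rewrite distrC.
      by apply: box_orthant; apply: box_ptP.
    by rewrite distrC.
  exists [ffun i => q i], c; split.
    move=> i m /=; rewrite ffunE.
    have h1 := hq i m; have h2 := hc m.
    have := ler_normB (f i (box_pt (a i) (b i) (q i)) 0 m - x 0 m) (ratr (c 0 m) - x 0 m).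
    rewrite opprB addrA subrK => h3; apply: le_lt_trans h3 _.
    by rewrite [ltRHS]splitr ltrD.
  exists x => // m; rewrite distrC; apply: lt_trans (hc m) _.
  by rewrite ltr_pdivrMr// ltr_pMr ?invr_gt0// ltrDl.
- have /choice[qc hqc] : forall n, exists qc : ({ffun 'I_k -> 'rV[rat]_N} * 'rV[rat]_d) * 'rV[R]_d,
    [/\ forall i m, `|f i (box_pt (a i) (b i) (qc.1.1 i)) 0 m - ratr (qc.1.2 0 m)| < n.+1%:R^-1,
        F qc.2 & forall m, `|qc.2 0 m - ratr (qc.1.2 0 m)| < n.+1%:R^-1].
    by move=> n; have [q [c [h1 [x Fx h2]]]] := h n; exists (q, c, x).
  pose t i n := box_pt (a i) (b i) ((qc n).1.1 i).
  have bt i n : box (a i) (b i) (t i n) by exact: box_ptP.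
  have [G [uG oG]] := @ultraFilterLemma nat \oo _.
  have Gge m : G [set n | (m <= n)%N] by apply: oG; exists m.
  have /choice[t0 ht0] : forall i, exists t0, box (a i) (b i) t0 /\ t i n @[n --> G] --> t0.
    move=> i; have := @compact_box R N (a i) (b i); rewrite compact_ultra => /(_ (t i @ G)).
    have uF : UltraFilter (t i @ G) by exact: ultra_fmap.
    move=> /(_ uF); case; first by apply: (@filterE _ G) => n; exact: bt.
    by move=> t0 [? ?]; exists t0.
  have cvt i : f i (t i n) @[n --> G] --> f i (t0 i).
    have [b0 c0] := ht0 i.
    have /subspace_continuousP/(_ (t0 i) (box_orthant b0)) hc := @cf i.
    apply: cvg_comp hc => V /= hV; have := c0 _ hV; rewrite /= => hV'.
    by apply: (@filterS _ G _ _ _ _ hV') => n /=; apply; apply: box_orthant; exact: bt.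
  (* Three errors below [e / 3]: continuity at the limit time, and the distances of the sampled
     value and of [u n] to the rational center. *)
  have dist i x0 (u : nat -> 'rV[R]_d) (hu : forall n m, `|u n 0 m - ratr ((qc n).1.2 0 m)| < n.+1%:R^-1)
      (e : R) : 0 < e -> f i (t0 i) = x0 -> G [set n | forall m, `|x0 0 m - u n 0 m| < e].
    move=> e0 <-; have e3 : 0 < e / 3 by rewrite divr_gt0.
    have [M hM] := exists_natS_inv_lt e3.
    have := cvt i _ (nbhsx_ballx (f i (t0 i)) _ e3).
    move=> h1; have h2 := Gge M; apply: (@filterS2 _ G _ _ _ _ _ h1 h2) => {h1 h2} n /= h1 h2 m.
    have /(rV_ballP _ _ e3)/(_ m) := h1.
    have [h3 _ _] := hqc n; have := h3 i m; have := hu n m; rewrite -/(t i n).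
    have hn : n.+1%:R^-1 < e / 3.
      by apply: le_lt_trans hM; rewrite lef_pV2 ?posrE// ler_nat.
    move: (u n 0 m) (ratr _) (f i (t i n) 0 m) (f i (t0 i) 0 m) (n.+1%:R^-1) hn => x1 x2 x3 x4 z hz.
    rewrite !ltr_norml => /andP[p1 p2] /andP[p3 p4] /andP[p5 p6]; apply/andP; split; lra.
  exists (f (Ordinal k0) (t0 (Ordinal k0))).
    move=> i; exists (t0 i); first by have [] := ht0 i.
    apply/rowP => m; apply/eqP/negPn/negP => neq.
    pose e := `|f i (t0 i) 0 m - f (Ordinal k0) (t0 (Ordinal k0)) 0 m|.
    have e0 : 0 < e / 2 by rewrite divr_gt0// normr_gt0 subr_eq0.
    have hu n m' : `|f i (t i n) 0 m' - ratr ((qc n).1.2 0 m')| < n.+1%:R^-1.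
      by have [h1 _ _] := hqc n; exact: h1.
    have g1 := dist i _ _ hu _ e0 erefl.
    have g2 := dist (Ordinal k0) _ _ hu _ e0 erefl.
    have [n [/= /(_ m) h1 /(_ m) h2]] := filter_ex (filterI g1 g2).
    have : e < e / 2 + e / 2.
      apply: le_lt_trans (ltrD h1 h2).
      by rewrite [X in _ <= _ + X]distrC; exact: ler_distD.
    by rewrite -splitr ltxx.
  apply: cF; apply/closure_ballP => n.
  have hu n' m' : `|(qc n').2 0 m' - ratr ((qc n').1.2 0 m')| < n'.+1%:R^-1.
    by have [_ _ h2] := hqc n'; exact: h2.
  have e0 : 0 < n.+1%:R^-1 :> R by rewrite invr_gt0.
  have [n' /= h1] := filter_ex (dist (Ordinal k0) _ _ hu _ e0 erefl).
  exists (qc n').2; first by apply/(rV_ballP _ _ e0).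
  by have [] := hqc n'.
Qed.

End hitting_box.

Lemma bigcup_countable_measurable (I : countType) dT (T : measurableType dT) (E : I -> set T) :
  (forall i, measurable (E i)) -> measurable (\bigcup_i E i).
Proof.
move=> mE; pose F n := if unpickle n is Some i then E i else set0.
have -> : \bigcup_i E i = \bigcup_n F n.
  apply/seteqP; split=> [w [i _ Ew]|w [n _]].
    by exists (pickle i) => //; rewrite /F pickleK.
  by rewrite /F; case: (unpickle n) => // i Ew; exists i.
by apply: bigcupT_measurable => n; rewrite /F; case: (unpickle n).
Qed.

Lemma measurable_meets (R : realType) (N d k : nat) (F : set 'rV[R]_d) :
  measurable (@meets R N d k F).
Proof.
pose E (n : nat) (qc : {ffun 'I_k -> 'rV[rat]_N} * 'rV[rat]_d) : set (pathspace R ('I_k * 'rV[rat]_N * 'I_d)) :=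
  [set y | (forall i m, `|y (i, qc.1 i, m) - ratr (qc.2 0 m)| < n.+1%:R^-1) /\
    exists2 x, F x & forall m, `|x 0 m - ratr (qc.2 0 m)| < n.+1%:R^-1].
have -> : @meets R N d k F = \bigcap_n \bigcup_qc E n qc.
  apply/seteqP; split=> [y hy n _|y hy n].
    by have [q [c hqc]] := hy n; exists (q, c).
  by have [[q c] _ hqc] := hy n I; exists q, c.
apply: bigcapT_measurable => n; apply: bigcup_countable_measurable => -[q c].
have -> : E n (q, c) = (\bigcap_(im in [set: 'I_k * 'I_d])
      [set y | `|y (im.1, q im.1, im.2) - ratr (c 0 im.2)| < n.+1%:R^-1]) `&`
    [set y | exists2 x, F x & forall m, `|x 0 m - ratr (c 0 m)| < n.+1%:R^-1].
  apply/seteqP; split=> [y [h1 h2]|y [h1 h2]]; split => //.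
    by move=> [i m] _; exact: h1.
  by move=> i m; exact: (h1 (i, m)).
apply: measurableI.
  apply: fin_bigcap_measurable => [|[i m] _ /=]; first exact: finite_finset.
  set z : R := ratr _; set e : R := _^-1.
  have := @measurable_coord R _ ((i, q i, m) : 'I_k * 'rV[rat]_N * 'I_d) measurableT _ (measurable_itv `](z - e), (z + e)[).
  rewrite setTI; congr measurable; apply/seteqP; split => y /=; by rewrite in_itv/= ltr_distl.
(* The condition on [F] does not involve the path, so this set is everything or empty. *)
case: (pselect (exists2 x, F x & forall m, `|x 0 m - ratr (c 0 m)| < n.+1%:R^-1)) => h.
  by rewrite (_ : [set y | _] = setT)//; apply/seteqP; split.
by rewrite (_ : [set y | _] = set0)//; apply/seteqP; split.
Qed.

(** * Rational boxes around parameters with distinct coordinates *)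

Section rational_boxes.
Context (R : realType) (N k : nat).
Notation boxes := ('M[rat]_(k, N) * 'M[rat]_(k, N))%type.
Implicit Type be : boxes.

Definition lower be i : 'rV[R]_N := ratrow R (row i be.1).

Definition upper be i : 'rV[R]_N := ratrow R (row i be.2).

Definition separated_boxes : set boxes := [set be | [/\ forall i l, 0 < lower be i 0 l,
  forall i l, lower be i 0 l < upper be i 0 l &
  forall i j l, i != j -> upper be i 0 l < lower be j 0 l \/ upper be j 0 l < lower be i 0 l]].

Lemma distinct_coordsP (t : 'I_k -> 'rV[R]_N) : distinct_coords t <->
  exists2 be, separated_boxes be & forall i, box (lower be i) (upper be i) (t i).
Proof.
split=> [[t0 tt]|[be [be0 _ bed] bt]].
(* [g] collects the coordinates, at [i = j], and the gaps between them, so one bound [e] controls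
   both. Margins of [e / 3] then keep the boxes positive and separated. *)
- pose g (x : 'I_N * 'I_k * 'I_k) := if x.1.2 == x.2 then t x.2 0 x.1.1
    else `|t x.1.2 0 x.1.1 - t x.2 0 x.1.1|.
  have g0 x : 0 < g x.
    case: x => [[l i] j]; rewrite /g /=; case: eqVneq => [//|ij].
    rewrite normr_gt0 subr_eq0; apply/eqP => e.
    case: (ltngtP i j) => [h|h|/val_inj h].
    + exact: tt h e.
    + exact: tt h (esym e).
    + by move: ij; rewrite h eqxx.
  have [e e0 he] := finite_pos_lower_bound g0.
  have e3 : 0 < e / 3 by rewrite divr_gt0.
  have /choice[u hu] : forall x : 'I_k * 'I_N, exists u : rat * rat,
      t x.1 0 x.2 - e / 3 < ratr u.1 < t x.1 0 x.2 /\
      t x.1 0 x.2 < ratr u.2 < t x.1 0 x.2 + e / 3.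
    move=> [i l] /=.
    have [|u] := @rat_in_itvoo R (t i 0 l - e / 3) (t i 0 l); first lra.
    have [|v] := @rat_in_itvoo R (t i 0 l) (t i 0 l + e / 3); first lra.
    by rewrite !in_itv/= => hv hu; exists (u, v).
  exists (\matrix_(i, l) (u (i, l)).1, \matrix_(i, l) (u (i, l)).2); last first.
    move=> i l; rewrite !mxE /=.
    by have [/andP[_ /ltW ->] /andP[/ltW -> _]] := hu (i, l).
  split=> [i l|i l|i j l ij]; rewrite !mxE /=.
  + have [/andP[h _] _] := hu (i, l); apply: lt_trans h => /=.
    have := he (l, i, i); rewrite /g /= eqxx => h; lra.
  + have [/andP[_ h] /andP[h' _]] := hu (i, l); exact: lt_trans h'.
  + have [/andP[h1 h2] /andP[h3 h4]] := hu (i, l).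
    have [/andP[h5 h6] /andP[h7 h8]] := hu (j, l).
    have := he (l, i, j); rewrite /g /= (negPf ij) => h.
    move: h1 h2 h3 h4 h5 h6 h7 h8; rewrite /= => h1 h2 h3 h4 h5 h6 h7 h8.
    case: (leP (t i 0 l) (t j 0 l)) => tij.
      by left; move: h; rewrite distrC ger0_norm ?subr_ge0// => h; lra.
    by right; move: h; rewrite ger0_norm ?subr_ge0 ?(ltW tij)// => h; lra.
- split=> [i l|l i j ij e]; first by have /andP[+ _] := bt i l; exact: lt_le_trans.
  have /andP[h1 h2] := bt i l; have /andP[h3 h4] := bt j l.
  have [|h|h] := bed i j l; first by rewrite neq_ltn ij.
  + by have := lt_le_trans (le_lt_trans h2 h) h3; rewrite e ltxx.
  + by have := lt_le_trans (le_lt_trans h4 h) h1; rewrite e ltxx.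
Qed.

End rational_boxes.

(** * Positivity of the coincidence event *)

Section coincidence.
Context (R : realType) (N d k : nat) dT (T : measurableType dT) (P : probability T R).
Variable X : 'I_k -> T -> 'rV[R]_N -> 'rV[R]_d.
Hypothesis k0 : (0 < k)%N.
Hypothesis cX : forall i w, {within @orthant R N, continuous (X i w)}.
Hypothesis mX : forall i t m, orthant t -> measurable_fun setT (fun w => X i w t 0 m).
Notation boxes := ('M[rat]_(k, N) * 'M[rat]_(k, N))%type.

Definition coincidence_values (be : boxes) w :=
  common_values (lower R be) (upper R be) (fun i => X i w).

Definition sampled_meets (be : boxes) (F : set 'rV[R]_d) := [set w | meets F
  (fun r => X r.1.1 w (box_pt (lower R be r.1.1) (upper R be r.1.1) r.1.2) 0 r.2)].

Lemma coincidence_hit A :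
  coincidence_event X A = \bigcup_(be in @separated_boxes R N k) hit (coincidence_values be) A.
Proof.
apply/seteqP; split=> [w [t [/distinct_coordsP[be sbe bt] [x [Ax tx]]]]|w [be sbe [x hx Ax]]].
  by exists be => //; exists x => // i; exists (t i).
have /choice[t ht] : forall i, exists t, box (lower R be i) (upper R be i) t /\ X i w t = x.
  by move=> i; have [t ? ?] := hx i; exists t.
exists t; split; first by apply/distinct_coordsP; exists be => // i; exact: (ht i).1.
by exists x; split=> // i; exact: (ht i).2.
Qed.

Section one_box.
Variable be : boxes.
Hypothesis sbe : separated_boxes R be.

Let lo0 i l : 0 <= lower R be i 0 l.
Proof. by have [h _ _] := sbe; exact: ltW. Qed.

Let lohi i l : lower R be i 0 l <= upper R be i 0 l.
Proof. by have [_ h _] := sbe; exact: ltW. Qed.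

Let compact_values w : compact (coincidence_values be w).
Proof. exact: (@compact_common_values R N d k _ _ k0 lo0 _ (cX^~ w)). Qed.

Let hit_closed F : closed F -> hit (coincidence_values be) F = sampled_meets be F.
Proof.
move=> cF; apply/seteqP; split=> w.
  by move=> h; apply/(@meetsP R N d k _ _ k0 lo0 lohi _ (cX^~ w) F cF).
by move=> h; apply/(@meetsP R N d k _ _ k0 lo0 lohi _ (cX^~ w) F cF).
Qed.

Let measurable_hit_closed F : closed F -> measurable (hit (coincidence_values be) F).
Proof.
move=> cF; rewrite hit_closed//.
have mp : measurable_fun setT (fun w => (fun r => X r.1.1 w
    (box_pt (lower R be r.1.1) (upper R be r.1.1) r.1.2) 0 r.2)
    : pathspace R ('I_k * 'rV[rat]_N * 'I_d)).
  apply: measurable_path => -[[i q] m] /=; apply: mX => l.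
  by have /andP[h _] := @box_ptP R N _ _ q (lohi i) l; exact: le_trans h.
by have := mp measurableT _ (@measurable_meets R N d k F); rewrite setTI.
Qed.

Lemma measurable_coincidence_box A : measure_is_complete P -> borel A ->
  measurable (hit (coincidence_values be) A).
Proof.
move=> cP /analytic_borel; exact: (measurable_hit (P := P) compact_values measurable_hit_closed).
Qed.

(** Closed subsets turn hitting into [sampled_meets], a cylinder event on which the two models can
    be compared. *)
Lemma coincidence_box_pos A : measure_is_complete P -> borel A ->
  (0 < P (hit (coincidence_values be) A))%E <->
  exists F, [/\ closed F, F `<=` A & (0 < P (sampled_meets be F))%E].
Proof.
move=> cP bA; have mA := measurable_coincidence_box cP bA; split=> [PA|[F [cF FA PF]]].
  have [F [cF FA PF]] := hit_inner compact_values measurable_hit_closed (analytic_borel bA) mA PA.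
  by exists F; rewrite -hit_closed.
apply: lt_le_trans PF _; rewrite -hit_closed//; apply: le_measure; rewrite ?inE//.
  exact: measurable_hit_closed.
exact: hit_subset.
Qed.

End one_box.

Lemma coincidence_pos A : measure_is_complete P -> borel A ->
  (0 < P (coincidence_event X A))%E <->
  exists2 be, @separated_boxes R N k be &
    exists F, [/\ closed F, F `<=` A & (0 < P (sampled_meets be F))%E].
Proof.
move=> cP bA.
have mE (be : boxes) : measurable
    (if be \in @separated_boxes R N k then hit (coincidence_values be) A else set0).
  by case: ifPn => // /set_mem sbe; exact: measurable_coincidence_box.
rewrite coincidence_hit bigcup_mkcond; split=> [PA|[be sbe /coincidence_box_pos PF]].
  (* There are countably many rational boxes, so if none were hit with positive probability the
     union would be null. *)
  apply: contrapT => h; suff E0 : P (\bigcup_be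
      (if be \in @separated_boxes R N k then hit (coincidence_values be) A else set0)) = 0%E.
    by move: PA; rewrite E0 ltxx.
  pose G n := if unpickle n is Some be then
    (if be \in @separated_boxes R N k then hit (coincidence_values be) A else set0) else set0.
  apply: (@subset_measure0 _ _ _ P _ (\bigcup_n G n)).
  - exact: bigcup_countable_measurable.
  - by apply: bigcupT_measurable => n; rewrite /G; case: (unpickle n).
  - by move=> w [be _ hw]; exists (pickle be) => //; rewrite /G pickleK.
  apply: measure_negligible; first by apply: bigcupT_measurable => n; rewrite /G; case: (unpickle n).
  apply: negligible_bigcup => n; rewrite /G.
  case: (unpickle n) => [be|]; last exact: negligible_set0.
  case: ifPn => [/set_mem sbe|_]; last exact: negligible_set0.
  apply/negligibleP; first exact: measurable_coincidence_box.
  apply/eqP; rewrite eq_le measure_ge0 andbT leNgt; apply/negP.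
  by move=> /(coincidence_box_pos sbe cP bA) hF; apply: h; exists be.
apply: lt_le_trans (PF sbe cP bA) _; apply: le_measure; rewrite ?inE//.
- exact: measurable_coincidence_box.
- exact: bigcup_countable_measurable.
by move=> w hw; exists be => //; rewrite mem_set.
Qed.

End coincidence.

Theorem theorem1p2 (R : realType) (N d : nat) (hN : (1 <= N)%N) (hd : (1 <= d)%N)
    (dT : measure_display) (T : measurableType dT) (P : probability T R)
    (hP : measure_is_complete P)
    (B : T -> 'rV[R]_N -> 'rV[R]_d) (hB : brownian_sheet P B)
    (A : set 'rV[R]_d) (hA : borel A)
    (k : nat) (hk : (2 <= k)%N)
    (dT' : measure_display) (T' : measurableType dT') (P' : probability T' R)
    (hP' : measure_is_complete P')
    (W : 'I_k -> T' -> 'rV[R]_N -> 'rV[R]_d)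
    (hW : forall i : 'I_k, brownian_sheet P' (W i))
    (hWi : independent_fields P' W) :
  (0 < P (coincidence_event (fun _ : 'I_k => B) A))%E <->
  (0 < P' (coincidence_event W A))%E.
Proof.
have k0 : (0 < k)%N by exact: ltnW.
have mval d1 (T1 : measurableType d1) (P1 : probability T1 R) (X : T1 -> 'rV[R]_N -> 'rV[R]_d) :
    brownian_sheet P1 X -> forall t m, orthant t -> measurable_fun setT (fun w => X w t 0 m).
  by move=> hX t m ot; have := measurable_sheet_val hX (t, m); rewrite /sheet_val /= clampE.
have -> := coincidence_pos k0 (fun _ => bs_continuous hB) (fun _ => mval _ _ _ _ hB) hP hA.
have -> := coincidence_pos k0 (fun i => bs_continuous (hW i)) (fun i => mval _ _ _ _ (hW i)) hP' hA.
(* The box and the closed set are deterministic, so the same pair serves in both models;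
   [box_null_equiv] says that the cylinder event is null in both or in neither. *)
have same be F : separated_boxes R be ->
    (0 < P (sampled_meets (fun _ => B) be F))%E <-> (0 < P' (sampled_meets W be F))%E.
  move=> [be0 bel bed].
  have bp i q l : lower R be i 0 l <= box_pt (lower R be i) (upper R be i) q 0 l <= upper R be i 0 l.
    by apply: box_ptP => l'; exact: ltW.
  have := box_null_equiv hN be0 bel bed bp hB hW hWi (measurable_meets F).
  rewrite !lt0e !measure_ge0 !andbT => h.
  by split=> /eqP n0; apply/eqP => /h.
by split=> -[be sbe [F [cF FA PF]]]; exists be => //; exists F; split=> //; apply/same.
Qed.
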